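(* Let $\mathcal{G}$ be an arithmetical semigroup (Beurling number system) satisfying Axiom A with constants $\kappa>0$, $A>0$, $0<\theta<1$. Let $\rho_0=\beta_0+i\gamma_0$ be a zero of the Beurling zeta function $\zeta_{\mathcal{G}}$ with $\beta_0>\theta$. Then for every $\varepsilon>0$ there are arbitrarily large values of $x$ such that $$|\Delta(x)|\ge (1-\varepsilon)\frac{x^{\beta_0}}{|\rho_0|};$$ moreover, if $\gamma_0\neq 0$, then for every $\varepsilon>0$ there are arbitrarily large values of $x$ such that $$|\Delta(x)|\ge \left(\frac{\pi}{2}-\varepsilon\right)\frac{x^{\beta_0}}{|\rho_0|}.$$
   Context: An arithmetical semigroup $\mathcal{G}$ is a unitary commutative semigroup freely generated by a countable set $\mathcal{P}$ of primes (every element has an essentially unique factorization into primes), equipped with a multiplicative norm $|\cdot|:\mathcal{G}\to\mathbb{R}_+$ such that the set of norms is locally finite; the unit has norm 1 and all other elements have norm $>1$. Let $\mathcal{N}(x):=\#\{g\in\mathcal{G}: |g|\le x\}$. Axiom A with constants $\kappa>0$, $A>0$, $0<\theta<1$ means: $|\mathcal{N}(x)-\kappa(x-1)|\le A x^{\theta}$ for all $x\ge 1$. The Beurling zeta function is $\zeta_{\mathcal{G}}(s)=\sum_{g\in\mathcal{G}}|g|^{-s}=\int_1^\infty x^{-s}\,d\mathcal{N}(x)$, which under Axiom A extends meromorphically to $\Re s>\theta$ with only a simple pole at $s=1$; zeros are understood for this continuation. The von Mangoldt function is $\Lambda(g)=\log|p|$ if $g=p^k$ for a prime $p\in\mathcal{P}$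 and $k\ge1$, and $0$ otherwise; $\psi(x)=\sum_{|g|\le x}\Lambda(g)$ and $\Delta(x)=\psi(x)-x$. *)

(* Defs.v *)
From Stdlib Require Import Reals List Permutation ClassicalEpsilon.
From Coquelicot Require Import Coquelicot.

Open Scope R_scope.

Section MonoidProducts.
Context {T : Type} (e : T) (op : T -> T -> T).

Definition mprod (l : list T) : T := fold_right op e l.

Definition mpow (x : T) (k : nat) : T := mprod (repeat x k).
End MonoidProducts.

(* [as_factor_exists] and [as_factor_unique] together say that the monoid is
   free commutative on the set [as_prime]. Local finiteness of the norm is the
   finiteness of every set { g | |g| <= x }, so that N(x) is finite. *)
Record arith_semigroup : Type := ArithSemigroup {
  as_carrier :> Type;
  as_one : as_carrier;
  as_mul : as_carrier -> as_carrier -> as_carrier;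
  as_mulA : forall a b c, as_mul a (as_mul b c) = as_mul (as_mul a b) c;
  as_mulC : forall a b, as_mul a b = as_mul b a;
  as_mul1 : forall a, as_mul as_one a = a;
  as_prime : as_carrier -> Prop;
  as_prime_countable : exists code : as_carrier -> nat,
    forall p q, as_prime p -> as_prime q -> code p = code q -> p = q;
  as_factor_exists : forall g, exists l : list as_carrier,
    List.Forall as_prime l /\ g = mprod as_one as_mul l;
  as_factor_unique : forall l l' : list as_carrier,
    List.Forall as_prime l -> List.Forall as_prime l' ->
    mprod as_one as_mul l = mprod as_one as_mul l' -> Permutation l l';
  as_norm : as_carrier -> R;
  as_norm_mul : forall a b, as_norm (as_mul a b) = as_norm a * as_norm b;
  as_norm_one : as_norm as_one = 1;
  as_norm_gt1 : forall g, g <> as_one -> 1 < as_norm g;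
  as_norm_finite : forall x : R, exists l : list as_carrier,
    NoDup l /\ forall g, In g l <-> as_norm g <= x
}.

Arguments as_one {_}.
Arguments as_mul {_} _ _.
Arguments as_prime {_} _.
Arguments as_norm {_} _.

(* A duplicate-free enumeration, in an unspecified order, of the elements of
   norm at most x; it is only used through its length and commutative sums. *)
Definition norm_ball (G : arith_semigroup) (x : R) : list G :=
  proj1_sig (constructive_indefinite_description _ (as_norm_finite G x)).

Definition count_N (G : arith_semigroup) (x : R) : R :=
  INR (length (norm_ball G x)).

Definition axiom_A (G : arith_semigroup) (kappa A theta : R) : Prop :=
  forall x : R, 1 <= x ->
    Rabs (count_N G x - kappa * (x - 1)) <= A * Rpower x theta.

Definition is_prime_power {G : arith_semigroup} (g p : G) : Prop :=
  as_prime p /\ exists k : nat, (1 <= k)%nat /\ g = mpow as_one as_mul p k.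

(* The prime p with g = p^k, k >= 1, is unique by unique factorization, so the
   value does not depend on the choice made here. *)
Definition von_mangoldt {G : arith_semigroup} (g : G) : R :=
  match excluded_middle_informative (exists p : G, is_prime_power g p) with
  | left h => ln (as_norm (proj1_sig (constructive_indefinite_description _ h)))
  | right _ => 0
  end.

Definition beurling_psi (G : arith_semigroup) (x : R) : R :=
  fold_right Rplus 0 (map von_mangoldt (norm_ball G x)).

Definition beurling_Delta (G : arith_semigroup) (x : R) : R := beurling_psi G x - x.

(* r^s = exp (s log r) for r > 0 and complex s. *)
Definition cpow (r : R) (s : C) : C :=
  (exp (Re s * ln r) * cos (Im s * ln r), exp (Re s * ln r) * sin (Im s * ln r)).

(* The sum of |g|^(-s) over |g| <= x, that is, the integral of u^(-s) dN(u)
   up to x. *)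
Definition zeta_partial (G : arith_semigroup) (s : C) (x : R) : C :=
  fold_right Cplus (RtoC 0)
    (map (fun g : G => cpow (as_norm g) (Copp s)) (norm_ball G x)).

(* Complex differentiability at every point of the open half-plane. *)
Definition holomorphic_right_of (theta : R) (f : C -> C) : Prop :=
  forall s : C, theta < Re s -> ex_derive (K := C_AbsRing) (V := C_NormedModule) f s.

Definition meromorphic_simple_pole_at_1 (theta : R) (f : C -> C) : Prop :=
  exists h : C -> C,
    holomorphic_right_of theta h /\
    h (RtoC 1) <> RtoC 0 /\
    forall s : C, theta < Re s -> s <> RtoC 1 ->
      f s = Cdiv (h s) (Cminus s (RtoC 1)).

(* [zeta] is the continuation to Re s > theta of the Beurling zeta function.
   As a total function it has a meaningless value at the pole s = 1 (and for
   Re s <= theta). *)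
Definition is_beurling_zeta (G : arith_semigroup) (theta : R) (zeta : C -> C) : Prop :=
  (forall s : C, 1 < Re s ->
     filterlim (zeta_partial G s) (Rbar_locally p_infty) (locally (zeta s))) /\
  meromorphic_simple_pole_at_1 theta zeta.

(* Main.v *)
Require Import Defs.
From Stdlib Require Import Reals Lra Lia Psatz List Permutation Classical ClassicalEpsilon.
From Coquelicot Require Import Coquelicot.
Import ListNotations.

Open Scope R_scope.

(** Put [h(s) = (s-1) zeta(s)] and [a(u) = Delta(e^u)], with Laplace transform
    [D(s)]. From [ln |g| = sum_{d | g} Lambda(d)] one gets [h' = -(1 + s D) h]
    for [Re s > 1]. If [|Delta(x)| <= c x^beta0 / |rho0|] for large [x], then [D]
    is holomorphic on [Re s > beta0], and by unique continuation
    [h exp(E) = const <> 0] there, where [E] is a primitive of [1 + s D]. Let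
    [s = rho0 + r] with [r] decreasing to [0]. On one side [|h(s)| = O(r)]. On the
    other side [-Re (s D(s))] is at most
    [c int_0^oo e^(-ru) |cos(gamma0 u - arg rho0)| du + O(1)], hence at most
    [c mu / r + O(1)] with [mu = 1], or with [mu = 2/PI], the mean of [|cos|], when
    [gamma0 <> 0]. Integrating, [|h(s)|] is at least a constant times
    [r^(c mu)], which forces [c mu >= 1]. *)

(** From [- zeta'/zeta = s int_0^oo psi(e^u) e^(-su) du = s D + s/(s-1)] and
    [h'/h = zeta'/zeta + 1/(s-1)], the poles at 1 cancel and leave the [1] of [1 + s D]. The
    obstacle is that on [Re s > beta0] nothing is known beforehand about the zeros of [h], so that
    neither [log h] nor [h'/h] is available there. Exponentiating a primitive of the controlled side
    gives a product that is holomorphic whatever [h] does. Its constant value is nonzero for a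
    similar reason: on half-planes inside [Re s > 1] the same identity would spread a zero of [h]
    over all of [Re s > 1] and, by continuity, to the point 1, where [h] does not vanish. The factor
    [|rho0|] comes from [Re (rho0 e^(-i gamma0 u)) = |rho0| cos(gamma0 u - arg rho0)] and cancels
    the denominator of the assumed bound. A multiple zero only makes [|h|] smaller than the [O(r)]
    that is used. *)

Definition ccont (f : R -> C) (t : R) : Prop :=
  continuous (fun u => Re (f u)) t /\ continuous (fun u => Im (f u)) t.

(** Curves and their integrals are treated coordinate by coordinate, so that the real theory of
    derivatives and Riemann integrals applies directly. *)
Definition curve_deriv (f : R -> C) (t : R) (l : C) : Prop :=
  is_derive (fun u => Re (f u)) t (Re l) /\ is_derive (fun u => Im (f u)) t (Im l).

Definition is_Cint (f : R -> C) (a b : R) (l : C) : Prop :=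
  is_RInt (fun t => Re (f t)) a b (Re l) /\ is_RInt (fun t => Im (f t)) a b (Im l).

Definition Cint (f : R -> C) (a b : R) : C :=
  (RInt (fun t => Re (f t)) a b, RInt (fun t => Im (f t)) a b).

Definition ex_Cint (f : R -> C) (a b : R) : Prop :=
  ex_RInt (fun t => Re (f t)) a b /\ ex_RInt (fun t => Im (f t)) a b.

(* Complex differentiability in terms of the modulus: Coquelicot's uniform
   structure on [C] is the one of the sup norm. *)
Definition cderiv (f : C -> C) (s l : C) : Prop :=
  forall eps, 0 < eps -> exists d, 0 < d /\ forall z, Cmod (z - s) < d ->
    Cmod (f z - f s - l * (z - s)) <= eps * Cmod (z - s).

(** * Modulus estimates and complex derivatives *)

Lemma Re_le_Cmod (z : C) : Rabs (Re z) <= Cmod z.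
Proof. eapply Rle_trans; [apply Rmax_l | apply (Rmax_Cmod z)]. Qed.

Lemma Im_le_Cmod (z : C) : Rabs (Im z) <= Cmod z.
Proof. eapply Rle_trans; [apply Rmax_r | apply (Rmax_Cmod z)]. Qed.

Lemma Cmod_le_Re_Im (z : C) : Cmod z <= Rabs (Re z) + Rabs (Im z).
Proof.
  replace z with ((RtoC (Re z) + RtoC (Im z) * Ci)%C).
  2: { destruct z; unfold Re, Im, Ci, RtoC, Cplus, Cmult; simpl; f_equal; ring. }
  eapply Rle_trans; [apply Cmod_triangle |].
  rewrite Cmod_mult, Cmod_Ci, !Cmod_R.
  destruct z; unfold Re, Im, Ci, RtoC, Cplus, Cmult; simpl.
  right; f_equal; [f_equal; ring | rewrite Rmult_1_r; f_equal; ring].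
Qed.

Lemma Cmod_triangle_minus (x y : C) : Cmod (x - y) <= Cmod x + Cmod y.
Proof. unfold Cminus. rewrite <- (Cmod_opp y). apply Cmod_triangle. Qed.

Lemma Cmod_minus_sym (x y : C) : Cmod (x - y) = Cmod (y - x).
Proof. rewrite <- Cmod_opp. f_equal. ring. Qed.

Lemma Cmod_minus_triangle (x y z : C) : Cmod (x - z) <= Cmod (x - y) + Cmod (y - z).
Proof. replace (x - z)%C with ((x - y) + (y - z))%C by ring. apply Cmod_triangle. Qed.

Lemma Cmod_small_eq0 (z : C) : (forall eps, 0 < eps -> Cmod z <= eps) -> z = RtoC 0.
Proof.
  intros H. apply Cmod_eq_0. destruct (Req_dec (Cmod z) 0) as [|Hn]; auto.
  assert (Hp := Cmod_ge_0 z). specialize (H (Cmod z / 2)). lra.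
Qed.

Lemma Ceq_minus (x y : C) : (x - y)%C = RtoC 0 -> x = y.
Proof. intros H. replace x with ((x - y) + y)%C by ring. rewrite H. ring. Qed.

Lemma is_derive_eps (f : R -> R) t l :
  (forall eps, 0 < eps -> exists d, 0 < d /\
    forall u, Rabs (u - t) < d -> Rabs (f u - f t - l * (u - t)) <= eps * Rabs (u - t)) ->
  is_derive f t l.
Proof.
  intros H. split; [apply is_linear_scal_l |].
  intros y Hy. apply (is_filter_lim_locally_unique (V := R_NormedModule) t y) in Hy. subst y.
  intros eps. destruct (H eps (cond_pos eps)) as [d [Hd H']].
  exists (mkposreal d Hd). intros u Hu.
  eapply Rle_trans; [|exact (H' u Hu)]. right.
  unfold norm; simpl; unfold abs; simpl. f_equal.
  unfold minus, plus, opp, scal; simpl; unfold mult; simpl. ring.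
Qed.

Lemma curve_deriv_eps (f : R -> C) t l :
  (forall eps, 0 < eps -> exists d, 0 < d /\
    forall u, Rabs (u - t) < d -> Cmod (f u - f t - l * RtoC (u - t)) <= eps * Rabs (u - t)) ->
  curve_deriv f t l.
Proof.
  intros H; split; apply is_derive_eps; intros eps Heps;
    destruct (H eps Heps) as [d [Hd H']]; exists d; split; auto; intros u Hu;
    eapply Rle_trans; [|exact (H' u Hu)| |exact (H' u Hu)].
  - eapply Rle_trans; [|apply Re_le_Cmod]. right. f_equal.
    destruct (f u), (f t), l; unfold Re; simpl; ring.
  - eapply Rle_trans; [|apply Im_le_Cmod]. right. f_equal.
    destruct (f u), (f t), l; unfold Im; simpl; ring.
Qed.

Lemma cderiv_continuous f s l : cderiv f s l ->
  forall eps, 0 < eps -> exists d, 0 < d /\ forall z, Cmod (z - s) < d -> Cmod (f z - f s) < eps.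
Proof.
  intros H eps Heps. destruct (H 1 Rlt_0_1) as [d [Hd H']].
  assert (HL := Cmod_ge_0 l).
  assert (Hq : 0 < eps / (2 + Cmod l)) by (apply Rdiv_lt_0_compat; lra).
  exists (Rmin d (eps / (2 + Cmod l))). split.
  { apply Rmin_pos; lra. }
  intros z Hz.
  assert (Hz1 : Cmod (z - s) < d) by (eapply Rlt_le_trans; [apply Hz | apply Rmin_l]).
  assert (Hz2 : Cmod (z - s) < eps / (2 + Cmod l)) by (eapply Rlt_le_trans; [apply Hz | apply Rmin_r]).
  specialize (H' z Hz1).
  replace (f z - f s)%C with ((f z - f s - l * (z - s)) + l * (z - s))%C by ring.
  eapply Rle_lt_trans; [apply Cmod_triangle |]. rewrite Cmod_mult.
  apply Rle_lt_trans with ((1 + Cmod l) * Cmod (z - s)); [lra |].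
  assert (Hz0 := Cmod_ge_0 (z - s)).
  apply Rle_lt_trans with ((2 + Cmod l) * Cmod (z - s)); [nra|].
  apply Rmult_lt_reg_l with (/ (2 + Cmod l)); [apply Rinv_0_lt_compat; lra|].
  rewrite <- Rmult_assoc, Rinv_l, Rmult_1_l by lra. unfold Rdiv in Hz2. lra.
Qed.

Lemma cderiv_ext f g s l : (forall z, f z = g z) -> cderiv f s l -> cderiv g s l.
Proof.
  intros H Hf eps He. destruct (Hf eps He) as [d [Hd H']]. exists d; split; auto.
  intros z Hz. rewrite <- !H. auto.
Qed.

Lemma cderiv_ext_loc f g s l r : 0 < r -> (forall z, Cmod (z - s) < r -> f z = g z) ->
  cderiv f s l -> cderiv g s l.
Proof.
  intros Hr H Hf eps He. destruct (Hf eps He) as [d [Hd H']].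
  exists (Rmin d r); split; [apply Rmin_pos; auto|].
  intros z Hz. rewrite <- !H.
  - apply H'. eapply Rlt_le_trans; [apply Hz | apply Rmin_l].
  - replace (s - s)%C with (RtoC 0) by ring. rewrite Cmod_0. auto.
  - eapply Rlt_le_trans; [apply Hz | apply Rmin_r].
Qed.

Lemma cderiv_const c s : cderiv (fun _ => c) s (RtoC 0).
Proof.
  intros eps He. exists 1; split; [lra|]. intros z _.
  replace (c - c - RtoC 0 * (z - s))%C with (RtoC 0) by ring. rewrite Cmod_0.
  apply Rmult_le_pos; [lra | apply Cmod_ge_0].
Qed.

Lemma cderiv_id s : cderiv (fun z => z) s (RtoC 1).
Proof.
  intros eps He. exists 1; split; [lra|]. intros z _.
  replace (z - s - RtoC 1 * (z - s))%C with (RtoC 0) by ring. rewrite Cmod_0.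
  apply Rmult_le_pos; [lra | apply Cmod_ge_0].
Qed.

Lemma cderiv_plus f g s a b : cderiv f s a -> cderiv g s b ->
  cderiv (fun z => f z + g z)%C s (a + b)%C.
Proof.
  intros Hf Hg eps He.
  destruct (Hf (eps / 2)) as [d1 [Hd1 H1]]; [lra|].
  destruct (Hg (eps / 2)) as [d2 [Hd2 H2]]; [lra|].
  exists (Rmin d1 d2); split; [apply Rmin_pos; auto|]. intros z Hz.
  assert (K1 := H1 z (Rlt_le_trans _ _ _ Hz (Rmin_l _ _))).
  assert (K2 := H2 z (Rlt_le_trans _ _ _ Hz (Rmin_r _ _))).
  replace (f z + g z - (f s + g s) - (a + b) * (z - s))%C
    with ((f z - f s - a * (z - s)) + (g z - g s - b * (z - s)))%C by ring.
  eapply Rle_trans; [apply Cmod_triangle |]. lra.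
Qed.

Lemma cderiv_comp f g s a b : cderiv f (g s) a -> cderiv g s b ->
  cderiv (fun z => f (g z)) s (a * b)%C.
Proof.
  intros Hf Hg eps He.
  assert (Ha := Cmod_ge_0 a). assert (Hb := Cmod_ge_0 b).
  set (e1 := eps / (2 * (Cmod b + 1))).
  assert (He1 : 0 < e1) by (apply Rdiv_lt_0_compat; lra).
  (* The cap at 1 makes [g] Lipschitz near [s] with constant [Cmod b + 1]; the added 1 in the
     denominators allows for zero derivatives. *)
  set (e2 := Rmin 1 (eps / (2 * (Cmod a + 1)))).
  assert (He2 : 0 < e2) by (apply Rmin_pos; [lra | apply Rdiv_lt_0_compat; lra]).
  destruct (Hf e1 He1) as [d1 [Hd1 H1]].
  destruct (Hg e2 He2) as [d2 [Hd2 H2]].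
  destruct (cderiv_continuous g s b Hg d1 Hd1) as [d3 [Hd3 H3]].
  exists (Rmin d2 d3); split; [apply Rmin_pos; auto|]. intros z Hz.
  assert (K2 := H2 z (Rlt_le_trans _ _ _ Hz (Rmin_l _ _))).
  assert (K3 := H3 z (Rlt_le_trans _ _ _ Hz (Rmin_r _ _))).
  assert (K1 := H1 _ K3).
  replace (f (g z) - f (g s) - a * b * (z - s))%C
    with ((f (g z) - f (g s) - a * (g z - g s)) + a * (g z - g s - b * (z - s)))%C by ring.
  eapply Rle_trans; [apply Cmod_triangle |]. rewrite Cmod_mult.
  assert (Kg : Cmod (g z - g s) <= (Cmod b + 1) * Cmod (z - s)).
  { replace (g z - g s)%C with ((g z - g s - b * (z - s)) + b * (z - s))%C by ring.
    eapply Rle_trans; [apply Cmod_triangle |]. rewrite Cmod_mult.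
    assert (e2 <= 1) by apply Rmin_l. assert (Hz0 := Cmod_ge_0 (z - s)). nra. }
  assert (Hz0 := Cmod_ge_0 (z - s)).
  assert (T1 : e1 * Cmod (g z - g s) <= eps / 2 * Cmod (z - s)).
  { apply Rle_trans with (e1 * ((Cmod b + 1) * Cmod (z - s))).
    - apply Rmult_le_compat_l; lra.
    - right. unfold e1. field. lra. }
  assert (T2 : Cmod a * (e2 * Cmod (z - s)) <= eps / 2 * Cmod (z - s)).
  { rewrite <- Rmult_assoc. apply Rmult_le_compat_r; auto.
    apply Rle_trans with ((Cmod a + 1) * (eps / (2 * (Cmod a + 1)))).
    - apply Rmult_le_compat; [lra|lra|lra|apply Rmin_r].
    - right. field. lra. }
  assert (T3 : Cmod a * Cmod (g z - g s - b * (z - s)) <= Cmod a * (e2 * Cmod (z - s))).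
  { apply Rmult_le_compat_l; lra. }
  lra.
Qed.

Lemma cderiv_sqr s : cderiv (fun z => z * z)%C s (2 * s)%C.
Proof.
  intros eps He. exists eps; split; auto. intros z Hz.
  replace (z * z - s * s - 2 * s * (z - s))%C with ((z - s) * (z - s))%C by ring.
  rewrite Cmod_mult. apply Rmult_le_compat_r; [apply Cmod_ge_0 | lra].
Qed.

Lemma cderiv_scal c f s a : cderiv f s a -> cderiv (fun z => c * f z)%C s (c * a)%C.
Proof.
  intros Hf. apply (cderiv_comp (fun w => c * w)%C f s c a); auto.
  intros eps He. exists 1; split; [lra|]. intros z _.
  replace (c * z - c * f s - c * (z - f s))%C with (RtoC 0) by ring. rewrite Cmod_0.
  apply Rmult_le_pos; [lra | apply Cmod_ge_0].
Qed.

Lemma cderiv_minus f g s a b : cderiv f s a -> cderiv g s b ->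
  cderiv (fun z => f z - g z)%C s (a - b)%C.
Proof.
  intros Hf Hg. replace (a - b)%C with (a + (- (RtoC 1)) * b)%C by ring.
  apply cderiv_ext with (fun z => f z + (- (RtoC 1)) * g z)%C; [intros; ring|].
  apply cderiv_plus, cderiv_scal; auto.
Qed.

(* [fg = ((f+g)^2 - (f-g)^2) / 4]. *)
Lemma cderiv_mult f g s a b : cderiv f s a -> cderiv g s b ->
  cderiv (fun z => f z * g z)%C s (a * g s + f s * b)%C.
Proof.
  intros Hf Hg.
  replace (a * g s + f s * b)%C with
    (/ RtoC 4 * (2 * (f s + g s) * (a + b) - 2 * (f s - g s) * (a - b)))%C
    by field.
  apply cderiv_ext with
    (fun z => / RtoC 4 * ((f z + g z) * (f z + g z) - (f z - g z) * (f z - g z)))%C.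
  { intros z. field. }
  apply cderiv_scal, cderiv_minus.
  - apply (cderiv_comp (fun w => w * w)%C (fun z => f z + g z)%C).
    + apply cderiv_sqr.
    + apply cderiv_plus; auto.
  - apply (cderiv_comp (fun w => w * w)%C (fun z => f z - g z)%C).
    + apply cderiv_sqr.
    + apply cderiv_minus; auto.
Qed.

(** The passage from complex differentiability to real curves, on which the fundamental theorem of
    calculus is available. *)
Lemma cderiv_line f s l w t0 : cderiv f (s + RtoC t0 * w)%C l ->
  curve_deriv (fun t => f (s + RtoC t * w)%C) t0 (l * w)%C.
Proof.
  intros H. apply curve_deriv_eps. intros eps He.
  assert (Hw := Cmod_ge_0 w).
  destruct (H (eps / (Cmod w + 1))) as [d [Hd H']]; [apply Rdiv_lt_0_compat; lra|].
  exists (d / (Cmod w + 1)); split; [apply Rdiv_lt_0_compat; lra|].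
  intros u Hu.
  assert (E : ((s + RtoC u * w) - (s + RtoC t0 * w))%C = (RtoC (u - t0) * w)%C).
  { rewrite RtoC_minus. ring. }
  assert (Em : Cmod ((s + RtoC u * w) - (s + RtoC t0 * w))%C = Rabs (u - t0) * Cmod w).
  { rewrite E, Cmod_mult, Cmod_R. reflexivity. }
  assert (Hp := Rabs_pos (u - t0)).
  assert (Hlt : Rabs (u - t0) * (Cmod w + 1) < d).
  { apply Rmult_lt_reg_r with (/ (Cmod w + 1)); [apply Rinv_0_lt_compat; lra|].
    rewrite Rmult_assoc, Rinv_r by lra. unfold Rdiv in Hu. lra. }
  assert (K := H' (s + RtoC u * w)%C).
  rewrite Em in K.
  assert (K' : Rabs (u - t0) * Cmod w < d) by nra.
  specialize (K K'). rewrite E in K.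
  replace (l * w * RtoC (u - t0))%C with (l * (RtoC (u - t0) * w))%C by ring.
  eapply Rle_trans; [exact K|].
  apply Rle_trans with (eps / (Cmod w + 1) * (Rabs (u - t0) * (Cmod w + 1))).
  - apply Rmult_le_compat_l; [apply Rlt_le, Rdiv_lt_0_compat; lra | nra].
  - right. field. lra.
Qed.

(** * Complex-valued integrals over real intervals *)

Lemma curve_deriv_ccont f t l : curve_deriv f t l -> ccont f t.
Proof.
  intros [H1 H2]; split;
  apply (ex_derive_continuous (V := R_NormedModule)); eexists; eauto.
Qed.

Lemma is_Cint_unique f a b l : is_Cint f a b l -> Cint f a b = l.
Proof.
  intros [H1 H2]. unfold Cint. 
  destruct l. f_equal; apply (is_RInt_unique (V := R_CompleteNormedModule)); auto.
Qed.

Lemma Cint_correct f a b : ex_Cint f a b -> is_Cint f a b (Cint f a b).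
Proof. intros [H1 H2]; split; apply (RInt_correct (V := R_CompleteNormedModule)); auto. Qed.

Lemma is_Cint_ex f a b l : is_Cint f a b l -> ex_Cint f a b.
Proof. intros [H1 H2]; split; eexists; eauto. Qed.

Lemma ex_Cint_cont f a b :
  (forall t, Rmin a b <= t <= Rmax a b -> ccont f t) -> ex_Cint f a b.
Proof.
  intros H; split; apply (ex_RInt_continuous (V := R_CompleteNormedModule));
  intros t Ht; apply (H t Ht).
Qed.

(** Seen as a single integral in the product normed module, whose norm is [Cmod], the integral obeys
    the norm inequality without the constant that separate estimates of the two coordinates would
    lose. *)
Lemma is_Cint_Cmod_le f a b l (g : R -> R) lg : a <= b ->
  (forall t, a <= t <= b -> Cmod (f t) <= g t) ->
  is_Cint f a b l -> is_RInt g a b lg -> Cmod l <= lg.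
Proof.
  intros Hab H [H1 H2] Hg.
  assert (K : is_RInt (V := prod_NormedModule _ R_NormedModule R_NormedModule) f a b l).
  { rewrite (surjective_pairing l). apply is_RInt_fct_extend_pair; [exact H1 | exact H2]. }
  assert (N : forall z : C, norm (V := prod_NormedModule _ R_NormedModule R_NormedModule) z = Cmod z).
  { intros z. unfold norm; simpl. unfold prod_norm, Cmod. f_equal.
    unfold norm; simpl. unfold abs; simpl. rewrite !Rmult_1_r.
    rewrite <- !Rabs_mult, !Rabs_right; auto; apply Rle_ge, Rle_0_sqr. }
  rewrite <- N. eapply norm_RInt_le; [exact Hab | | exact K | exact Hg].
  intros t Ht. rewrite N. auto.
Qed.

Lemma is_Cint_Cmod_le_const f a b l M :
  (forall t, Rmin a b <= t <= Rmax a b -> Cmod (f t) <= M) ->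
  is_Cint f a b l -> Cmod l <= Rabs (b - a) * M.
Proof.
  intros H Hf.
  destruct (Rle_dec a b) as [Hab|Hab].
  - rewrite Rabs_right by lra. rewrite Rmin_left, Rmax_right in H by lra.
    eapply is_Cint_Cmod_le; [exact Hab | exact H | exact Hf |].
    apply (is_RInt_const (V := R_NormedModule)).
  - rewrite Rabs_left1 by lra. rewrite Rmin_right, Rmax_left in H by lra.
    replace (- (b - a)) with (a - b) by ring.
    assert (Hf' : is_Cint f b a (- l)%C).
    { destruct Hf; split; apply (is_RInt_swap (V := R_NormedModule)); auto. }
    rewrite <- Cmod_opp.
    eapply (is_Cint_Cmod_le f b a); [lra | exact H | exact Hf' |].
    apply (is_RInt_const (V := R_NormedModule)).
Qed.

Lemma is_Cint_ext f g a b l :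
  (forall t, Rmin a b < t < Rmax a b -> f t = g t) -> is_Cint f a b l -> is_Cint g a b l.
Proof.
  intros H [H1 H2]; split; (eapply is_RInt_ext; [|eassumption]);
  intros t Ht; simpl; rewrite (H t Ht); auto.
Qed.

Lemma is_Cint_plus f g a b l m : is_Cint f a b l -> is_Cint g a b m ->
  is_Cint (fun t => f t + g t)%C a b (l + m)%C.
Proof.
  intros [H1 H2] [H3 H4]; split; apply (is_RInt_plus (V := R_NormedModule)); auto.
Qed.

Lemma is_Cint_scal c f a b l : is_Cint f a b l -> is_Cint (fun t => c * f t)%C a b (c * l)%C.
Proof.
  intros [H1 H2]; split.
  - apply (is_RInt_minus (V := R_NormedModule));
      apply (is_RInt_scal (V := R_NormedModule)); auto.
  - apply (is_RInt_plus (V := R_NormedModule));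
      apply (is_RInt_scal (V := R_NormedModule)); auto.
Qed.

Lemma is_Cint_minus f g a b l m : is_Cint f a b l -> is_Cint g a b m ->
  is_Cint (fun t => f t - g t)%C a b (l - m)%C.
Proof.
  intros [H1 H2] [H3 H4]; split; apply (is_RInt_minus (V := R_NormedModule)); auto.
Qed.

Lemma is_Cint_Chasles f a b c l m : is_Cint f a b l -> is_Cint f b c m ->
  is_Cint f a c (l + m)%C.
Proof.
  intros [H1 H2] [H3 H4]; split; eapply (is_RInt_Chasles (V := R_NormedModule)); eauto.
Qed.

Lemma Cint_Chasles f a b c : ex_Cint f a b -> ex_Cint f b c ->
  (Cint f a b + Cint f b c)%C = Cint f a c.
Proof.
  intros H1 H2. symmetry. apply is_Cint_unique.
  eapply is_Cint_Chasles; apply Cint_correct; auto.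
Qed.

Lemma is_Cint_derive F f a b :
  (forall t, Rmin a b <= t <= Rmax a b -> curve_deriv F t (f t)) ->
  (forall t, Rmin a b <= t <= Rmax a b -> ccont f t) ->
  is_Cint f a b (F b - F a)%C.
Proof.
  intros H1 H2; split.
  - apply (is_RInt_derive (V := R_CompleteNormedModule) (fun t => Re (F t)));
      intros t Ht; [apply (H1 t Ht) | apply (H2 t Ht)].
  - apply (is_RInt_derive (V := R_CompleteNormedModule) (fun t => Im (F t)));
      intros t Ht; [apply (H1 t Ht) | apply (H2 t Ht)].
Qed.

Lemma is_Cint_const c a b : is_Cint (fun _ => c) a b (RtoC (b - a) * c)%C.
Proof.
  replace (RtoC (b - a) * c)%C with ((b - a) * Re c, (b - a) * Im c).
  - split; apply (is_RInt_const (V := R_NormedModule)).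
  - destruct c; unfold RtoC, Cmult, Re, Im; simpl; f_equal; ring.
Qed.

Lemma Re_scal_R t z : Re (RtoC t * z) = t * Re z.
Proof. destruct z; unfold RtoC, Cmult, Re; simpl; ring. Qed.

Lemma Im_scal_R t z : Im (RtoC t * z) = t * Im z.
Proof. destruct z; unfold RtoC, Cmult, Im; simpl; ring. Qed.

(** * The complex exponential *)

Definition cexp (z : C) : C := (exp (Re z) * cos (Im z), exp (Re z) * sin (Im z)).

Lemma cexp_0 : cexp (RtoC 0) = RtoC 1.
Proof. unfold cexp, RtoC; simpl. rewrite exp_0, cos_0, sin_0. f_equal; ring. Qed.

Lemma cexp_plus z w : cexp (z + w) = (cexp z * cexp w)%C.
Proof.
  destruct z as [x y], w as [u v]. unfold cexp, Cmult; simpl.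
  rewrite exp_plus, cos_plus, sin_plus. f_equal; ring.
Qed.

Lemma Cmod_cexp z : Cmod (cexp z) = exp (Re z).
Proof.
  destruct z as [x y]. unfold cexp, Cmod; simpl.
  replace (exp x * cos y * (exp x * cos y * 1) + exp x * sin y * (exp x * sin y * 1))
    with ((exp x)² * ((sin y)² + (cos y)²)) by (unfold Rsqr; ring).
  rewrite sin2_cos2, Rmult_1_r. apply sqrt_Rsqr. apply Rlt_le, exp_pos.
Qed.

Lemma cexp_neg_mult z : (cexp (- z) * cexp z)%C = RtoC 1.
Proof. rewrite <- cexp_plus. replace (- z + z)%C with (RtoC 0) by ring. apply cexp_0. Qed.

(** Rays through the origin are the curves that matter: the Laplace kernels have the form
    [cexp (RtoC u * - s)], and the Taylor remainders of [cexp] are integrals over [0 <= t <= 1]. *)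
Lemma cexp_ray_deriv z t : curve_deriv (fun u => cexp (RtoC u * z)) t (z * cexp (RtoC t * z))%C.
Proof.
  split.
  - apply is_derive_ext with (fun u => exp (u * Re z) * cos (u * Im z)).
    { intros u. unfold cexp. rewrite Re_scal_R, Im_scal_R. reflexivity. }
    auto_derive; auto.
    unfold cexp. rewrite Re_scal_R, Im_scal_R. unfold Re, Im, Cmult; simpl. ring.
  - apply is_derive_ext with (fun u => exp (u * Re z) * sin (u * Im z)).
    { intros u. unfold cexp. rewrite Re_scal_R, Im_scal_R. reflexivity. }
    auto_derive; auto.
    unfold cexp. rewrite Re_scal_R, Im_scal_R. unfold Re, Im, Cmult; simpl. ring.
Qed.

Lemma ccont_cexp_ray z t : ccont (fun u => cexp (RtoC u * z)) t.
Proof. eapply curve_deriv_ccont, cexp_ray_deriv. Qed.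

Lemma ccont_scal c f t : ccont f t -> ccont (fun u => c * f u)%C t.
Proof.
  intros [H1 H2]; split.
  - apply (continuous_minus (V := R_NormedModule));
      apply (continuous_scal_r (V := R_NormedModule)); auto.
  - apply (continuous_plus (V := R_NormedModule));
      apply (continuous_scal_r (V := R_NormedModule)); auto.
Qed.

Lemma ccont_minus f g t : ccont f t -> ccont g t -> ccont (fun u => f u - g u)%C t.
Proof.
  intros [H1 H2] [H3 H4]; split; apply (continuous_minus (V := R_NormedModule)); auto.
Qed.

Lemma ccont_const c t : ccont (fun _ => c) t.
Proof. split; apply continuous_const. Qed.

Lemma Cmod_cexp_ray_le z t : 0 <= t <= 1 -> Cmod (cexp (RtoC t * z)) <= exp (Cmod z).
Proof.
  intros Ht. rewrite Cmod_cexp, Re_scal_R.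
  assert (H := Re_le_Cmod z). assert (H' := Rle_abs (Re z)). assert (Hz := Cmod_ge_0 z).
  destruct (Rle_lt_or_eq_dec (t * Re z) (Cmod z)) as [K|K]; [nra| |].
  - apply Rlt_le, exp_increasing; auto.
  - rewrite K; lra.
Qed.

Lemma cexp_minus_1_bound z : Cmod (cexp z - 1) <= Cmod z * exp (Cmod z).
Proof.
  assert (H : is_Cint (fun t => z * cexp (RtoC t * z))%C 0 1 (cexp z - 1)%C).
  { replace (cexp z - 1)%C with (cexp (RtoC 1 * z) - cexp (RtoC 0 * z))%C.
    - apply (is_Cint_derive (fun u => cexp (RtoC u * z))).
      + intros; apply cexp_ray_deriv.
      + intros; apply ccont_scal, ccont_cexp_ray.
    - replace (RtoC 0 * z)%C with (RtoC 0) by ring. rewrite cexp_0. f_equal. f_equal. ring. }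
  apply is_Cint_Cmod_le_const with (M := Cmod z * exp (Cmod z)) in H.
  - rewrite Rabs_right in H by lra. lra.
  - rewrite Rmin_left, Rmax_right by lra. intros t Ht. rewrite Cmod_mult.
    apply Rmult_le_compat_l; [apply Cmod_ge_0 | apply Cmod_cexp_ray_le; auto].
Qed.

(** Integrates the first-order bound along the ray to [z]. Being valid for every [z], it later gives
    remainders uniform in the truncation when Laplace integrals and Dirichlet series are
    differentiated. *)
Lemma cexp_taylor_bound z : Cmod (cexp z - 1 - z) <= Cmod z * Cmod z * exp (Cmod z).
Proof.
  assert (H : is_Cint (fun t => z * (cexp (RtoC t * z) - 1))%C 0 1 (cexp z - 1 - z)%C).
  { replace (cexp z - 1 - z)%C
      with ((cexp (RtoC 1 * z) - RtoC 1 * z) - (cexp (RtoC 0 * z) - RtoC 0 * z))%C.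
    - apply (is_Cint_derive (fun u => cexp (RtoC u * z) - RtoC u * z)%C).
      + intros t _. destruct (cexp_ray_deriv z t) as [A B].
        replace (z * (cexp (RtoC t * z) - 1))%C with (z * cexp (RtoC t * z) - z)%C by ring.
        split.
        * apply (is_derive_minus (K := R_AbsRing) (V := R_NormedModule)
            (fun u => Re (cexp (RtoC u * z))) (fun u => Re (RtoC u * z))); auto.
          apply is_derive_ext with (fun u => u * Re z); [intros; symmetry; apply Re_scal_R|].
          auto_derive; auto; unfold Re; ring.
        * apply (is_derive_minus (K := R_AbsRing) (V := R_NormedModule)
            (fun u => Im (cexp (RtoC u * z))) (fun u => Im (RtoC u * z))); auto.
          apply is_derive_ext with (fun u => u * Im z); [intros; symmetry; apply Im_scal_R|].
          auto_derive; auto; unfold Im; ring.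
      + intros; apply ccont_scal, ccont_minus; [apply ccont_cexp_ray | apply ccont_const].
    - replace (RtoC 0 * z)%C with (RtoC 0) by ring. rewrite cexp_0.
      replace (RtoC 1 * z)%C with z by ring. ring. }
  apply is_Cint_Cmod_le_const with (M := Cmod z * (Cmod z * exp (Cmod z))) in H.
  - rewrite Rabs_right in H by lra. lra.
  - rewrite Rmin_left, Rmax_right by lra. intros t Ht. rewrite Cmod_mult.
    apply Rmult_le_compat_l; [apply Cmod_ge_0 |].
    eapply Rle_trans; [apply cexp_minus_1_bound|].
    rewrite Cmod_mult, Cmod_R, Rabs_right by lra. assert (Hz := Cmod_ge_0 z).
    apply Rmult_le_compat; try nra.
    + apply Rlt_le, exp_pos.
    + destruct (Rle_lt_or_eq_dec (t * Cmod z) (Cmod z)) as [K|K]; [nra| |].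
      * apply Rlt_le, exp_increasing; auto.
      * rewrite K; lra.
Qed.

Lemma cderiv_cexp s : cderiv cexp s (cexp s).
Proof.
  intros eps He. assert (Hp := Cmod_cexp s). assert (Hq := exp_pos (Re s)).
  assert (H1 := exp_pos 1).
  exists (Rmin 1 (eps / (exp (Re s) * exp 1))). split.
  { apply Rmin_pos; [lra|]. apply Rdiv_lt_0_compat; [lra | apply Rmult_lt_0_compat; lra]. }
  intros z Hz. set (w := (z - s)%C) in *.
  assert (K1 : Cmod w < 1) by (eapply Rlt_le_trans; [apply Hz | apply Rmin_l]).
  assert (K2 : Cmod w < eps / (exp (Re s) * exp 1)) by (eapply Rlt_le_trans; [apply Hz | apply Rmin_r]).
  replace (cexp z) with (cexp s * cexp w)%C
    by (rewrite <- cexp_plus; f_equal; unfold w; ring).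
  replace (cexp s * cexp w - cexp s - cexp s * w)%C with (cexp s * (cexp w - 1 - w))%C by ring.
  rewrite Cmod_mult, Cmod_cexp.
  assert (T := cexp_taylor_bound w). assert (Hw := Cmod_ge_0 w).
  assert (Te : exp (Cmod w) <= exp 1) by (apply Rlt_le, exp_increasing; auto).
  apply Rle_trans with (exp (Re s) * (Cmod w * Cmod w * exp 1)).
  { apply Rmult_le_compat_l; [lra|]. eapply Rle_trans; [exact T|].
    apply Rmult_le_compat_l; [nra | auto]. }
  replace (exp (Re s) * (Cmod w * Cmod w * exp 1)) with
    ((exp (Re s) * exp 1) * Cmod w * Cmod w) by ring.
  apply Rmult_le_compat_r; auto.
  apply Rle_trans with ((exp (Re s) * exp 1) * (eps / (exp (Re s) * exp 1))).
  - apply Rmult_le_compat_l; [apply Rlt_le, Rmult_lt_0_compat; lra | lra].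
  - right. field. split; lra.
Qed.

(** * Goursat's theorem and primitives on half-planes *)

Definition holo (b : R) (f : C -> C) : Prop :=
  forall s : C, b < Re s -> exists l, cderiv f s l.

Lemma hline_eq (r y : R) : ((r, y) : C) = ((0, y) + RtoC r * RtoC 1)%C.
Proof. unfold Cplus, Cmult, RtoC; simpl; f_equal; ring. Qed.

Lemma vline_eq (x t : R) : ((x, t) : C) = ((x, 0) + RtoC t * Ci)%C.
Proof. unfold Cplus, Cmult, RtoC, Ci; simpl; f_equal; ring. Qed.

Lemma curve_deriv_ext f g t l : (forall u, f u = g u) -> curve_deriv f t l -> curve_deriv g t l.
Proof.
  intros H [H1 H2]; split; (eapply is_derive_ext; [|eassumption]);
  intros u; simpl; rewrite H; auto.
Qed.

Lemma cderiv_hline f x y l : cderiv f (x, y) l -> curve_deriv (fun r => f (r, y)) x l.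
Proof.
  intros H. replace l with (l * RtoC 1)%C by ring.
  apply curve_deriv_ext with (fun r => f ((0, y) + RtoC r * RtoC 1)%C).
  - intros; rewrite <- hline_eq; auto.
  - apply cderiv_line. rewrite <- hline_eq. auto.
Qed.

Lemma cderiv_vline f x y l : cderiv f (x, y) l -> curve_deriv (fun t => f (x, t)) y (Ci * l)%C.
Proof.
  intros H. rewrite (Cmult_comm Ci l).
  apply curve_deriv_ext with (fun t => f ((x, 0) + RtoC t * Ci)%C).
  - intros; rewrite <- vline_eq; auto.
  - apply cderiv_line. rewrite <- vline_eq. auto.
Qed.

Lemma holo_hcont b f x y : holo b f -> b < x -> ccont (fun r => f (r, y)) x.
Proof.
  intros H Hx. destruct (H (x, y) Hx) as [l Hl].
  eapply curve_deriv_ccont, cderiv_hline, Hl.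
Qed.

Lemma holo_vcont b f x y : holo b f -> b < x -> ccont (fun t => f (x, t)) y.
Proof.
  intros H Hx. destruct (H (x, y) Hx) as [l Hl].
  eapply curve_deriv_ccont, cderiv_vline, Hl.
Qed.

Lemma holo_hint b f x1 x2 y : holo b f -> b < x1 -> b < x2 ->
  ex_Cint (fun r => f (r, y)) x1 x2.
Proof.
  intros H H1 H2. apply ex_Cint_cont. intros t Ht. eapply holo_hcont; eauto.
  eapply Rlt_le_trans; [|apply Ht]. apply Rmin_glb_lt; auto.
Qed.

Lemma holo_vint b f x y1 y2 : holo b f -> b < x -> ex_Cint (fun t => f (x, t)) y1 y2.
Proof. intros H H1. apply ex_Cint_cont. intros t Ht. eapply holo_vcont; eauto. Qed.

Lemma holo_const b c : holo b (fun _ => c).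
Proof. intros s _. eexists; apply cderiv_const. Qed.

Lemma holo_id b : holo b (fun z => z).
Proof. intros s _. eexists; apply cderiv_id. Qed.

Lemma holo_plus b f g : holo b f -> holo b g -> holo b (fun z => f z + g z)%C.
Proof.
  intros Hf Hg s Hs. destruct (Hf s Hs), (Hg s Hs). eexists; apply cderiv_plus; eauto.
Qed.

Lemma holo_minus b f g : holo b f -> holo b g -> holo b (fun z => f z - g z)%C.
Proof.
  intros Hf Hg s Hs. destruct (Hf s Hs), (Hg s Hs). eexists; apply cderiv_minus; eauto.
Qed.

Lemma holo_mult b f g : holo b f -> holo b g -> holo b (fun z => f z * g z)%C.
Proof.
  intros Hf Hg s Hs. destruct (Hf s Hs), (Hg s Hs). eexists; apply cderiv_mult; eauto.
Qed.

Lemma holo_cexp b f : holo b f -> holo b (fun z => cexp (f z)).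
Proof.
  intros Hf s Hs. destruct (Hf s Hs). eexists. apply (cderiv_comp cexp f); eauto.
  apply cderiv_cexp.
Qed.

(** The contour integral of [f(z) dz] counterclockwise around the rectangle with opposite corners
    [(x1, y1)] and [(x2, y2)]; the factor [Ci] is [dz] on the vertical sides. *)
Definition rect_int (f : C -> C) (x1 x2 y1 y2 : R) : C :=
  (Cint (fun r => f (r, y1)) x1 x2 + Ci * Cint (fun t => f (x2, t)) y1 y2
   - Cint (fun r => f (r, y2)) x1 x2 - Ci * Cint (fun t => f (x1, t)) y1 y2)%C.

Lemma rect_int_primitive b F f x1 x2 y1 y2 : holo b f ->
  (forall z, b < Re z -> cderiv F z (f z)) -> b < x1 -> b < x2 ->
  rect_int f x1 x2 y1 y2 = RtoC 0.
Proof.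
  intros Hf HF H1 H2.
  assert (Hm : forall t, Rmin x1 x2 <= t <= Rmax x1 x2 -> b < t).
  { intros t Ht. eapply Rlt_le_trans; [|apply Ht]. apply Rmin_glb_lt; auto. }
  assert (Hh : forall y, Cint (fun r => f (r, y)) x1 x2 = (F (x2, y) - F (x1, y))%C).
  { intros y. apply is_Cint_unique.
    apply (is_Cint_derive (fun r => F (r, y))).
    - intros t Ht. apply cderiv_hline, HF. simpl. auto.
    - intros t Ht. eapply holo_hcont; eauto. }
  assert (Hv : forall x, b < x -> (Ci * Cint (fun t => f (x, t)) y1 y2)%C = (F (x, y2) - F (x, y1))%C).
  { intros x Hx.
    assert (E : is_Cint (fun t => Ci * f (x, t))%C y1 y2 (F (x, y2) - F (x, y1))%C).
    { apply (is_Cint_derive (fun t => F (x, t))).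
      - intros t Ht. apply cderiv_vline, HF. simpl. auto.
      - intros t Ht. apply ccont_scal. eapply holo_vcont; eauto. }
    rewrite <- (is_Cint_unique _ _ _ _ E). symmetry. apply is_Cint_unique.
    apply is_Cint_scal, Cint_correct. eapply holo_vint; eauto. }
  unfold rect_int. rewrite !Hh, !Hv by auto. ring.
Qed.

Lemma rect_int_minus b f g x1 x2 y1 y2 : holo b f -> holo b g -> b < x1 -> b < x2 ->
  rect_int (fun z => f z - g z)%C x1 x2 y1 y2
  = (rect_int f x1 x2 y1 y2 - rect_int g x1 x2 y1 y2)%C.
Proof.
  intros Hf Hg H1 H2. unfold rect_int.
  assert (E : forall u v a c, ex_Cint u a c -> ex_Cint v a c ->
     Cint (fun t => u t - v t)%C a c = (Cint u a c - Cint v a c)%C).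
  { intros u v a c Hu Hv. apply is_Cint_unique, is_Cint_minus; apply Cint_correct; auto. }
  assert (Fh : forall y, ex_Cint (fun r => f (r, y)) x1 x2) by (intros; apply (holo_hint b); auto).
  assert (Gh : forall y, ex_Cint (fun r => g (r, y)) x1 x2) by (intros; apply (holo_hint b); auto).
  assert (Fv : forall x, b < x -> ex_Cint (fun t => f (x, t)) y1 y2)
    by (intros; apply (holo_vint b); auto).
  assert (Gv : forall x, b < x -> ex_Cint (fun t => g (x, t)) y1 y2)
    by (intros; apply (holo_vint b); auto).
  rewrite (E _ _ _ _ (Fh y1) (Gh y1)), (E _ _ _ _ (Fh y2) (Gh y2)),
    (E _ _ _ _ (Fv x1 H1) (Gv x1 H1)), (E _ _ _ _ (Fv x2 H2) (Gv x2 H2)). ring.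
Qed.

Lemma rect_int_bound b f x1 x2 y1 y2 M : holo b f -> b < x1 -> x1 <= x2 -> y1 <= y2 ->
  (forall x y, x1 <= x <= x2 -> y1 <= y <= y2 -> Cmod (f (x, y)) <= M) ->
  Cmod (rect_int f x1 x2 y1 y2) <= 2 * ((x2 - x1) + (y2 - y1)) * M.
Proof.
  intros Hf H1 H2 H3 HM. unfold rect_int.
  assert (Eh : forall y, y1 <= y <= y2 -> Cmod (Cint (fun r => f (r, y)) x1 x2) <= (x2 - x1) * M).
  { intros y Hy. rewrite <- (Rabs_right (x2 - x1)) by lra.
    apply is_Cint_Cmod_le_const with (fun r => f (r, y)).
    - rewrite Rmin_left, Rmax_right by lra. intros; apply HM; auto.
    - apply Cint_correct. eapply holo_hint; eauto; lra. }
  assert (Ev : forall x, x1 <= x <= x2 -> Cmod (Cint (fun t => f (x, t)) y1 y2) <= (y2 - y1) * M).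
  { intros x Hx. rewrite <- (Rabs_right (y2 - y1)) by lra.
    apply is_Cint_Cmod_le_const with (fun t => f (x, t)).
    - rewrite Rmin_left, Rmax_right by lra. intros; apply HM; auto.
    - apply Cint_correct. eapply holo_vint; eauto; lra. }
  eapply Rle_trans; [apply Cmod_triangle_minus|].
  eapply Rle_trans; [apply Rplus_le_compat_r, Cmod_triangle_minus|].
  eapply Rle_trans; [apply Rplus_le_compat_r, Rplus_le_compat_r, Cmod_triangle|].
  rewrite !Cmod_mult, !Cmod_Ci.
  assert (A1 := Eh y1). assert (A2 := Eh y2). assert (A3 := Ev x1). assert (A4 := Ev x2).
  lra.
Qed.

Lemma rect_int_split b f x1 x2 x3 y1 y2 y3 : holo b f -> b < x1 -> b < x2 -> b < x3 ->
  rect_int f x1 x3 y1 y3 =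
  (rect_int f x1 x2 y1 y2 + rect_int f x2 x3 y1 y2 + rect_int f x1 x2 y2 y3
   + rect_int f x2 x3 y2 y3)%C.
Proof.
  intros Hf H1 H2 H3. unfold rect_int.
  assert (Eh : forall y, Cint (fun r => f (r, y)) x1 x3
    = (Cint (fun r => f (r, y)) x1 x2 + Cint (fun r => f (r, y)) x2 x3)%C).
  { intros y. symmetry. apply Cint_Chasles; eapply holo_hint; eauto. }
  assert (Ev : forall x, b < x -> Cint (fun t => f (x, t)) y1 y3
    = (Cint (fun t => f (x, t)) y1 y2 + Cint (fun t => f (x, t)) y2 y3)%C).
  { intros x Hx. symmetry. apply Cint_Chasles; eapply holo_vint; eauto. }
  rewrite !Eh, !Ev by auto. ring.
Qed.

(** The common point is the supremum of the left ends [u n]; every right end [u m + w m] bounds them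
    all. *)
Lemma nested_intervals (u w : nat -> R) :
  (forall n, 0 <= w n) -> (forall n, u n <= u (S n)) ->
  (forall n, u (S n) + w (S n) <= u n + w n) ->
  exists x, forall n, u n <= x <= u n + w n.
Proof.
  intros Hw Hu Huw.
  assert (M1 : forall n k, u n <= u (n + k)%nat).
  { intros n k. induction k. rewrite Nat.add_0_r; lra.
    rewrite Nat.add_succ_r. specialize (Hu (n + k)%nat). lra. }
  assert (M2 : forall n k, u (n + k)%nat + w (n + k)%nat <= u n + w n).
  { intros n k. induction k. rewrite Nat.add_0_r; lra.
    rewrite Nat.add_succ_r. specialize (Huw (n + k)%nat). lra. }
  assert (M : forall n m, u n <= u m + w m).
  { intros n m. destruct (Nat.le_ge_cases n m) as [H|H].
    - specialize (M1 n (m - n)%nat). replace (n + (m - n))%nat with m in M1 by lia.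
      specialize (Hw m). lra.
    - specialize (M2 m (n - m)%nat). replace (m + (n - m))%nat with n in M2 by lia.
      specialize (Hw n). lra. }
  destruct (completeness (fun x => exists n, x = u n)) as [x [Hx1 Hx2]].
  - exists (u 0%nat + w 0%nat). intros y [n ->]. apply M.
  - exists (u 0%nat), 0%nat; auto.
  - exists x. intros n. split.
    + apply Hx1. exists n; auto.
    + apply Hx2. intros y [m ->]. apply M.
Qed.

Lemma max_quarter (a b c d : C) :
  Cmod (a + b + c + d) / 4 <= Cmod a \/ Cmod (a + b + c + d) / 4 <= Cmod b \/
  Cmod (a + b + c + d) / 4 <= Cmod c \/ Cmod (a + b + c + d) / 4 <= Cmod d.
Proof.
  assert (H : Cmod (a + b + c + d) <= Cmod a + Cmod b + Cmod c + Cmod d).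
  { eapply Rle_trans; [apply Cmod_triangle|]. apply Rplus_le_compat_r.
    eapply Rle_trans; [apply Cmod_triangle|]. apply Rplus_le_compat_r. apply Cmod_triangle. }
  lra.
Qed.

(* Goursat's argument: a nonzero boundary integral survives, with a loss of at
   most a factor 4 per step, in a nested sequence of quarter rectangles, whereas
   differentiability at their common point makes it [o(4^-n)]. *)
Lemma goursat b f x y p q : holo b f -> b < x -> 0 <= p -> 0 <= q ->
  rect_int f x (x + p) y (y + q) = RtoC 0.
Proof.
  intros Hf Hx Hp Hq.
  set (I := fun (n : nat) (z : R * R) =>
    rect_int f (fst z) (fst z + p / 2 ^ n) (snd z) (snd z + q / 2 ^ n)).
  assert (P2 : forall n, 0 < 2 ^ n) by (intros; apply pow_lt; lra).
  assert (Hp2 : forall n, 0 <= p / 2 ^ n).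
  { intros. apply Rmult_le_pos; auto. apply Rlt_le, Rinv_0_lt_compat; auto. }
  assert (Hq2 : forall n, 0 <= q / 2 ^ n).
  { intros. apply Rmult_le_pos; auto. apply Rlt_le, Rinv_0_lt_compat; auto. }
  assert (Half : forall c n, c / 2 ^ n = c / 2 ^ (S n) + c / 2 ^ (S n)).
  { intros c n. simpl. field. specialize (P2 n). lra. }
  (* The condition [b < fst z] stands under the existential, so that the choice of a quarter is a
     total function and can be iterated. *)
  assert (Hstep : forall n z, exists z', b < fst z ->
    (fst z <= fst z' <= fst z + p / 2 ^ (S n)) /\
    (snd z <= snd z' <= snd z + q / 2 ^ (S n)) /\ Cmod (I n z) / 4 <= Cmod (I (S n) z')).
  { intros n [u v]. destruct (Rlt_dec b u) as [Hu|Hu].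
    2: { exists (u, v). simpl. intros; contradiction. }
    assert (A := Hp2 (S n)). assert (B := Hq2 (S n)).
    set (p' := p / 2 ^ (S n)) in *. set (q' := q / 2 ^ (S n)) in *.
    assert (E : I n (u, v) = (I (S n) (u, v) + I (S n) ((u + p')%R, v) + I (S n) (u, (v + q')%R)
       + I (S n) ((u + p')%R, (v + q')%R))%C).
    { unfold I, fst, snd. rewrite (Half p n), (Half q n). fold p' q'.
      rewrite <- !Rplus_assoc. eapply rect_int_split; eauto; lra. }
    destruct (max_quarter (I (S n) (u, v)) (I (S n) (u + p', v)) (I (S n) (u, v + q'))
       (I (S n) (u + p', v + q'))) as [K|[K|[K|K]]]; rewrite <- E in K;
    [exists (u, v) | exists (u + p', v) | exists (u, v + q') | exists (u + p', v + q')];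
    intros _; cbn [fst snd]; (split; [lra|split; [lra|exact K]]). }
  set (step := fun n z => proj1_sig (constructive_indefinite_description _ (Hstep n z))).
  assert (Hst : forall n z, b < fst z ->
    (fst z <= fst (step n z) <= fst z + p / 2 ^ (S n)) /\
    (snd z <= snd (step n z) <= snd z + q / 2 ^ (S n)) /\ Cmod (I n z) / 4 <= Cmod (I (S n) (step n z))).
  { intros n z Hz. unfold step. destruct (constructive_indefinite_description _ (Hstep n z)). auto. }
  set (Z := fix Z n := match n with O => (x, y) | S m => step m (Z m) end).
  assert (HZ : forall n, b < fst (Z n)).
  { induction n; simpl; auto. specialize (Hst n (Z n) IHn). lra. }
  assert (HI : forall n, Cmod (I 0%nat (x, y)) / 4 ^ n <= Cmod (I n (Z n))).
  { induction n. simpl; lra.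
    destruct (Hst n (Z n) (HZ n)) as [_ [_ K]].
    change (Z (S n)) with (step n (Z n)). eapply Rle_trans; [|exact K].
    simpl. replace (Cmod (I 0%nat (x, y)) / (4 * 4 ^ n)) with (Cmod (I 0%nat (x, y)) / 4 ^ n / 4).
    - lra.
    - field. apply pow_nonzero; lra. }
  destruct (nested_intervals (fun n => fst (Z n)) (fun n => p / 2 ^ n)) as [xs Hxs]; auto.
  { intros n. destruct (Hst n (Z n) (HZ n)) as [K _]. simpl Z. lra. }
  { intros n. destruct (Hst n (Z n) (HZ n)) as [K _]. change (Z (S n)) with (step n (Z n)).
    rewrite (Half p n). lra. }
  destruct (nested_intervals (fun n => snd (Z n)) (fun n => q / 2 ^ n)) as [ys Hys]; auto.
  { intros n. destruct (Hst n (Z n) (HZ n)) as [_ [K _]]. simpl Z. lra. }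
  { intros n. destruct (Hst n (Z n) (HZ n)) as [_ [K _]]. change (Z (S n)) with (step n (Z n)).
    rewrite (Half q n). lra. }
  assert (Hxb : b < xs) by (specialize (Hxs 0%nat); simpl in Hxs; lra).
  destruct (Hf (xs, ys) Hxb) as [l Hl].
  apply Cmod_small_eq0. intros eps He.
  set (w := p + q). assert (Hw : 0 <= w) by (unfold w; lra).
  (* The rectangle of step [n] has perimeter [2 w / 2^n], and on it [f] differs from its affine
     approximation by at most [e w / 2^n]. Multiplying by the [4^n] lost on the way leaves
     [2 w^2 e], which is at most [eps]. *)
  set (e := eps / (2 * w * w + 1)).
  assert (He' : 0 < e) by (apply Rdiv_lt_0_compat; nra).
  destruct (Hl e He') as [d [Hd H]].
  assert (Hn : exists n, w / 2 ^ n < d).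
  { destruct (pow_lt_1_zero (/2)) with (y := d / (w + 1)) as [N HN].
    - rewrite Rabs_right; lra.
    - apply Rdiv_lt_0_compat; lra.
    - exists N. specialize (HN N (le_n N)).
      rewrite Rabs_right in HN by (apply Rle_ge, Rlt_le, pow_lt; lra).
      rewrite pow_inv in HN.
      assert (Q := Rinv_0_lt_compat _ (P2 N)).
      apply Rle_lt_trans with ((w + 1) * / 2 ^ N).
      + unfold Rdiv. apply Rmult_le_compat_r; lra.
      + apply Rmult_lt_reg_l with (/ (w + 1)); [apply Rinv_0_lt_compat; lra|].
        rewrite <- Rmult_assoc, Rinv_l, Rmult_1_l by lra. unfold Rdiv in HN. lra. }
  destruct Hn as [n Hn].
  specialize (HI n). specialize (Hxs n). specialize (Hys n). simpl in Hxs, Hys.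
  set (zs := (xs, ys) : C) in *.
  set (aff := fun z : C => (f zs + l * (z - zs))%C).
  assert (Haff : holo b aff).
  { apply holo_plus; [apply holo_const|]. apply holo_mult; [apply holo_const|].
    apply holo_minus; [apply holo_id | apply holo_const]. }
  (* An affine function has a quadratic primitive, so subtracting it does not change the boundary
     integral. *)
  assert (E0 : rect_int aff (fst (Z n)) (fst (Z n) + p / 2 ^ n) (snd (Z n)) (snd (Z n) + q / 2 ^ n) = RtoC 0).
  { assert (A := HZ n). assert (A1 := Hp2 n).
    apply rect_int_primitive with b (fun z => f zs * z + l / 2 * ((z - zs) * (z - zs)))%C; auto; [|lra].
    intros z _. unfold aff.
    replace (f zs + l * (z - zs))%C with (f zs * RtoC 1 + l / 2 * (2 * (z - zs) * (RtoC 1 - RtoC 0)))%C by field.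
    apply cderiv_plus.
    - apply cderiv_scal, cderiv_id.
    - apply cderiv_scal. apply (cderiv_comp (fun w => w * w)%C (fun z => z - zs)%C).
      + apply cderiv_sqr.
      + apply cderiv_minus; [apply cderiv_id | apply cderiv_const]. }
  assert (Wn : w / 2 ^ n = p / 2 ^ n + q / 2 ^ n) by (unfold w; field; specialize (P2 n); lra).
  assert (HB : Cmod (I n (Z n)) <= 2 * (w / 2 ^ n) * (e * (w / 2 ^ n))).
  { assert (A := HZ n). assert (A1 := Hp2 n). assert (A2 := Hq2 n).
    replace (I n (Z n)) with (rect_int (fun z => f z - aff z)%C (fst (Z n)) (fst (Z n) + p / 2 ^ n)
      (snd (Z n)) (snd (Z n) + q / 2 ^ n)).
    2: { rewrite (rect_int_minus b) by (auto; lra). rewrite E0. unfold I. ring. }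
    eapply Rle_trans.
    - eapply (rect_int_bound b) with (M := e * (w / 2 ^ n)); auto; try lra.
      + apply holo_minus; auto.
      + intros u v Hu Hv.
        assert (Hz : Cmod ((u, v) - zs) <= w / 2 ^ n).
        { eapply Rle_trans; [apply Cmod_le_Re_Im|]. unfold zs; simpl. rewrite Wn.
          apply Rplus_le_compat; apply Rabs_le; lra. }
        unfold aff. replace (f (u, v) - (f zs + l * ((u, v) - zs)))%C
          with (f (u, v) - f zs - l * ((u, v) - zs))%C by ring.
        eapply Rle_trans; [apply H; lra|]. apply Rmult_le_compat_l; lra.
    - right. rewrite Wn. f_equal. ring. }
  assert (K : Cmod (I 0%nat (x, y)) <= 2 * w * w * e).
  { assert (P4 : 4 ^ n = 2 ^ n * 2 ^ n) by (rewrite <- Rpow_mult_distr; f_equal; lra).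
    apply Rmult_le_reg_r with (/ 4 ^ n); [apply Rinv_0_lt_compat, pow_lt; lra|].
    unfold Rdiv in HI at 1. eapply Rle_trans; [exact HI|]. eapply Rle_trans; [exact HB|].
    right. rewrite P4. field. specialize (P2 n). lra. }
  replace (rect_int f x (x + p) y (y + q)) with (I 0%nat (x, y)).
  2: { unfold I, fst, snd. simpl. f_equal; field. }
  eapply Rle_trans; [exact K|]. unfold e.
  apply Rmult_le_reg_r with (2 * w * w + 1); [nra|].
  replace (2 * w * w * (eps / (2 * w * w + 1)) * (2 * w * w + 1)) with (2 * w * w * eps) by (field; nra).
  nra.
Qed.

Lemma Cint_swap f a b : ex_Cint f a b -> Cint f b a = (- Cint f a b)%C.
Proof.
  intros H. apply is_Cint_unique. destruct (Cint_correct _ _ _ H).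
  split; apply (is_RInt_swap (V := R_NormedModule)); auto.
Qed.

(** Exchanging two opposite sides changes the sign of the boundary integral, so the vanishing does
    not depend on the order of the corners; the primitive needs it for points in any position. *)
Lemma rect_int_0 b f x1 x2 y1 y2 : holo b f -> b < x1 -> b < x2 ->
  rect_int f x1 x2 y1 y2 = RtoC 0.
Proof.
  intros Hf H1 H2.
  assert (G : forall u v y z, b < u -> u <= v -> y <= z -> rect_int f u v y z = RtoC 0).
  { intros u v y z Hu Huv Hyz. replace v with (u + (v - u)) by ring.
    replace z with (y + (z - y)) by ring. apply (goursat b); auto; lra. }
  assert (Sx : forall u v y z, b < u -> b < v -> rect_int f v u y z = (- rect_int f u v y z)%C).
  { intros u v y z Hu Hv. unfold rect_int.
    rewrite (Cint_swap (fun r => f (r, y)) u v), (Cint_swap (fun r => f (r, z)) u v)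
      by (eapply holo_hint; eauto). ring. }
  assert (Sy : forall u v y z, b < u -> b < v -> rect_int f u v z y = (- rect_int f u v y z)%C).
  { intros u v y z Hu Hv. unfold rect_int.
    rewrite (Cint_swap (fun r => f (u, r)) y z), (Cint_swap (fun r => f (v, r)) y z)
      by (eapply holo_vint; eauto). ring. }
  assert (G' : forall u v, b < u -> b < v -> u <= v -> rect_int f u v y1 y2 = RtoC 0).
  { intros u v Hu Hv Huv. destruct (Rle_dec y1 y2) as [Hy|Hy].
    - apply G; auto.
    - rewrite Sy, G by (auto; lra). ring. }
  destruct (Rle_dec x1 x2).
  - apply G'; auto.
  - rewrite Sx, G' by (auto; lra). ring.
Qed.

(* The complex primitive, integrated along the horizontal line [Im z = c] first. *)
Lemma holo_primitive b f x0 c : holo b f -> b < x0 ->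
  exists F, (forall z, b < Re z -> cderiv F z (f z)) /\
    (forall x, F (x, c) = Cint (fun r => f (r, c)) x0 x).
Proof.
  intros Hf H0.
  set (F := fun z : C => (Cint (fun r => f (r, c)) x0 (Re z)
                          + Ci * Cint (fun t => f (Re z, t)) c (Im z))%C).
  exists F. split.
  2: { intros x. unfold F; simpl. replace (Cint (fun t => f (x, t)) c c) with (RtoC 0). ring.
       unfold Cint. rewrite !(RInt_point (V := R_CompleteNormedModule)). auto. }
  (* The rectangle between the lines [Im = c] and [Im = Im z] has zero boundary integral, so the
     path from the base point to [w] may be routed through [z]. *)
  assert (Hinc : forall z w : C, b < Re z -> b < Re w ->
    (F w - F z)%C = (Cint (fun r => f (r, Im z)) (Re z) (Re w) + Ci * Cint (fun t => f (Re w, t)) (Im z) (Im w))%C).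
  { intros [x y] [u v] Hz Hw; simpl in *. unfold F; simpl.
    rewrite <- (Cint_Chasles (fun r => f (r, c)) x0 x u) by (apply (holo_hint b); auto).
    rewrite <- (Cint_Chasles (fun r => f (u, r)) c y v) by (apply (holo_vint b); auto).
    assert (R := rect_int_0 b f x u c y Hf Hz Hw). unfold rect_int in R.
    apply Ceq_minus. rewrite <- R. ring. }
  intros z Hz eps He.
  destruct (Hf z Hz) as [l Hl].
  destruct (cderiv_continuous f z l Hl (eps / 2)) as [d [Hd Hc]]; [lra|].
  (* The bound [d / 2] on each of the two coordinates keeps the whole path within [d] of [z], and
     [Re z - b] keeps it in the half-plane. *)
  exists (Rmin (d / 2) (Re z - b)). split; [apply Rmin_pos; lra|].
  intros w Hw.
  assert (Hw1 := Rlt_le_trans _ _ _ Hw (Rmin_l _ _)).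
  assert (Hw2 := Rlt_le_trans _ _ _ Hw (Rmin_r _ _)).
  assert (A1 := Re_le_Cmod (w - z)). assert (A2 := Im_le_Cmod (w - z)).
  assert (Ar : Re (w - z) = Re w - Re z) by (destruct w, z; reflexivity).
  assert (Ai : Im (w - z) = Im w - Im z) by (destruct w, z; reflexivity).
  rewrite Ar in A1. rewrite Ai in A2.
  assert (A3 := Rcomplements.Rabs_le_between (Re w - Re z) (Cmod (w - z))).
  assert (Hwb : b < Re w) by (apply A3 in A1; lra).
  rewrite (Hinc z w) by auto.
  assert (I1 : is_Cint (fun r => f (r, Im z) - f z)%C (Re z) (Re w)
    (Cint (fun r => f (r, Im z)) (Re z) (Re w) - RtoC (Re w - Re z) * f z)%C).
  { apply is_Cint_minus; [|apply is_Cint_const]. apply Cint_correct. eapply holo_hint; eauto. }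
  assert (I2 : is_Cint (fun r => f (Re w, r) - f z)%C (Im z) (Im w)
    (Cint (fun r => f (Re w, r)) (Im z) (Im w) - RtoC (Im w - Im z) * f z)%C).
  { apply is_Cint_minus; [|apply is_Cint_const]. apply Cint_correct. eapply holo_vint; eauto. }
  assert (Hbox : forall x y, Rabs (x - Re z) <= Rabs (Re w - Re z) -> Rabs (y - Im z) <= Rabs (Im w - Im z) ->
     Cmod (f (x, y) - f z) <= eps / 2).
  { intros x y Hx Hy. apply Rlt_le, Hc. eapply Rle_lt_trans; [apply Cmod_le_Re_Im|].
    destruct z; simpl in *. unfold Rminus in *. lra. }
  assert (Btw : forall a c t, Rmin a c <= t <= Rmax a c -> Rabs (t - a) <= Rabs (c - a)).
  { intros a c' t. unfold Rmin, Rmax. destruct (Rle_dec a c'); intros;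
    [rewrite !Rabs_right by lra | rewrite !Rabs_left1 by lra]; lra. }
  apply is_Cint_Cmod_le_const with (M := eps / 2) in I1.
  2: { intros t Ht. apply Hbox; [apply Btw; auto|]. rewrite Rminus_diag, Rabs_R0. apply Rabs_pos. }
  apply is_Cint_Cmod_le_const with (M := eps / 2) in I2.
  2: { intros t Ht. apply Hbox; [lra|apply Btw; auto]. }
  match goal with |- Cmod ?X <= _ => replace X with
   ((Cint (fun r => f (r, Im z)) (Re z) (Re w) - RtoC (Re w - Re z) * f z)
    + Ci * (Cint (fun r => f (Re w, r)) (Im z) (Im w) - RtoC (Im w - Im z) * f z))%C end.
  - eapply Rle_trans; [apply Cmod_triangle|]. rewrite Cmod_mult, Cmod_Ci.
    assert (Hz0 := Cmod_ge_0 (w - z)). nra.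
  - replace (w - z)%C with (RtoC (Re w - Re z) + Ci * RtoC (Im w - Im z))%C.
    + ring.
    + destruct w, z; unfold Cminus, Cplus, Cmult, RtoC, Ci, Copp, Re, Im; simpl. f_equal; ring.
Qed.

(** * Unique continuation and Laplace transforms *)

Lemma cderiv_0_const b k : (forall z, b < Re z -> cderiv k z (RtoC 0)) ->
  forall z w, b < Re z -> b < Re w -> k w = k z.
Proof.
  intros H z w Hz Hw.
  assert (I1 : is_Cint (fun _ => RtoC 0 * (w - z))%C 0 1
    (k (z + RtoC 1 * (w - z))%C - k (z + RtoC 0 * (w - z))%C)%C).
  { apply (is_Cint_derive (fun t => k (z + RtoC t * (w - z))%C)).
    - rewrite Rmin_left, Rmax_right by lra. intros t Ht.
      apply cderiv_line, H.
      replace (Re (z + RtoC t * (w - z))) with ((1 - t) * Re z + t * Re w)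
        by (destruct z, w; unfold Re, RtoC, Cplus, Cminus, Cmult, Copp; simpl; ring).
      destruct (Rle_lt_or_eq_dec 0 t (proj1 Ht)) as [Hp| <-]; [|lra].
      nra.
    - intros; apply ccont_const. }
  apply is_Cint_unique in I1.
  rewrite (is_Cint_unique _ _ _ _ (is_Cint_const _ 0 1)) in I1.
  replace (z + RtoC 1 * (w - z))%C with w in I1 by ring.
  replace (z + RtoC 0 * (w - z))%C with z in I1 by ring.
  apply Ceq_minus. rewrite <- I1. ring.
Qed.

Lemma ccont_bounded f a b : a <= b -> (forall t, a <= t <= b -> ccont f t) ->
  exists M, forall t, a <= t <= b -> Cmod (f t) <= M.
Proof.
  intros Hab H.
  assert (B : forall g : R -> R, (forall t, a <= t <= b -> continuous g t) ->
    exists M, forall t, a <= t <= b -> Rabs (g t) <= M).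
  { intros g Hg. destruct (continuity_ab_maj (fun t => Rabs (g t)) a b Hab) as [m [Hm _]].
    - intros t Ht. apply continuity_pt_filterlim.
      apply (continuous_comp g Rabs). apply Hg; auto. apply continuous_Rabs.
    - exists (Rabs (g m)). auto. }
  destruct (B (fun t => Re (f t))) as [M1 H1]; [intros t Ht; exact (proj1 (H t Ht))|].
  destruct (B (fun t => Im (f t))) as [M2 H2]; [intros t Ht; exact (proj2 (H t Ht))|].
  exists (M1 + M2). intros t Ht. eapply Rle_trans; [apply Cmod_le_Re_Im|].
  apply Rplus_le_compat; auto.
Qed.

Lemma exp_le x y : x <= y -> exp x <= exp y.
Proof. intros [H| ->]; [apply Rlt_le, exp_increasing; auto | lra]. Qed.

(* Integrate [f(z) exp(l (z-z0)^2)] around a rectangle whose left side is centred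
   at [z0] and whose right side lies in the region where [f] vanishes: on the
   left side the weight is a Gaussian concentrating at [z0], while on the
   horizontal sides of a tall rectangle it is negligible as [l] grows. *)
Lemma holo_vanish b B f : holo b f -> (forall s, B < Re s -> f s = RtoC 0) ->
  forall z, b < Re z -> f z = RtoC 0.
Proof.
  intros Hf HB z0 Hz0. apply NNPP. intros Hne.
  destruct (Rlt_dec B (Re z0)) as [HBz|HBz]; [apply Hne, HB; auto|].
  (* Normalized to 1 at [z0], the function has real part at least [1/2] nearby, so real parts of
     integrals can be bounded from below. *)
  set (f1 := fun z => (/ f z0 * f z)%C).
  assert (Hf1 : holo b f1) by (apply holo_mult; [apply holo_const | auto]).
  assert (Ef1 : f1 z0 = RtoC 1) by (unfold f1; field; auto).
  assert (Hz1 : forall s, B < Re s -> f1 s = RtoC 0).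
  { intros s Hs. unfold f1. rewrite (HB s Hs). ring. }
  clearbody f1. clear Hf HB Hne f.
  destruct z0 as [x0 y0]. simpl in Hz0, HBz.
  set (x2 := B + 1). set (W := x2 - x0). assert (HW : 1 <= W) by (unfold W, x2; lra).
  (* The half-height exceeds the width by 1, so [R0^2 - (x - x0)^2 >= d^2] on the horizontal sides,
     where the Gaussian weight is then at most [exp (- lam * (d * d))]. *)
  set (R0 := W + 1).
  destruct (Hf1 (x0, y0) Hz0) as [l Hl].
  destruct (cderiv_continuous _ _ _ Hl (1 / 2)) as [d0 [Hd0 Hc0]]; [lra|].
  set (d := Rmin d0 1).
  assert (Hd : 0 < d) by (apply Rmin_pos; lra).
  assert (Hd1 : d <= 1) by apply Rmin_r.
  assert (Hc : forall t, Rabs (t - y0) < d -> 1 / 2 <= Re (f1 (x0, t))).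
  { intros t Ht. assert (K : Cmod (f1 (x0, t) - f1 (x0, y0)) < 1 / 2).
    { apply Hc0. eapply Rle_lt_trans; [apply Cmod_le_Re_Im|]. simpl.
      replace (x0 + - x0) with 0 by ring. rewrite Rabs_R0, Rplus_0_l.
      eapply Rlt_le_trans; [exact Ht | apply Rmin_l]. }
    rewrite Ef1 in K. assert (K' := Re_le_Cmod (f1 (x0, t) - 1)).
    replace (Re (f1 (x0, t) - 1)) with (Re (f1 (x0, t)) - 1) in K'
      by (destruct (f1 (x0, t)); simpl; ring).
    assert (K2 := proj1 (Rcomplements.Rabs_le_between _ _) K'). lra. }
  destruct (ccont_bounded (fun t => f1 (x0, t)) (y0 - R0) (y0 + R0)) as [M1 HM1].
  { unfold R0; lra. } { intros; eapply holo_vcont; eauto. }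
  destruct (ccont_bounded (fun r => f1 (r, y0 - R0)) x0 x2) as [M2 HM2].
  { unfold W in HW; lra. } { intros; eapply holo_hcont; eauto; lra. }
  destruct (ccont_bounded (fun r => f1 (r, y0 + R0)) x0 x2) as [M3 HM3].
  { unfold W in HW; lra. } { intros; eapply holo_hcont; eauto; lra. }
  assert (PM1 := Rle_trans _ _ _ (Cmod_ge_0 _) (HM1 y0 ltac:(unfold R0; lra))).
  assert (PM2 := Rle_trans _ _ _ (Cmod_ge_0 _) (HM2 x0 ltac:(unfold W in HW; lra))).
  assert (PM3 := Rle_trans _ _ _ (Cmod_ge_0 _) (HM3 x0 ltac:(unfold W in HW; lra))).
  set (M := M1 + M2 + M3).
  set (K := (2 * R0 * M + 2 * W * M) * (2 / d)).
  assert (HK : 0 <= K).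
  { unfold K, M, R0. apply Rmult_le_pos; [nra|]. apply Rlt_le, Rdiv_lt_0_compat; lra. }
  (* The choice gives [3/4 lam d^2 = K]. With [q = exp (- lam * (d * d))], the middle of the left
     side contributes at least [(d/2) q exp K], and everything else at most [(d/2) q K]. Hence
     [exp K <= K], against [1 + K <= exp K]. *)
  set (lam := 4 / 3 * K / (d * d)).
  assert (Hlam : 0 <= lam).
  { unfold lam. apply Rmult_le_pos; [lra|]. apply Rlt_le, Rinv_0_lt_compat; nra. }
  set (g := fun z : C => (f1 z * cexp (RtoC lam * ((z - (x0, y0)) * (z - (x0, y0)))))%C).
  assert (Hg : holo b g).
  { apply holo_mult; auto. apply holo_cexp. apply holo_mult; [apply holo_const|].
    apply holo_mult; (apply holo_minus; [apply holo_id | apply holo_const]). }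
  assert (Emod : forall x y, Cmod (g (x, y)) = Cmod (f1 (x, y)) * exp (lam * ((x - x0) * (x - x0) - (y - y0) * (y - y0)))).
  { intros x y. unfold g. rewrite Cmod_mult, Cmod_cexp, Re_scal_R. do 3 f_equal. }
  assert (ERe : forall y, Re (g (x0, y)) = Re (f1 (x0, y)) * exp (- lam * ((y - y0) * (y - y0)))).
  { intros y. unfold g, cexp. rewrite Re_scal_R, Im_scal_R. simpl.
    replace (lam * ((x0 + - x0) * (y + - y0) + (y + - y0) * (x0 + - x0))) with 0 by ring.
    rewrite cos_0, sin_0.
    replace (lam * ((x0 + - x0) * (x0 + - x0) - (y + - y0) * (y + - y0)))
      with (- lam * ((y - y0) * (y - y0))) by ring.
    unfold Re; ring. }
  assert (Hx2 : b < x2) by (unfold W in HW; lra).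
  assert (R := rect_int_0 b g x0 x2 (y0 - R0) (y0 + R0) Hg Hz0 Hx2). unfold rect_int in R.
  assert (Rz : Cint (fun t => g (x2, t)) (y0 - R0) (y0 + R0) = RtoC 0).
  { apply is_Cint_unique. replace (RtoC 0) with (RtoC (y0 + R0 - (y0 - R0)) * RtoC 0)%C by ring.
    apply is_Cint_ext with (fun _ => RtoC 0); [|apply is_Cint_const].
    intros t _. unfold g. rewrite Hz1. ring. unfold x2; simpl; lra. }
  rewrite Rz in R.
  set (q := exp (- lam * (d * d))).
  assert (Hq : 0 < q) by apply exp_pos.
  assert (Hside : forall y x, (y = y0 - R0 \/ y = y0 + R0) -> x0 <= x <= x2 ->
     Cmod (f1 (x, y)) <= M -> Cmod (g (x, y)) <= M * q).
  { intros y x Hy Hx Hm. rewrite Emod. apply Rmult_le_compat; auto.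
    - apply Cmod_ge_0.
    - apply Rlt_le, exp_pos.
    - apply exp_le. replace ((y - y0) * (y - y0)) with (R0 * R0).
      2: { destruct Hy; subst y; ring. }
      assert ((x - x0) * (x - x0) <= W * W) by (unfold W; apply Rmult_le_compat; lra).
      assert (d * d <= R0 * R0 - (x - x0) * (x - x0)) by (unfold R0; nra).
      nra. }
  assert (B1 : Cmod (Cint (fun r => g (r, y0 - R0)) x0 x2) <= W * (M * q)).
  { replace W with (Rabs (x2 - x0)) by (apply Rabs_right; fold W; lra).
    apply is_Cint_Cmod_le_const with (fun r => g (r, y0 - R0)).
    - rewrite Rmin_left, Rmax_right by (unfold W in HW; lra). intros t Ht.
      apply Hside; auto. eapply Rle_trans; [apply HM2; auto|]. unfold M; lra.
    - apply Cint_correct. apply (holo_hint b); auto. }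
  assert (B2 : Cmod (Cint (fun r => g (r, y0 + R0)) x0 x2) <= W * (M * q)).
  { replace W with (Rabs (x2 - x0)) by (apply Rabs_right; fold W; lra).
    apply is_Cint_Cmod_le_const with (fun r => g (r, y0 + R0)).
    - rewrite Rmin_left, Rmax_right by (unfold W in HW; lra). intros t Ht.
      apply Hside; auto. eapply Rle_trans; [apply HM3; auto|]. unfold M; lra.
    - apply Cint_correct. apply (holo_hint b); auto. }
  assert (B3 : Cmod (Cint (fun t => g (x0, t)) (y0 - R0) (y0 + R0)) <= 2 * W * M * q).
  { rewrite <- (Rmult_1_l (Cmod (Cint (fun t => g (x0, t)) _ _))), <- Cmod_Ci, <- Cmod_mult.
    replace (Ci * Cint (fun t => g (x0, t)) (y0 - R0) (y0 + R0))%C with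
     (Cint (fun r => g (r, (y0 - R0)%R)) x0 x2 - Cint (fun r => g (r, (y0 + R0)%R)) x0 x2)%C.
    - eapply Rle_trans; [apply Cmod_triangle_minus|]. lra.
    - apply Ceq_minus. rewrite <- R. ring. }
  assert (Xi : forall u v, ex_RInt (fun t => Re (g (x0, t))) u v).
  { intros u v. destruct (holo_vint b g x0 u v Hg Hz0) as [X _]. exact X. }
  assert (L : forall u v m, u <= v -> (forall t, u <= t <= v -> m <= Re (g (x0, t))) ->
     (v - u) * m <= RInt (fun t => Re (g (x0, t))) u v).
  { intros u v m Huv Hm.
    assert (E := RInt_const (V := R_CompleteNormedModule) u v m).
    unfold scal in E; simpl in E; unfold mult in E; simpl in E. rewrite <- E.
    apply RInt_le; auto. apply ex_RInt_const. intros t Ht. apply Hm; lra. }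
  assert (Hlow : forall t, y0 - R0 <= t <= y0 + R0 -> - M * q <= Re (g (x0, t))).
  { intros t Ht. rewrite ERe. assert (P := exp_pos (- lam * ((t - y0) * (t - y0)))).
    destruct (Rlt_dec (Rabs (t - y0)) d) as [Hlt|Hlt].
    - specialize (Hc t Hlt). assert (0 <= M) by (unfold M; lra). nra.
    - assert (Hm := Re_le_Cmod (f1 (x0, t))). assert (Hm' := HM1 t Ht). simpl in Hm'.
      assert (Q : exp (- lam * ((t - y0) * (t - y0))) <= q).
      { apply exp_le. assert (Q1 : d * d <= (t - y0) * (t - y0)).
        { rewrite <- (Rabs_right ((t - y0) * (t - y0)) (Rle_ge _ _ (Rle_0_sqr (t - y0)))), Rabs_mult.
          apply Rmult_le_compat; lra. }
        nra. }
      assert (N := proj1 (Rcomplements.Rabs_le_between _ _) Hm).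
      assert (N' : - M <= Re (f1 (x0, t))) by (unfold M; lra).
      assert (0 <= M) by (unfold M; lra). nra. }
  assert (Hmid : forall t, y0 - d / 2 <= t <= y0 + d / 2 -> 1 / 2 * exp (- lam * (d * d / 4)) <= Re (g (x0, t))).
  { intros t Ht. rewrite ERe. apply Rmult_le_compat; [lra | apply Rlt_le, exp_pos | |].
    - apply Hc. apply Rabs_def1; lra.
    - apply exp_le. assert ((t - y0) * (t - y0) <= d * d / 4) by nra. nra. }
  assert (L1 := L (y0 - R0) (y0 - d / 2) (- M * q) ltac:(unfold R0; lra)
      ltac:(intros; apply Hlow; unfold R0 in *; lra)).
  assert (L2 := L (y0 - d / 2) (y0 + d / 2) _ ltac:(lra) Hmid).
  assert (L3 := L (y0 + d / 2) (y0 + R0) (- M * q) ltac:(unfold R0; lra)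
      ltac:(intros; apply Hlow; unfold R0 in *; lra)).
  assert (Sum : RInt (fun t => Re (g (x0, t))) (y0 - R0) (y0 + R0) =
     RInt (fun t => Re (g (x0, t))) (y0 - R0) (y0 - d / 2) +
     RInt (fun t => Re (g (x0, t))) (y0 - d / 2) (y0 + d / 2) +
     RInt (fun t => Re (g (x0, t))) (y0 + d / 2) (y0 + R0)).
  { rewrite (RInt_Chasles (V := R_CompleteNormedModule) (fun t => Re (g (x0, t)))) by auto.
    rewrite (RInt_Chasles (V := R_CompleteNormedModule) (fun t => Re (g (x0, t)))) by auto.
    reflexivity. }
  assert (Up : RInt (fun t => Re (g (x0, t))) (y0 - R0) (y0 + R0) <= 2 * W * M * q).
  { eapply Rle_trans; [|exact B3]. eapply Rle_trans; [|apply Re_le_Cmod]. apply Rle_abs. }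
  assert (HM0 : 0 <= M) by (unfold M; lra).
  assert (F1 : d / 2 * exp (- lam * (d * d / 4)) <= (2 * R0 * M + 2 * W * M) * q).
  { assert (0 <= M * q * d) by (apply Rmult_le_pos; nra). nra. }
  assert (F2 : exp (- lam * (d * d / 4)) = q * exp K).
  { unfold q. rewrite <- exp_plus. f_equal. unfold lam. field. lra. }
  rewrite F2 in F1.
  assert (F3 : exp K <= K).
  { apply Rmult_le_reg_r with (q * (d / 2)); [apply Rmult_lt_0_compat; lra|].
    replace (K * (q * (d / 2))) with ((2 * R0 * M + 2 * W * M) * q) by (unfold K; field; lra).
    lra. }
  assert (F4 := exp_ineq1_le K). lra.
Qed.

(** * Limits at infinity *)

Definition clim (v : R -> C) (l : C) : Prop :=
  forall eps, 0 < eps -> exists X, forall x, X <= x -> Cmod (v x - l) < eps.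

Lemma clim_ext v w l X : (forall x, X <= x -> v x = w x) -> clim v l -> clim w l.
Proof.
  intros H Hv eps He. destruct (Hv eps He) as [Y HY]. exists (Rmax X Y). intros x Hx.
  rewrite <- H. apply HY. eapply Rle_trans; [apply Rmax_r | apply Hx].
  eapply Rle_trans; [apply Rmax_l | apply Hx].
Qed.

Lemma clim_bound v l K X : clim v l -> (forall x, X <= x -> Cmod (v x) <= K) -> Cmod l <= K.
Proof.
  intros H HK. apply Rnot_lt_le. intros Hlt.
  destruct (H (Cmod l - K)) as [Y HY]; [lra|].
  specialize (HY (Rmax X Y) (Rmax_r _ _)). specialize (HK (Rmax X Y) (Rmax_l _ _)).
  assert (T := Cmod_triangle_minus (v (Rmax X Y)) (v (Rmax X Y) - l)).
  replace (v (Rmax X Y) - (v (Rmax X Y) - l))%C with l in T by ring. lra.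
Qed.

Lemma clim_plus v w l m : clim v l -> clim w m -> clim (fun x => v x + w x)%C (l + m)%C.
Proof.
  intros Hv Hw eps He. destruct (Hv (eps / 2)) as [X HX]; [lra|].
  destruct (Hw (eps / 2)) as [Y HY]; [lra|]. exists (Rmax X Y). intros x Hx.
  specialize (HX x (Rle_trans _ _ _ (Rmax_l _ _) Hx)).
  specialize (HY x (Rle_trans _ _ _ (Rmax_r _ _) Hx)).
  replace (v x + w x - (l + m))%C with ((v x - l) + (w x - m))%C by ring.
  eapply Rle_lt_trans; [apply Cmod_triangle|]. lra.
Qed.

Lemma clim_const c : clim (fun _ => c) c.
Proof.
  intros eps He. exists 0. intros x _. replace (c - c)%C with (RtoC 0) by ring.
  rewrite Cmod_0. auto.
Qed.

Lemma clim_scal c v l : clim v l -> clim (fun x => c * v x)%C (c * l)%C.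
Proof.
  intros Hv eps He. assert (Hc := Cmod_ge_0 c).
  destruct (Hv (eps / (Cmod c + 1))) as [X HX]; [apply Rdiv_lt_0_compat; lra|].
  exists X. intros x Hx. specialize (HX x Hx).
  replace (c * v x - c * l)%C with (c * (v x - l))%C by ring. rewrite Cmod_mult.
  apply Rle_lt_trans with ((Cmod c) * (eps / (Cmod c + 1))).
  - apply Rmult_le_compat_l; lra.
  - apply Rmult_lt_reg_r with (Cmod c + 1); [lra|].
    replace (Cmod c * (eps / (Cmod c + 1)) * (Cmod c + 1)) with (Cmod c * eps) by (field; lra).
    nra.
Qed.

Lemma clim_minus v w l m : clim v l -> clim w m -> clim (fun x => v x - w x)%C (l - m)%C.
Proof.
  intros Hv Hw. replace (l - m)%C with (l + (- (RtoC 1)) * m)%C by ring.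
  apply clim_ext with (fun x => v x + (- (RtoC 1)) * w x)%C 0.
  - intros; ring.
  - apply clim_plus, clim_scal; auto.
Qed.

Lemma clim_unique v l m : clim v l -> clim v m -> l = m.
Proof.
  intros H1 H2. apply Ceq_minus, Cmod_small_eq0. intros eps He.
  apply clim_bound with (fun x => v x - v x)%C 0; [apply clim_minus; auto|].
  intros x _. replace (v x - v x)%C with (RtoC 0) by ring. rewrite Cmod_0. lra.
Qed.

(** As for derivatives, polarization reduces products to squares. *)
Lemma clim_mult v w l m : clim v l -> clim w m -> clim (fun x => v x * w x)%C (l * m)%C.
Proof.
  intros Hv Hw.
  assert (Sq : forall u k, clim u k -> clim (fun x => u x * u x)%C (k * k)%C).
  { intros u k Hu eps He. assert (Hk := Cmod_ge_0 k).
    set (e := Rmin 1 (eps / (2 * Cmod k + 2))).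
    assert (Hep : 0 < e) by (apply Rmin_pos; [lra | apply Rdiv_lt_0_compat; lra]).
    destruct (Hu e Hep) as [X HX]. exists X. intros x Hx. specialize (HX x Hx).
    replace (u x * u x - k * k)%C with ((u x - k) * ((u x - k) + 2 * k))%C by ring.
    rewrite Cmod_mult.
    assert (T := Cmod_triangle (u x - k) (2 * k)). rewrite Cmod_mult, Cmod_R, Rabs_right in T by lra.
    assert (e <= 1) by apply Rmin_l. assert (E2 : e <= eps / (2 * Cmod k + 2)) by apply Rmin_r.
    assert (P := Cmod_ge_0 (u x - k)).
    apply Rle_lt_trans with (Cmod (u x - k) * (1 + 2 * Cmod k)).
    - apply Rmult_le_compat_l; lra.
    - apply Rle_lt_trans with (e * (1 + 2 * Cmod k)); [apply Rmult_le_compat_r; lra|].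
      apply Rle_lt_trans with (eps / (2 * Cmod k + 2) * (1 + 2 * Cmod k)).
      + apply Rmult_le_compat_r; lra.
      + apply Rmult_lt_reg_r with (2 * Cmod k + 2); [lra|].
        replace (eps / (2 * Cmod k + 2) * (1 + 2 * Cmod k) * (2 * Cmod k + 2))
          with (eps * (1 + 2 * Cmod k)) by (field; lra). nra. }
  apply clim_ext with (fun x => / RtoC 4 * ((v x + w x) * (v x + w x) - (v x - w x) * (v x - w x)))%C 0.
  { intros; field. }
  replace (l * m)%C with (/ RtoC 4 * ((l + m) * (l + m) - (l - m) * (l - m)))%C by field.
  apply clim_scal, clim_minus.
  - apply (Sq (fun x => v x + w x)%C), clim_plus; auto.
  - apply (Sq (fun x => v x - w x)%C), clim_minus; auto.
Qed.

(** The tail bound [tau] will be an exponential for Laplace integrals, and the missing mass of a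
    majorant for Dirichlet series. *)
Lemma clim_cauchy (v : R -> C) (tau : R -> R) X :
  (forall p q, X <= p <= q -> Cmod (v q - v p) <= tau p) ->
  (forall eps, 0 < eps -> exists T, X <= T /\ tau T < eps) ->
  exists l, clim v l /\ forall T, X <= T -> Cmod (l - v T) <= tau T.
Proof.
  intros Hv Ht.
  assert (Hc : forall (pr : C -> R), (forall z w, Rabs (pr z - pr w) <= Cmod (z - w)) ->
    exists y : R, filterlim (fun x => pr (v x)) (Rbar_locally p_infty) (locally y)).
  { intros pr Hpr.
    apply (proj1 (filterlim_locally_cauchy (U := R_CompleteSpace) (F := Rbar_locally p_infty) (fun x => pr (v x)))).
    intros eps. destruct (Ht (eps / 2)) as [T [HT1 HT2]].
    { destruct eps; simpl; lra. }
    exists (fun x => T < x). split.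
    - exists T. auto.
    - intros u w Hu Hw. change (Rabs (pr (v w) - pr (v u)) < eps).
      eapply Rle_lt_trans; [apply Hpr|].
      eapply Rle_lt_trans; [apply Cmod_minus_triangle with (y := v T)|].
      rewrite (Cmod_minus_sym (v T)).
      assert (A1 := Hv T u ltac:(lra)). assert (A2 := Hv T w ltac:(lra)). lra. }
  destruct (Hc Re) as [y1 H1].
  { intros z w. eapply Rle_trans; [|apply Re_le_Cmod]. right. destruct z, w; reflexivity. }
  destruct (Hc Im) as [y2 H2].
  { intros z w. eapply Rle_trans; [|apply Im_le_Cmod]. right. destruct z, w; reflexivity. }
  assert (Hl : clim v (y1, y2)).
  { intros eps He. assert (He2 : 0 < eps / 2) by lra.
    destruct (proj1 (filterlim_locally _ _) H1 (mkposreal _ He2)) as [X1 K1].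
    destruct (proj1 (filterlim_locally _ _) H2 (mkposreal _ He2)) as [X2 K2].
    exists (Rmax X1 X2 + 1). intros x Hx.
    assert (Rmax X1 X2 >= X1) by (apply Rle_ge, Rmax_l).
    assert (Rmax X1 X2 >= X2) by (apply Rle_ge, Rmax_r).
    assert (J1 := K1 x ltac:(lra)). assert (J2 := K2 x ltac:(lra)).
    change (Rabs (Re (v x) - y1) < eps / 2) in J1.
    change (Rabs (Im (v x) - y2) < eps / 2) in J2.
    eapply Rle_lt_trans; [apply Cmod_le_Re_Im|].
    replace (Re (v x - (y1, y2))) with (Re (v x) - y1) by (destruct (v x); reflexivity).
    replace (Im (v x - (y1, y2))) with (Im (v x) - y2) by (destruct (v x); reflexivity).
    lra. }
  exists (y1, y2). split; auto. intros T HT.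
  apply clim_bound with (fun x => v x - v T)%C T.
  - apply clim_minus; [auto | apply clim_const].
  - intros x Hx. apply Hv; lra.
Qed.

(** A quadratic remainder whose constant does not depend on the truncation [x] survives the limit.
    This exchanges limit and derivative while the derivatives [w] need to converge at the single
    point [s] only. *)
Lemma cderiv_of_limit (v : C -> R -> C) (w : R -> C) (f : C -> C) (s g : C) r K X :
  0 < r -> (forall z, Cmod (z - s) < r -> clim (v z) (f z)) -> clim w g ->
  (forall z x, Cmod (z - s) < r -> X <= x ->
     Cmod (v z x - v s x - w x * (z - s)) <= K * (Cmod (z - s) * Cmod (z - s))) ->
  cderiv f s g.
Proof.
  intros Hr Hv Hw H eps He.
  assert (Hs : Cmod (s - s) < r) by (replace (s - s)%C with (RtoC 0) by ring; rewrite Cmod_0; auto).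
  assert (HK := Rabs_pos K).
  exists (Rmin r (eps / (Rabs K + 1))). split.
  { apply Rmin_pos; auto. apply Rdiv_lt_0_compat; lra. }
  intros z Hz.
  assert (Hz1 := Rlt_le_trans _ _ _ Hz (Rmin_l _ _)).
  assert (Hz2 := Rlt_le_trans _ _ _ Hz (Rmin_r _ _)).
  assert (Hz0 := Cmod_ge_0 (z - s)).
  assert (B : Cmod (f z - f s - g * (z - s)) <= K * (Cmod (z - s) * Cmod (z - s))).
  { apply clim_bound with (fun x => v z x - v s x - w x * (z - s))%C X.
    - apply clim_minus; [apply clim_minus; auto|].
      apply clim_mult; [auto | apply clim_const].
    - intros x Hx. apply H; auto. }
  eapply Rle_trans; [exact B|]. rewrite <- Rmult_assoc. apply Rmult_le_compat_r; auto.
  assert (K <= Rabs K) by apply Rle_abs.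
  apply Rle_trans with ((Rabs K + 1) * Cmod (z - s)); [nra|].
  apply Rle_trans with ((Rabs K + 1) * (eps / (Rabs K + 1))).
  - apply Rmult_le_compat_l; lra.
  - right; field; lra.
Qed.

(* Riemann integrability on the half-line, in the form stable under
   multiplication by continuous functions. *)
Definition loc_int (a : R -> R) : Prop :=
  forall phi : R -> R, (forall t, continuous phi t) ->
  forall p q, 0 <= p -> 0 <= q -> ex_RInt (fun u => a u * phi u) p q.

Lemma loc_int_ex_Cint a phi p q : loc_int a -> (forall t, ccont phi t) -> 0 <= p -> 0 <= q ->
  ex_Cint (fun u => RtoC (a u) * phi u)%C p q.
Proof.
  intros Ha Hp H1 H2. split.
  - apply ex_RInt_ext with (fun u => a u * Re (phi u)).
    + intros; rewrite Re_scal_R; auto.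
    + apply Ha; auto. intros t; exact (proj1 (Hp t)).
  - apply ex_RInt_ext with (fun u => a u * Im (phi u)).
    + intros; rewrite Im_scal_R; auto.
    + apply Ha; auto. intros t; exact (proj2 (Hp t)).
Qed.

Lemma is_RInt_exp_decay K c p q : 0 < c ->
  is_RInt (fun u => K * exp (- c * u)) p q (K / c * (exp (- c * p) - exp (- c * q))).
Proof.
  intros Hc.
  replace (K / c * (exp (- c * p) - exp (- c * q)))
    with (minus (- (K / c) * exp (- c * q)) (- (K / c) * exp (- c * p))).
  2: { unfold minus, plus, opp; simpl. ring. }
  apply (is_RInt_derive (V := R_CompleteNormedModule) (fun u => - (K / c) * exp (- c * u))).
  - intros x _. auto_derive; auto. field. lra.
  - intros x _. apply (ex_derive_continuous (V := R_NormedModule)). auto_derive. auto.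
Qed.

Lemma Cint_exp_decay f K c p q : ex_Cint f p q -> 0 < c -> p <= q -> 0 <= K ->
  (forall u, p <= u <= q -> Cmod (f u) <= K * exp (- c * u)) ->
  Cmod (Cint f p q) <= K / c * exp (- c * p).
Proof.
  intros Hf Hc Hpq HK H.
  eapply Rle_trans.
  - eapply is_Cint_Cmod_le; [exact Hpq | exact H | apply Cint_correct, Hf | apply is_RInt_exp_decay; auto].
  - apply Rmult_le_compat_l.
    + apply Rmult_le_pos; auto. apply Rlt_le, Rinv_0_lt_compat; auto.
    + assert (P := exp_pos (- c * q)). lra.
Qed.

Definition lap (a : R -> R) (s : C) (T : R) : C :=
  Cint (fun u => RtoC (a u) * cexp (RtoC u * - s))%C 0 T.

Lemma lap_ex a s p q : loc_int a -> 0 <= p -> 0 <= q ->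
  ex_Cint (fun u => RtoC (a u) * cexp (RtoC u * - s))%C p q.
Proof. intros. apply loc_int_ex_Cint; auto. intros; apply ccont_cexp_ray. Qed.

Lemma Cmod_lap_integrand a s u : Cmod (RtoC (a u) * cexp (RtoC u * - s)) = Rabs (a u) * exp (- Re s * u).
Proof.
  rewrite Cmod_mult, Cmod_R, Cmod_cexp, Re_scal_R. f_equal. f_equal.
  destruct s; simpl; ring.
Qed.

Lemma exp_decay_small K c eps : 0 < c -> 0 < eps -> exists T, 0 <= T /\ K * exp (- c * T) < eps.
Proof.
  intros Hc He. assert (HK := Rabs_pos K).
  exists (Rabs K / (eps * c)). 
  assert (HT : 0 <= Rabs K / (eps * c)).
  { apply Rmult_le_pos; auto. apply Rlt_le, Rinv_0_lt_compat, Rmult_lt_0_compat; auto. }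
  split; auto.
  replace (- c * (Rabs K / (eps * c))) with (- (Rabs K / eps)) by (field; lra).
  rewrite exp_Ropp. assert (E := exp_ineq1_le (Rabs K / eps)).
  assert (P := exp_pos (Rabs K / eps)).
  apply Rmult_lt_reg_r with (exp (Rabs K / eps)); auto.
  rewrite Rmult_assoc, Rinv_l by lra. rewrite Rmult_1_r.
  assert (K <= Rabs K) by apply Rle_abs.
  apply Rlt_le_trans with (eps * (1 + Rabs K / eps)).
  - replace (eps * (1 + Rabs K / eps)) with (eps + Rabs K) by (field; lra). lra.
  - apply Rmult_le_compat_l; lra.
Qed.

Lemma lap_limit a b M : loc_int a -> (forall u, 0 <= u -> Rabs (a u) <= M * exp (b * u)) ->
  forall s, b < Re s -> exists l, clim (lap a s) l.
Proof.
  intros Ha HM s Hs.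
  assert (HM0 : 0 <= M).
  { specialize (HM 0 (Rle_refl 0)). rewrite Rmult_0_r, exp_0 in HM.
    assert (P := Rabs_pos (a 0)). lra. }
  destruct (clim_cauchy (lap a s) (fun p => M / (Re s - b) * exp (- (Re s - b) * p)) 0) as [l [Hl _]].
  - intros p q Hpq. unfold lap.
    rewrite <- (Cint_Chasles _ 0 p q) by (apply lap_ex; auto; lra).
    match goal with |- Cmod (?X + ?Y - ?X) <= _ => replace (X + Y - X)%C with Y by ring end.
    apply Cint_exp_decay; try lra.
    + apply lap_ex; auto; lra.
    + intros u Hu. rewrite Cmod_lap_integrand.
      apply Rle_trans with (M * exp (b * u) * exp (- Re s * u)).
      * apply Rmult_le_compat_r; [apply Rlt_le, exp_pos | apply HM; lra].
      * right. rewrite Rmult_assoc, <- exp_plus. do 2 f_equal. ring.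
  - intros eps He. apply exp_decay_small; lra.
  - exists l; auto.
Qed.

(** Obtained by squaring [1 + x/2 <= exp (x/2)]; it absorbs into a small exponential the quadratic
    factors that Taylor remainders produce. *)
Lemma exp_ge_sqr x : 0 <= x -> x * x / 4 <= exp x.
Proof.
  intros Hx. replace x with (x / 2 + x / 2) at 3 by field. rewrite exp_plus.
  assert (H := exp_ineq1_le (x / 2)). nra.
Qed.

Lemma loc_int_scal_id a : loc_int a -> loc_int (fun u => - u * a u).
Proof.
  intros Ha phi Hphi p q Hp Hq.
  apply ex_RInt_ext with (fun u => a u * (- u * phi u)).
  { intros u _. change (a u * (- u * phi u) = - u * a u * phi u). ring. }
  apply Ha; auto. intros t. apply (continuous_mult (K := R_AbsRing)); auto.
  apply (continuous_opp (V := R_NormedModule)), continuous_id.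
Qed.

(** Differentiation under the integral sign: the derivative is the transform of [- u * a u], and the
    Taylor remainder of the kernel integrates to a multiple of [|z - s|^2] that does not depend on
    [T]. *)
Lemma lap_holo a b M D : loc_int a -> (forall u, 0 <= u -> Rabs (a u) <= M * exp (b * u)) ->
  (forall s, b < Re s -> clim (lap a s) (D s)) -> holo b D.
Proof.
  intros Ha HM HD s Hs.
  assert (HM0 : 0 <= M).
  { specialize (HM 0 (Rle_refl 0)). rewrite Rmult_0_r, exp_0 in HM.
    assert (P := Rabs_pos (a 0)). lra. }
  (* Of the margin [Re s - b = 4 e], one [e] pays for the factor [u^2], another for the growth of
     the remainder when [Cmod (z - s) < e]; a decay of [2 e] is left. *)
  set (e := (Re s - b) / 4). assert (He : 0 < e) by (unfold e; lra).
  assert (Ha1 := loc_int_scal_id a Ha).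
  destruct (lap_limit (fun u => - u * a u) (b + e) (M / e) Ha1) with (s := s) as [g Hg].
  { intros u Hu. rewrite Rabs_mult, Rabs_Ropp, (Rabs_right u) by lra.
    specialize (HM u Hu). rewrite Rmult_plus_distr_r, exp_plus.
    assert (E := exp_ineq1_le (e * u)). assert (P := exp_pos (b * u)).
    apply Rle_trans with (exp (e * u) / e * (M * exp (b * u))).
    - apply Rmult_le_compat; auto; [apply Rabs_pos|].
      apply Rmult_le_reg_r with e; auto. unfold Rdiv. rewrite Rmult_assoc, Rinv_l by lra. lra.
    - right. field. lra. }
  { unfold e; lra. }
  exists g.
  set (K := 4 * M / (e * e) / (2 * e)).
  apply cderiv_of_limit with (lap a) (lap (fun u => - u * a u) s) e K 0; auto.
  { intros z Hz. apply HD. assert (A := Re_le_Cmod (z - s)).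
    replace (Re (z - s)) with (Re z - Re s) in A by (destruct z, s; reflexivity).
    apply Rcomplements.Rabs_le_between in A. unfold e in *; lra. }
  intros z T Hz HT. set (w := (z - s)%C) in *. assert (Hw := Cmod_ge_0 w).
  assert (I0 : is_Cint (fun u => RtoC (a u) * (cexp (RtoC u * - s) * (cexp (RtoC u * - w) - 1 - RtoC u * - w)))%C 0 T
     (lap a z T - lap a s T - lap (fun u => (- u * a u)%R) s T * w)%C).
  { rewrite (Cmult_comm _ w).
    apply is_Cint_ext with (fun u => RtoC (a u) * cexp (RtoC u * - z) - RtoC (a u) * cexp (RtoC u * - s)
       - w * (RtoC (- u * a u)%R * cexp (RtoC u * - s)))%C.
    - intros u _. replace (RtoC u * - z)%C with (RtoC u * - s + RtoC u * - w)%C by (unfold w; ring).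
      rewrite cexp_plus, RtoC_mult, RtoC_opp. ring.
    - apply is_Cint_minus; [apply is_Cint_minus|apply is_Cint_scal]; apply Cint_correct, lap_ex; auto; lra. }
  assert (Bd : forall u, 0 <= u <= T ->
     Cmod (RtoC (a u) * (cexp (RtoC u * - s) * (cexp (RtoC u * - w) - 1 - RtoC u * - w)))
     <= (4 * M / (e * e) * (Cmod w * Cmod w)) * exp (- (2 * e) * u)).
  { intros u Hu. rewrite Cmod_mult, Cmod_R, Cmod_mult, Cmod_cexp, Re_scal_R.
    replace (u * Re (- s)) with (- Re s * u) by (destruct s; simpl; ring).
    assert (T1 := cexp_taylor_bound (RtoC u * - w)).
    rewrite Cmod_mult, Cmod_R, Cmod_opp, Rabs_right in T1 by lra.
    assert (T2 : exp (u * Cmod w) <= exp (e * u)) by (apply exp_le; nra).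
    assert (T3 : u * u <= 4 / (e * e) * exp (e * u)).
    { assert (Q := exp_ge_sqr (e * u) ltac:(nra)).
      apply Rmult_le_reg_r with (e * e / 4); [nra|].
      replace (4 / (e * e) * exp (e * u) * (e * e / 4)) with (exp (e * u)) by (field; lra). lra. }
    specialize (HM u (proj1 Hu)).
    assert (P1 := exp_pos (- Re s * u)). assert (P2 := exp_pos (e * u)).
    apply Rle_trans with (M * exp (b * u) * (exp (- Re s * u) * ((4 / (e * e) * exp (e * u)) * (Cmod w * Cmod w) * exp (e * u)))).
    - apply Rmult_le_compat; auto; [apply Rabs_pos | apply Rmult_le_pos; [lra|apply Cmod_ge_0] |].
      apply Rmult_le_compat_l; [lra|]. eapply Rle_trans; [exact T1|].
      replace (u * Cmod w * (u * Cmod w)) with (u * u * (Cmod w * Cmod w)) by ring.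
      apply Rmult_le_compat; auto.
      + apply Rmult_le_pos; nra.
      + apply Rlt_le, exp_pos.
      + apply Rmult_le_compat_r; nra.
    - right. transitivity (4 * M / (e * e) * (Cmod w * Cmod w) * (exp (b * u) * exp (- Re s * u) * exp (e * u) * exp (e * u))).
      + field. lra.
      + rewrite <- !exp_plus. do 2 f_equal. unfold e. field. }
  rewrite <- (is_Cint_unique _ _ _ _ I0).
  eapply Rle_trans.
  - apply Cint_exp_decay with (c := 2 * e); [eapply is_Cint_ex; exact I0 | lra | lra | | exact Bd].
    assert (0 <= 4 * M / (e * e)).
    { apply Rmult_le_pos; [lra|]. apply Rlt_le, Rinv_0_lt_compat. nra. }
    apply Rmult_le_pos; nra.
  - rewrite Rmult_0_r, exp_0. right. unfold K. field. lra.
Qed.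

(** * The von Mangoldt function of an arithmetical semigroup *)

Section Sums.
Context {T : Type}.

Definition csum (f : T -> C) (l : list T) : C := fold_right Cplus (RtoC 0) (map f l).
Definition rsum (f : T -> R) (l : list T) : R := fold_right Rplus 0 (map f l).

Lemma csum_perm f l l' : Permutation l l' -> csum f l = csum f l'.
Proof.
  intros H. unfold csum. induction H; simpl; auto.
  - rewrite IHPermutation; auto.
  - ring.
  - congruence.
Qed.

Lemma rsum_perm f l l' : Permutation l l' -> rsum f l = rsum f l'.
Proof.
  intros H. unfold rsum. induction H; simpl; auto.
  - rewrite IHPermutation; auto.
  - ring.
  - congruence.
Qed.

Lemma csum_app f l l' : csum f (l ++ l') = (csum f l + csum f l')%C.
Proof. unfold csum. induction l; simpl; [ring | rewrite IHl; ring]. Qed.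

Lemma rsum_app f l l' : rsum f (l ++ l') = rsum f l + rsum f l'.
Proof. unfold rsum. induction l; simpl; [ring | rewrite IHl; ring]. Qed.

Lemma csum_ext f g l : (forall x, In x l -> f x = g x) -> csum f l = csum g l.
Proof.
  intros H. unfold csum. induction l; simpl; auto.
  rewrite H by (simpl; auto). rewrite IHl; auto. intros; apply H; simpl; auto.
Qed.

Lemma rsum_ext f g l : (forall x, In x l -> f x = g x) -> rsum f l = rsum g l.
Proof.
  intros H. unfold rsum. induction l; simpl; auto.
  rewrite H by (simpl; auto). rewrite IHl; auto. intros; apply H; simpl; auto.
Qed.

Lemma csum_plus f g l : csum (fun x => f x + g x)%C l = (csum f l + csum g l)%C.
Proof. unfold csum. induction l; simpl; [ring | rewrite IHl; ring]. Qed.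

Lemma csum_minus f g l : csum (fun x => f x - g x)%C l = (csum f l - csum g l)%C.
Proof. unfold csum. induction l; simpl; [ring | rewrite IHl; ring]. Qed.

Lemma csum_scal c f l : csum (fun x => c * f x)%C l = (c * csum f l)%C.
Proof. unfold csum. induction l; simpl; [ring | rewrite IHl; ring]. Qed.

Lemma rsum_scal c f l : rsum (fun x => c * f x) l = c * rsum f l.
Proof. unfold rsum. induction l; simpl; [ring | rewrite IHl; ring]. Qed.

Lemma rsum_le f g l : (forall x, In x l -> f x <= g x) -> rsum f l <= rsum g l.
Proof.
  intros H. unfold rsum. induction l; simpl; [lra|].
  apply Rplus_le_compat; [apply H; simpl; auto | apply IHl; intros; apply H; simpl; auto].
Qed.

Lemma rsum_ge0 f l : (forall x, In x l -> 0 <= f x) -> 0 <= rsum f l.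
Proof.
  intros H. replace 0 with (rsum (fun _ => 0) l); [apply rsum_le; auto|].
  unfold rsum. clear. induction l; simpl; auto. rewrite IHl; ring.
Qed.

Lemma Cmod_csum_le f w l : (forall x, In x l -> Cmod (f x) <= w x) -> Cmod (csum f l) <= rsum w l.
Proof.
  intros H. unfold csum, rsum. induction l; simpl; [rewrite Cmod_0; lra|].
  eapply Rle_trans; [apply Cmod_triangle|].
  apply Rplus_le_compat; [apply H; simpl; auto | apply IHl; intros; apply H; simpl; auto].
Qed.

Lemma csum_RtoC f l : csum (fun x => RtoC (f x)) l = RtoC (rsum f l).
Proof. unfold csum, rsum. induction l; simpl; auto. rewrite IHl, RtoC_plus; auto. Qed.

Definition cfilter (P : T -> Prop) (l : list T) : list T :=
  filter (fun x => if excluded_middle_informative (P x) then true else false) l.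

Lemma In_cfilter P l x : In x (cfilter P l) <-> In x l /\ P x.
Proof.
  unfold cfilter. rewrite filter_In.
  destruct (excluded_middle_informative (P x)); intuition discriminate.
Qed.

Lemma NoDup_cfilter P l : NoDup l -> NoDup (cfilter P l).
Proof. apply NoDup_filter. Qed.

Lemma rsum_cfilter P f l :
  rsum f (cfilter P l) = rsum (fun x => if excluded_middle_informative (P x) then f x else 0) l.
Proof.
  unfold rsum, cfilter. induction l; simpl; auto.
  destruct (excluded_middle_informative (P a)); simpl; rewrite IHl; ring.
Qed.

Lemma csum_cfilter P f l :
  csum f (cfilter P l) = csum (fun x => if excluded_middle_informative (P x) then f x else RtoC 0) l.
Proof.
  unfold csum, cfilter. induction l; simpl; auto.
  destruct (excluded_middle_informative (P a)); simpl; rewrite IHl; ring.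
Qed.

End Sums.

Lemma csum_swap {T U : Type} (F : T -> U -> C) l l' :
  csum (fun x => csum (F x) l') l = csum (fun y => csum (fun x => F x y) l) l'.
Proof.
  induction l as [|a l IH].
  - transitivity (csum (fun _ : U => RtoC 0) l').
    + unfold csum; simpl. clear. induction l'; simpl; auto. rewrite <- IHl'; ring.
    + reflexivity.
  - transitivity (csum (F a) l' + csum (fun x => csum (F x) l') l)%C; [reflexivity|].
    rewrite IH, <- csum_plus. reflexivity.
Qed.

Lemma csum_map {T U : Type} (f : U -> C) (m : T -> U) l : csum f (map m l) = csum (fun x => f (m x)) l.
Proof. unfold csum. rewrite map_map. auto. Qed.

Section Arith.
Context (G : arith_semigroup).
Implicit Types (g d e p q : G).

Notation mul := (@as_mul G).
Notation prd := (mprod (@as_one G) mul).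
Notation pw := (mpow (@as_one G) mul).
Notation L := (von_mangoldt (G := G)).

Lemma In_ball x g : In g (norm_ball G x) <-> as_norm g <= x.
Proof. unfold norm_ball. destruct (constructive_indefinite_description _ _) as [l [H1 H2]]. apply H2. Qed.

Lemma NoDup_ball x : NoDup (norm_ball G x).
Proof. unfold norm_ball. destruct (constructive_indefinite_description _ _) as [l [H1 H2]]. apply H1. Qed.

Lemma norm_ge1 g : 1 <= as_norm g.
Proof.
  destruct (classic (g = as_one)) as [-> | H].
  - rewrite as_norm_one; lra.
  - apply Rlt_le, as_norm_gt1; auto.
Qed.

Lemma ln_norm_ge0 g : 0 <= ln (as_norm g).
Proof. rewrite <- ln_1. apply ln_le; [lra | apply norm_ge1]. Qed.

Lemma ln_norm_mul a b : ln (as_norm (mul a b)) = ln (as_norm a) + ln (as_norm b).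
Proof.
  rewrite as_norm_mul. assert (A := norm_ge1 a). assert (B := norm_ge1 b).
  apply ln_mult; lra.
Qed.

Lemma mul1r a : mul a as_one = a.
Proof. rewrite as_mulC. apply as_mul1. Qed.

Lemma prd_app l l' : prd (l ++ l') = mul (prd l) (prd l').
Proof.
  induction l; simpl.
  - symmetry. apply as_mul1.
  - change (mul a (prd (l ++ l')) = mul (mul a (prd l)) (prd l')). rewrite IHl. apply as_mulA.
Qed.

Lemma prd_perm l l' : Permutation l l' -> prd l = prd l'.
Proof.
  intros H. induction H; simpl; auto.
  - f_equal; auto.
  - rewrite !as_mulA. f_equal. apply as_mulC.
  - congruence.
Qed.

Lemma pw_S p k : pw p (S k) = mul p (pw p k).
Proof. reflexivity. Qed.

Lemma pw_add p j k : pw p (j + k) = mul (pw p j) (pw p k).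
Proof. unfold mpow. rewrite repeat_app. apply prd_app. Qed.

Lemma Forall_prime_repeat p k : as_prime p -> List.Forall as_prime (repeat p k).
Proof. intros H. induction k; simpl; auto. Qed.

(** Cancellation is inherited from lists of primes, where a common prefix can be removed from a
    permutation. *)
Lemma mul_cancel a b c : mul a b = mul a c -> b = c.
Proof.
  destruct (as_factor_exists G a) as [la [Pa ->]].
  destruct (as_factor_exists G b) as [lb [Pb ->]].
  destruct (as_factor_exists G c) as [lc [Pc ->]].
  rewrite <- !prd_app. intros H. apply prd_perm.
  apply as_factor_unique in H; [|apply Forall_app; auto|apply Forall_app; auto].
  eapply Permutation_app_inv_l; eauto.
Qed.

(** The lengths of the two factorizations give the exponents; [1 <= j] then provides an occurrence
    of [p] to be found among the copies of [q]. *)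
Lemma pw_inj p q j k : as_prime p -> as_prime q -> (1 <= j)%nat -> pw p j = pw q k -> p = q /\ j = k.
Proof.
  intros Hp Hq Hj H.
  apply as_factor_unique in H; try (apply Forall_prime_repeat; auto).
  assert (E := Permutation_length H). rewrite !repeat_length in E. subst k. split; auto.
  destruct j; [lia|]. apply repeat_spec with (S j).
  eapply Permutation_in; [exact H | simpl; auto].
Qed.

Lemma mangoldt_pw p k : as_prime p -> (1 <= k)%nat -> L (pw p k) = ln (as_norm p).
Proof.
  intros Hp Hk. unfold von_mangoldt.
  destruct (excluded_middle_informative _) as [h|h].
  - destruct (constructive_indefinite_description _ _) as [q [Hq [j [Hj E]]]]. simpl.
    destruct (pw_inj p q k j Hp Hq Hk E) as [-> _]. auto.
  - exfalso. apply h. exists p. split; auto. exists k; auto.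
Qed.

Definition is_pp g : Prop := exists p, is_prime_power g p.

Lemma mangoldt_not_pp g : ~ is_pp g -> L g = 0.
Proof.
  intros H. unfold von_mangoldt. destruct (excluded_middle_informative _) as [h|h]; auto.
  contradiction.
Qed.

Lemma mangoldt_ge0 g : 0 <= L g.
Proof.
  unfold von_mangoldt. destruct (excluded_middle_informative _); [apply ln_norm_ge0 | lra].
Qed.

Definition divs d g : Prop := exists e, mul d e = g.

Lemma divs_norm_le d g : divs d g -> as_norm d <= as_norm g.
Proof.
  intros [e <-]. rewrite as_norm_mul. assert (A := norm_ge1 d). assert (B := norm_ge1 e). nra.
Qed.

Lemma divs_trans a b c : divs a b -> divs b c -> divs a c.
Proof. intros [e <-] [e' <-]. exists (mul e e'). apply as_mulA. Qed.

Lemma pw_le_divs p j k : (j <= k)%nat -> divs (pw p j) (pw p k).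
Proof. intros H. exists (pw p (k - j)). rewrite <- pw_add. f_equal. lia. Qed.

Lemma pw_divs_length p k l : as_prime p -> List.Forall as_prime l -> divs (pw p k) (prd l) ->
  (k <= length l)%nat.
Proof.
  intros Hp Hl [e He]. destruct (as_factor_exists G e) as [le [Pe ->]].
  unfold mpow in He. rewrite <- prd_app in He.
  apply as_factor_unique in He; auto.
  - apply Permutation_length in He. rewrite length_app, repeat_length in He. lia.
  - apply Forall_app; split; auto. apply Forall_prime_repeat; auto.
Qed.

(** Without a last exponent every power of [p] would divide the product, against the bound by the
    number of prime factors. *)
Lemma valuation_exists p l : as_prime p -> List.Forall as_prime l ->
  exists v, divs (pw p v) (prd l) /\ ~ divs (pw p (S v)) (prd l).
Proof.
  intros Hp Hl. apply NNPP. intros H.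
  assert (A : forall k, divs (pw p k) (prd l)).
  { induction k.
    - exists (prd l). apply as_mul1.
    - apply NNPP. intros K. apply H. exists k; auto. }
  specialize (A (S (length l))). apply pw_divs_length in A; auto. lia.
Qed.

(** By unique factorization [p] occurs among the factors of [q^k e]; being different from [q], it
    lies in the cofactor [e] and can be removed there. *)
Lemma pw_divs_other_prime p q k l : as_prime p -> as_prime q -> p <> q -> List.Forall as_prime l ->
  divs (pw q k) (mul p (prd l)) -> divs (pw q k) (prd l).
Proof.
  intros Hp Hq Hne Hl [e He]. destruct (as_factor_exists G e) as [le [Pe ->]].
  unfold mpow in *. rewrite <- prd_app in He.
  change (mul p (prd l)) with (prd (p :: l)) in He.
  apply as_factor_unique in He.
  2: { apply Forall_app; split; auto. apply Forall_prime_repeat; auto. }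
  2: { constructor; auto. }
  assert (Hin : In p (repeat q k ++ le)).
  { eapply Permutation_in; [apply Permutation_sym; exact He | simpl; auto]. }
  apply in_app_or in Hin. destruct Hin as [Hin|Hin].
  - apply repeat_spec in Hin. contradiction.
  - apply in_split in Hin. destruct Hin as [l1 [l2 ->]].
    exists (prd (l1 ++ l2)). rewrite <- prd_app. apply prd_perm.
    apply Permutation_cons_inv with p. rewrite <- He.
    rewrite !app_assoc. apply Permutation_middle.
Qed.

(** Multiplication by [p] creates a single new prime-power divisor, [p^(v+1)], where [v] is the
    exponent of [p] in [prd l]. This is the induction step of the identity that expresses [ln |g|]
    by the von Mangoldt function. *)
Lemma pp_divs_cons p l v d : as_prime p -> List.Forall as_prime l ->
  divs (pw p v) (prd l) -> ~ divs (pw p (S v)) (prd l) ->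
  (is_pp d /\ divs d (mul p (prd l)) <-> d = pw p (S v) \/ (is_pp d /\ divs d (prd l))).
Proof.
  intros Hp Hl Hv Hv'. split.
  - intros [[q [Hq [k [Hk ->]]]] Hd].
    destruct (classic (p = q)) as [<-|Hne].
    + destruct k as [|k]; [lia|].
      assert (Hk' : divs (pw p k) (prd l)).
      { destruct Hd as [e He]. exists e. apply mul_cancel with p.
        rewrite as_mulA, <- pw_S. auto. }
      destruct (Nat.lt_trichotomy k v) as [Hlt|[->|Hgt]]; auto.
      * right. split; [exists p; split; auto; exists (S k); auto|].
        eapply divs_trans; [apply pw_le_divs with (k := v); lia | auto].
      * exfalso. apply Hv'. eapply divs_trans; [apply pw_le_divs with (k := k); lia | auto].
    + right. split; [exists q; split; auto; exists k; auto|].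
      apply pw_divs_other_prime with p; auto.
  - intros [H0 | [H1 H2]]; [subst d|].
    + split; [exists p; split; auto; exists (S v); split; auto; lia|].
      destruct Hv as [e He]. exists e. rewrite pw_S, <- as_mulA, He. auto.
    + split; auto. destruct H2 as [e <-]. exists (mul p e).
      rewrite !as_mulA. f_equal. apply as_mulC.
Qed.

(** Each prime factor adds one prime power, of weight [ln |p|]. The enumeration [D] is arbitrary, so
    that the induction hypothesis applies to the one built for the shorter product. *)
Lemma mangoldt_sum_pp l : List.Forall as_prime l -> forall D : list G, NoDup D ->
  (forall d, In d D <-> is_pp d /\ divs d (prd l)) -> rsum L D = ln (as_norm (prd l)).
Proof.
  induction l as [|p l IH]; intros Hl D HD HI.
  - assert (D = []) as ->.
    { destruct D as [|d D]; auto. exfalso.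
      destruct (proj1 (HI d) (or_introl eq_refl)) as [[q [Hq [k [Hk ->]]]] Hd].
      apply pw_divs_length in Hd; auto. simpl in Hd. lia. }
    unfold rsum; simpl. change (prd []) with (@as_one G). rewrite as_norm_one, ln_1. auto.
  - inversion Hl; subst.
    destruct (valuation_exists p l) as [v [Hv Hv']]; auto.
    set (D' := cfilter (fun d => is_pp d /\ divs d (prd l)) (norm_ball G (as_norm (prd l)))).
    assert (HI' : forall d, In d D' <-> is_pp d /\ divs d (prd l)).
    { intros d. unfold D'. rewrite In_cfilter, In_ball. split; [tauto|].
      intros [A B]. repeat split; auto. apply divs_norm_le; auto. }
    assert (HD' : NoDup D') by (apply NoDup_cfilter, NoDup_ball).
    assert (P : Permutation D (pw p (S v) :: D')).
    { apply NoDup_Permutation; auto.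
      - constructor; auto. rewrite HI'. tauto.
      - intros d. rewrite HI. change (prd (p :: l)) with (mul p (prd l)).
        rewrite (pp_divs_cons p l v d) by auto. simpl. rewrite HI'.
        split; intros [K|K]; auto. }
    rewrite (rsum_perm _ _ _ P). change (prd (p :: l)) with (mul p (prd l)).
    rewrite ln_norm_mul, <- (IH H2 D' HD' HI').
    unfold rsum; cbn [map fold_right]. rewrite mangoldt_pw by (auto; lia). auto.
Qed.

(** Divisibility is an indicator inside a sum over the whole ball, so that the range does not depend
    on [g] and the two sums of the convolution can be exchanged. *)
Lemma mangoldt_divisor_sum x g : as_norm g <= x ->
  rsum (fun d => if excluded_middle_informative (divs d g) then L d else 0) (norm_ball G x)
  = ln (as_norm g).
Proof.
  intros Hx. destruct (as_factor_exists G g) as [l [Hl Eg]].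
  replace (ln (as_norm g)) with (ln (as_norm (prd l))) by (rewrite <- Eg; auto).
  rewrite <- (mangoldt_sum_pp l Hl (cfilter (fun d => is_pp d /\ divs d g) (norm_ball G x))).
  - rewrite rsum_cfilter. apply rsum_ext. intros d _.
    destruct (excluded_middle_informative (divs d g)), (excluded_middle_informative _); auto; try tauto.
    apply mangoldt_not_pp. tauto.
  - apply NoDup_cfilter, NoDup_ball.
  - intros d. rewrite In_cfilter, In_ball, Eg. split; [tauto|]. intros [A B].
    repeat split; auto. rewrite <- Eg in B. apply divs_norm_le in B. lra.
Qed.

(** Since [g] divides itself, its weight is one of the nonnegative terms of the divisor sum. *)
Lemma mangoldt_le_ln g : L g <= ln (as_norm g).
Proof.
  rewrite <- (mangoldt_divisor_sum (as_norm g) g (Rle_refl _)).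
  assert (Hin : In g (norm_ball G (as_norm g))) by (apply In_ball; lra).
  apply in_split in Hin. destruct Hin as [l1 [l2 ->]].
  rewrite rsum_app. unfold rsum at 2; cbn [map fold_right].
  fold (rsum (fun d => if excluded_middle_informative (divs d g) then L d else 0) l2).
  assert (P : forall l, 0 <= rsum (fun d => if excluded_middle_informative (divs d g) then L d else 0) l).
  { intros l. apply rsum_ge0. intros d _. destruct (excluded_middle_informative _); [apply mangoldt_ge0 | lra]. }
  assert (A := P l1). assert (B := P l2).
  destruct (excluded_middle_informative (divs g g)) as [h|h]; [lra|].
  exfalso. apply h. exists as_one. apply mul1r.
Qed.

Lemma ball_multiples x d :
  Permutation (cfilter (divs d) (norm_ball G x)) (map (mul d) (norm_ball G (x / as_norm d))).
Proof.
  assert (Nd := norm_ge1 d).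
  assert (E : forall e, as_norm (mul d e) <= x <-> as_norm e <= x / as_norm d).
  { intros e. rewrite as_norm_mul. split; intros H.
    - apply Rmult_le_reg_l with (as_norm d); [lra|].
      replace (as_norm d * (x / as_norm d)) with x by (field; lra). auto.
    - apply Rmult_le_compat_l with (r := as_norm d) in H; [|lra].
      replace (as_norm d * (x / as_norm d)) with x in H by (field; lra). auto. }
  apply NoDup_Permutation.
  - apply NoDup_cfilter, NoDup_ball.
  - apply FinFun.Injective_map_NoDup; [|apply NoDup_ball].
    intros a b. apply mul_cancel.
  - intros g. rewrite In_cfilter, In_ball, in_map_iff. split.
    + intros [A [e <-]]. exists e. split; auto. apply In_ball, E, A.
    + intros [e [<- A]]. apply In_ball, E in A. split; auto. exists e; auto.
Qed.

(** The truncated form of [- zeta' = V zeta], where [V] is the von Mangoldt series: expand [ln |g|]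
    over the divisors [d], exchange the sums and write [g = d e], which leaves [|e| <= x / |d|]. *)
Lemma mangoldt_convolution (f : G -> C) x : (forall a b, f (mul a b) = (f a * f b)%C) ->
  csum (fun g => RtoC (ln (as_norm g)) * f g)%C (norm_ball G x) =
  csum (fun d => RtoC (L d) * f d * csum f (norm_ball G (x / as_norm d)))%C (norm_ball G x).
Proof.
  intros Hf.
  transitivity (csum (fun g => csum (fun d =>
    if excluded_middle_informative (divs d g) then RtoC (L d) * f g else RtoC 0)%C (norm_ball G x)) (norm_ball G x)).
  - apply csum_ext. intros g Hg. apply In_ball in Hg.
    rewrite <- (mangoldt_divisor_sum x g Hg), <- csum_RtoC, Cmult_comm, <- csum_scal.
    apply csum_ext. intros d _. destruct (excluded_middle_informative _); ring.
  - rewrite csum_swap. apply csum_ext. intros d _.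
    rewrite <- (csum_cfilter (divs d) (fun g => RtoC (L d) * f g)%C).
    rewrite (csum_perm _ _ _ (ball_multiples x d)), csum_map, <- csum_scal.
    apply csum_ext. intros e _. rewrite Hf. ring.
Qed.

(** The two balls are enumerated by independent choices, so the smaller list is contained in the
    larger one only up to permutation. *)
Lemma ball_split x y : x <= y ->
  Permutation (norm_ball G y) (norm_ball G x ++ cfilter (fun g => x < as_norm g) (norm_ball G y)).
Proof.
  intros Hxy. apply NoDup_Permutation.
  - apply NoDup_ball.
  - apply NoDup_app; [apply NoDup_ball | apply NoDup_cfilter, NoDup_ball |].
    intros g H1 H2. apply In_ball in H1. apply In_cfilter in H2. lra.
  - intros g. rewrite in_app_iff, In_cfilter, !In_ball.
    split; intros H.
    + destruct (Rle_dec (as_norm g) x); [left | right; split]; lra.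
    + lra.
Qed.

(** Expresses [psi] for all [x <= y] over one fixed list, hence as a finite combination of step
    functions of [x]. *)
Lemma psi_cutoff x y : x <= y ->
  beurling_psi G x = rsum (fun g => if Rle_dec (as_norm g) x then L g else 0) (norm_ball G y).
Proof.
  intros Hxy. rewrite (rsum_perm _ _ _ (ball_split x y Hxy)), rsum_app.
  change (beurling_psi G x) with (rsum L (norm_ball G x)).
  assert (E1 : rsum (fun g => if Rle_dec (as_norm g) x then L g else 0) (norm_ball G x)
    = rsum L (norm_ball G x)).
  { apply rsum_ext. intros g Hg. apply In_ball in Hg.
    destruct (Rle_dec _ _); auto. contradiction. }
  assert (E2 : rsum (fun g => if Rle_dec (as_norm g) x then L g else 0)
    (cfilter (fun g => x < as_norm g) (norm_ball G y)) = 0 * rsum L (norm_ball G y)).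
  { rewrite (rsum_ext _ (fun _ => 0 * 0)).
    - rewrite rsum_scal. ring.
    - intros g Hg. apply In_cfilter in Hg. destruct (Rle_dec _ _); lra. }
  rewrite E1, E2. ring.
Qed.

End Arith.

(** * Dirichlet series *)

Section Dirichlet.
Context (G : arith_semigroup).
Implicit Types (g d e : G) (w : G -> R).

Notation L := (von_mangoldt (G := G)).
Notation ball := (norm_ball G).
Notation lnn g := (ln (as_norm g)).

(** This is [|g|^(-s)], written like the Laplace kernel at [u = ln |g|]. *)
Definition es (s : C) (g : G) : C := cexp (RtoC (lnn g) * - s).

Lemma zeta_partial_es s x : zeta_partial G s x = csum (es s) (ball x).
Proof.
  unfold zeta_partial. apply (csum_ext (fun g : G => cpow (as_norm g) (- s)%C)). intros g _.
  unfold cpow, es, cexp. rewrite Re_scal_R, Im_scal_R.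
  f_equal; f_equal; f_equal; ring.
Qed.

Lemma es_mul s a b : es s (as_mul a b) = (es s a * es s b)%C.
Proof.
  unfold es. rewrite <- cexp_plus, ln_norm_mul, RtoC_plus. f_equal. ring.
Qed.

Lemma Cmod_es s g : Cmod (es s g) = exp (- Re s * lnn g).
Proof. unfold es. rewrite Cmod_cexp, Re_scal_R. f_equal. destruct s; simpl; ring. Qed.

Lemma rsum_ball_mono w x y : (forall g, 0 <= w g) -> x <= y -> rsum w (ball x) <= rsum w (ball y).
Proof.
  intros Hw Hxy. rewrite (rsum_perm _ _ _ (ball_split G x y Hxy)), rsum_app.
  assert (0 <= rsum w (cfilter (fun g => x < as_norm g) (ball y))) by (apply rsum_ge0; auto).
  lra.
Qed.

(** Meant for nonnegative weights, for which bounded sums over balls amount to absolute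
    convergence. *)
Definition summable w : Prop := exists B, forall x, rsum w (ball x) <= B.

Lemma summable_le w w' K : 0 <= K -> (forall g, w g <= K * w' g) -> summable w' -> summable w.
Proof.
  intros HK H [B HB]. exists (K * B). intros x.
  eapply Rle_trans; [apply rsum_le; intros; apply H|]. rewrite rsum_scal.
  apply Rmult_le_compat_l; auto.
Qed.

Lemma summable_sup w : summable w ->
  exists S, (forall x, rsum w (ball x) <= S) /\
    forall eps, 0 < eps -> exists T, S - rsum w (ball T) < eps.
Proof.
  intros [B HB].
  destruct (completeness (fun y => exists x, y = rsum w (ball x))) as [S [H1 H2]].
  - exists B. intros y [x ->]. auto.
  - exists (rsum w (ball 0)), 0; auto.
  - exists S. split.
    + intros x. apply H1. exists x; auto.
    + intros eps He. apply NNPP. intros Hn.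
      assert (S <= S - eps); [|lra]. apply H2. intros y [x ->].
      apply Rnot_lt_le. intros Hlt. apply Hn. exists x. lra.
Qed.

Lemma summable_tail w : (forall g, 0 <= w g) -> summable w -> forall eps, 0 < eps ->
  exists X, 1 <= X /\ forall y, X <= y -> rsum w (cfilter (fun g => X < as_norm g) (ball y)) < eps.
Proof.
  intros Hw Hs eps He. destruct (summable_sup w Hs) as [S [H1 H2]].
  destruct (H2 eps He) as [T HT]. exists (Rmax 1 T). split; [apply Rmax_l|].
  intros y Hy. specialize (H1 y).
  rewrite (rsum_perm _ _ _ (ball_split G _ y Hy)), rsum_app in H1.
  assert (M := rsum_ball_mono w T (Rmax 1 T) Hw (Rmax_r _ _)). lra.
Qed.

Lemma summable_clim (F : G -> C) w : (forall g, Cmod (F g) <= w g) -> summable w ->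
  exists l, clim (fun x => csum F (ball x)) l.
Proof.
  intros HF Hs.
  assert (Hw : forall g, 0 <= w g) by (intros g; eapply Rle_trans; [apply Cmod_ge_0 | apply HF]).
  destruct (summable_sup w Hs) as [S [H1 H2]].
  destruct (clim_cauchy (fun x => csum F (ball x)) (fun x => S - rsum w (ball x)) 0) as [l [Hl _]].
  - intros p q Hpq. specialize (H1 q).
    rewrite (csum_perm _ _ _ (ball_split G p q (proj2 Hpq))), csum_app.
    rewrite (rsum_perm _ _ _ (ball_split G p q (proj2 Hpq))), rsum_app in H1.
    match goal with |- Cmod (?X + ?Y - ?X) <= _ => replace (X + Y - X)%C with Y by ring end.
    eapply Rle_trans; [apply (Cmod_csum_le _ w); intros; apply HF|]. lra.
  - intros eps He. destruct (H2 eps He) as [T HT]. exists (Rmax 0 T). split; [apply Rmax_l|].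
    assert (M := rsum_ball_mono w T (Rmax 0 T) Hw (Rmax_r _ _)). lra.
  - exists l; auto.
Qed.

(* The tail of the hyperbola [|d||e| > x] is dominated by [|d| > D] together
   with [|e| > x / D]. *)
Lemma dirichlet_product (F H : G -> C) (w w' : G -> R) V Z :
  (forall g, Cmod (F g) <= w g) -> (forall g, Cmod (H g) <= w' g) -> summable w -> summable w' ->
  clim (fun x => csum F (ball x)) V -> clim (fun x => csum H (ball x)) Z ->
  clim (fun x => csum (fun d => F d * csum H (ball (x / as_norm d)))%C (ball x)) (V * Z)%C.
Proof.
  intros HF HH Hs Hs' HV HZ.
  assert (Hw : forall g, 0 <= w g) by (intros g; eapply Rle_trans; [apply Cmod_ge_0 | apply HF]).
  destruct Hs as [B HB]. assert (Hs : summable w) by (exists B; auto).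
  destruct Hs' as [B' HB'].
  assert (HB0 : 0 <= B) by (eapply Rle_trans; [|apply (HB 0)]; apply rsum_ge0; auto).
  assert (Hy : forall y, Cmod (csum H (ball y)) <= B').
  { intros y. eapply Rle_trans; [apply (Cmod_csum_le _ w'); intros; apply HH | apply HB']. }
  assert (HZB : Cmod Z <= B') by (apply clim_bound with (fun x => csum H (ball x)) 0; auto).
  assert (HB0' : 0 <= B') by (eapply Rle_trans; [apply Cmod_ge_0 | exact HZB]).
  assert (K : clim (fun x => csum (fun d => F d * (csum H (ball (x / as_norm d)) - Z))%C (ball x)) (RtoC 0)).
  (* The part [|d| <= D] costs at most [e1 * B], the part [|d| > D] at most [2 * B' * e1]. *)
  { intros eps He. set (e1 := eps / (2 * (B + 2 * B' + 1))).
    assert (He1 : 0 < e1) by (apply Rdiv_lt_0_compat; lra).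
    destruct (summable_tail w Hw Hs e1 He1) as [D [HD1 HD2]].
    destruct (HZ e1 He1) as [Y HY].
    exists (Rmax D (D * Rmax 0 Y)). intros x Hx.
    assert (Hx1 : D <= x) by (eapply Rle_trans; [apply Rmax_l | exact Hx]).
    assert (Hx2 : D * Rmax 0 Y <= x) by (eapply Rle_trans; [apply Rmax_r | exact Hx]).
    replace (csum (fun d => F d * (csum H (ball (x / as_norm d)) - Z))%C (ball x) - RtoC 0)%C
      with (csum (fun d => F d * (csum H (ball (x / as_norm d)) - Z))%C (ball x)) by ring.
    rewrite (csum_perm _ _ _ (ball_split G D x Hx1)), csum_app.
    eapply Rle_lt_trans; [apply Cmod_triangle|].
    assert (A1 : Cmod (csum (fun d => F d * (csum H (ball (x / as_norm d)) - Z))%C (ball D)) <= e1 * B).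
    { apply Rle_trans with (rsum (fun d => e1 * w d) (ball D)).
      - apply Cmod_csum_le. intros d Hd. apply In_ball in Hd. assert (N := norm_ge1 G d).
        rewrite Cmod_mult, Rmult_comm. apply Rmult_le_compat; auto; try apply Cmod_ge_0.
        apply Rlt_le, HY. apply Rle_trans with (Rmax 0 Y); [apply Rmax_r|].
        apply Rmult_le_reg_r with (as_norm d); [lra|].
        replace (x / as_norm d * as_norm d) with x by (field; lra).
        assert (0 <= Rmax 0 Y) by apply Rmax_l. nra.
      - rewrite rsum_scal. apply Rmult_le_compat_l; [lra | apply HB]. }
    assert (A2 : Cmod (csum (fun d => F d * (csum H (ball (x / as_norm d)) - Z))%C
       (cfilter (fun g => D < as_norm g) (ball x))) <= 2 * B' * e1).
    { apply Rle_trans with (rsum (fun d => 2 * B' * w d) (cfilter (fun g => D < as_norm g) (ball x))).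
      - apply Cmod_csum_le. intros d _. rewrite Cmod_mult, Rmult_comm.
        apply Rmult_le_compat; auto; try apply Cmod_ge_0.
        eapply Rle_trans; [apply Cmod_triangle_minus|]. specialize (Hy (x / as_norm d)). lra.
      - rewrite rsum_scal. apply Rmult_le_compat_l; [lra|]. apply Rlt_le, HD2; auto. }
    apply Rle_lt_trans with (e1 * (B + 2 * B' + 1)); [nra|].
    replace (e1 * (B + 2 * B' + 1)) with (eps / 2) by (unfold e1; field; lra). lra. }
  replace (V * Z)%C with (RtoC 0 + Z * V)%C by ring.
  apply clim_ext with (fun x => csum (fun d => F d * (csum H (ball (x / as_norm d)) - Z))%C (ball x)
     + Z * csum F (ball x))%C 0.
  - intros x _. rewrite <- csum_scal, <- csum_plus. apply csum_ext. intros; ring.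
  - apply clim_plus; auto. apply clim_scal; auto.
Qed.

Context (zeta : C -> C)
  (Hzeta : forall s, 1 < Re s -> clim (zeta_partial G s) (zeta s)).

(** At a real point the terms are nonnegative and their sums over balls increase, so convergence
    there already bounds all of them; this makes the series absolutely convergent throughout
    [Re s > 1]. *)
Lemma summable_exp (sg : R) : 1 < sg -> summable (fun g => exp (- sg * lnn g)).
Proof.
  intros Hs.
  destruct (Hzeta (RtoC sg) Hs 1 Rlt_0_1) as [X HX].
  exists (Cmod (zeta (RtoC sg)) + 1). intros x.
  assert (Hw : forall g : G, 0 <= exp (- sg * lnn g)) by (intros; apply Rlt_le, exp_pos).
  eapply Rle_trans; [apply (rsum_ball_mono _ x (Rmax x X) Hw (Rmax_l _ _))|].
  specialize (HX (Rmax x X) (Rmax_r _ _)). rewrite zeta_partial_es in HX.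
  rewrite (csum_ext _ (fun g => RtoC (exp (- sg * lnn g)))) in HX.
  2: { intros g _. unfold es, cexp. rewrite Re_scal_R, Im_scal_R. simpl.
       rewrite Ropp_0, Rmult_0_r, cos_0, sin_0. unfold RtoC. f_equal; [rewrite Rmult_1_r; f_equal; ring | ring]. }
  rewrite csum_RtoC in HX.
  assert (T := Cmod_triangle (RtoC (rsum (fun g : G => exp (- sg * lnn g)) (ball (Rmax x X))) - zeta (RtoC sg)) (zeta (RtoC sg))).
  match type of T with Cmod (?A - ?B + ?B) <= _ => replace (A - B + B)%C with A in T by ring end.
  rewrite Cmod_R in T. eapply Rle_trans; [apply Rle_abs|]. lra.
Qed.

(** Half of the distance from [sg] to 1 is spent on absorbing the squared logarithm. *)
Lemma summable_sqr_exp sg : 1 < sg -> summable (fun g => (1 + lnn g * lnn g) * exp (- sg * lnn g)).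
Proof.
  intros Hs. set (c := (sg - 1) / 2). assert (Hc : 0 < c) by (unfold c; lra).
  apply summable_le with (fun g => exp (- (sg - c) * lnn g)) (1 + 4 / (c * c)).
  - assert (0 < 4 / (c * c)) by (apply Rdiv_lt_0_compat; nra). lra.
  - intros g. replace (- (sg - c) * lnn g) with (c * lnn g + - sg * lnn g) by ring.
    rewrite exp_plus, <- Rmult_assoc. apply Rmult_le_compat_r; [apply Rlt_le, exp_pos|].
    assert (P := ln_norm_ge0 G g).
    assert (Q := exp_ge_sqr (c * lnn g) ltac:(nra)).
    assert (Q1 : 1 <= exp (c * lnn g)) by (rewrite <- exp_0; apply exp_le; nra).
    rewrite Rmult_plus_distr_r, Rmult_1_l. apply Rplus_le_compat; auto.
    apply Rmult_le_reg_r with (c * c / 4); [nra|].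
    replace (4 / (c * c) * exp (c * lnn g) * (c * c / 4)) with (exp (c * lnn g)) by (field; lra).
    lra.
  - apply summable_exp. unfold c; lra.
Qed.

Lemma summable_ln_exp sg : 1 < sg -> summable (fun g => lnn g * exp (- sg * lnn g)).
Proof.
  intros Hs. apply summable_le with (fun g => (1 + lnn g * lnn g) * exp (- sg * lnn g)) 1; [lra| |].
  - intros g. rewrite Rmult_1_l. apply Rmult_le_compat_r; [apply Rlt_le, exp_pos | nra].
  - apply summable_sqr_exp; auto.
Qed.

(** Rankin's trick: for [|g| <= e^u] the factor [(e^u / |g|)^sg] is at least 1, and inserting it
    compares the finite sum with a convergent series. *)
Lemma psi_bound sg : 1 < sg -> exists B, forall u, 0 <= u -> 0 <= beurling_psi G (exp u) <= B * exp (sg * u).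
Proof.
  intros Hs. destruct (summable_ln_exp sg Hs) as [B HB]. exists B. intros u Hu.
  change (beurling_psi G (exp u)) with (rsum L (ball (exp u))). split.
  - apply rsum_ge0. intros; apply mangoldt_ge0.
  - apply Rle_trans with (rsum (fun g => exp (sg * u) * (lnn g * exp (- sg * lnn g))) (ball (exp u))).
    + apply rsum_le. intros g Hg. apply In_ball in Hg.
      assert (Hl : lnn g <= u).
      { rewrite <- (ln_exp u). apply ln_le; auto. assert (N := norm_ge1 G g). lra. }
      eapply Rle_trans; [apply mangoldt_le_ln|].
      replace (exp (sg * u) * (lnn g * exp (- sg * lnn g))) with (lnn g * exp (sg * u + - sg * lnn g))
        by (rewrite exp_plus; ring).
      assert (P := ln_norm_ge0 G g).
      assert (1 <= exp (sg * u + - sg * lnn g)) by (rewrite <- exp_0; apply exp_le; nra).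
      nra.
    + rewrite rsum_scal, Rmult_comm. apply Rmult_le_compat_r; [apply Rlt_le, exp_pos | apply HB].
Qed.

(** [V] is the series of [- zeta'/zeta]; the product form avoids any division by [zeta]. *)
Lemma mangoldt_series s : 1 < Re s ->
  exists V, clim (fun x => csum (fun g => RtoC (L g) * es s g)%C (ball x)) V /\
    cderiv zeta s (- (V * zeta s))%C.
Proof.
  intros Hs.
  assert (HF : forall g, Cmod (RtoC (L g) * es s g) <= lnn g * exp (- Re s * lnn g)).
  { intros g. rewrite Cmod_mult, Cmod_R, Cmod_es, Rabs_right by (apply Rle_ge, mangoldt_ge0).
    apply Rmult_le_compat_r; [apply Rlt_le, exp_pos | apply mangoldt_le_ln]. }
  destruct (summable_clim _ _ HF (summable_ln_exp _ Hs)) as [V HV].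
  exists V. split; auto.
  (* The series with weights [ln |g|], which is minus the termwise derivative, is a Dirichlet
     product by the convolution identity. *)
  assert (HN : clim (fun x => csum (fun g => RtoC (lnn g) * es s g)%C (ball x)) (V * zeta s)%C).
  { apply clim_ext with (fun x => csum (fun d => RtoC (L d) * es s d * csum (es s) (ball (x / as_norm d)))%C (ball x)) 0.
    - intros x _. symmetry. apply mangoldt_convolution. apply es_mul.
    - eapply dirichlet_product.
      + exact HF.
      + intros g. rewrite Cmod_es. apply Rle_refl.
      + apply summable_ln_exp; auto.
      + apply summable_exp; auto.
      + exact HV.
      + apply clim_ext with (zeta_partial G s) 0; [intros; apply zeta_partial_es | apply Hzeta; auto]. }
  (* With [Cmod (z - s) < c] the Taylor remainder grows at most like [|g|^c], so the majorant still
     converges at [Re s - c > 1]. *)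
  set (c := (Re s - 1) / 2). assert (Hc : 0 < c) by (unfold c; lra).
  destruct (summable_sqr_exp (Re s - c)) as [K HK]; [unfold c; lra|].
  apply cderiv_of_limit with (zeta_partial G)
    (fun x => (- (RtoC 1)) * csum (fun g => RtoC (lnn g) * es s g) (ball x))%C c K 0; auto.
  - intros z Hz. apply Hzeta. assert (A := Re_le_Cmod (z - s)).
    replace (Re (z - s)) with (Re z - Re s) in A by (destruct z, s; reflexivity).
    apply Rcomplements.Rabs_le_between in A. unfold c in *; lra.
  - replace (- (V * zeta s))%C with (- (RtoC 1) * (V * zeta s))%C by ring. apply clim_scal; auto.
  - intros z x Hz _. rewrite !zeta_partial_es. set (w := (z - s)%C) in *. assert (Hw := Cmod_ge_0 w).
    replace (csum (es z) (ball x) - csum (es s) (ball x)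
        - - (RtoC 1) * csum (fun g => RtoC (lnn g) * es s g)%C (ball x) * w)%C
      with (csum (fun g => es s g * (cexp (RtoC (lnn g) * - w) - 1 - RtoC (lnn g) * - w))%C (ball x)).
    2: { replace (csum (es z) (ball x) - csum (es s) (ball x)
        - - (RtoC 1) * csum (fun g => RtoC (lnn g) * es s g)%C (ball x) * w)%C
         with (csum (es z) (ball x) - csum (es s) (ball x)
        + w * csum (fun g => RtoC (lnn g) * es s g)%C (ball x))%C by ring.
      rewrite <- csum_scal, <- csum_minus, <- csum_plus. apply csum_ext. intros g _.
      replace (es z g) with (es s g * cexp (RtoC (lnn g) * - w))%C.
      - ring.
      - unfold es. rewrite <- cexp_plus. f_equal. unfold w. ring. }
    eapply Rle_trans.
    + apply (Cmod_csum_le _ (fun g => (Cmod w * Cmod w) * ((1 + lnn g * lnn g) * exp (- (Re s - c) * lnn g)))).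
      intros g _. rewrite Cmod_mult, Cmod_es. assert (P := ln_norm_ge0 G g).
      assert (T := cexp_taylor_bound (RtoC (lnn g) * - w)).
      rewrite Cmod_mult, Cmod_R, Cmod_opp, Rabs_right in T by lra.
      assert (T2 : exp (lnn g * Cmod w) <= exp (c * lnn g)) by (apply exp_le; nra).
      replace (- (Re s - c) * lnn g) with (- Re s * lnn g + c * lnn g) by ring.
      rewrite exp_plus.
      assert (P1 := exp_pos (- Re s * lnn g)). assert (P2 := exp_pos (c * lnn g)).
      apply Rle_trans with (exp (- Re s * lnn g) * (lnn g * Cmod w * (lnn g * Cmod w) * exp (c * lnn g))).
      * apply Rmult_le_compat_l; [lra|]. eapply Rle_trans; [exact T|].
        apply Rmult_le_compat_l; [nra | auto].
      * replace (Cmod w * Cmod w * ((1 + lnn g * lnn g) * (exp (- Re s * lnn g) * exp (c * lnn g))))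
          with (exp (- Re s * lnn g) * ((Cmod w * Cmod w * (1 + lnn g * lnn g)) * exp (c * lnn g))) by ring.
        apply Rmult_le_compat_l; [lra|]. apply Rmult_le_compat_r; nra.
    + rewrite rsum_scal, Rmult_comm. apply Rmult_le_compat_r; [nra | apply HK].
Qed.

(** * Abel summation and the transform of [Delta] *)

Definition ind (c u : R) : R := if Rle_dec c u then 1 else 0.

Lemma ex_RInt_ind c phi p q : (forall t, continuous phi t) -> ex_RInt (fun u => ind c u * phi u) p q.
Proof.
  intros Hphi.
  assert (E : forall q, ex_RInt (fun u => ind c u * phi u) c q).
  { intros q'. destruct (Rle_dec c q') as [H|H].
    - apply ex_RInt_ext with phi.
      + intros t Ht. rewrite Rmin_left in Ht by lra. unfold ind.
        destruct (Rle_dec c t); [|lra]. symmetry. apply Rmult_1_l.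
      + apply (ex_RInt_continuous (V := R_CompleteNormedModule)). auto.
    - apply ex_RInt_ext with (fun _ => 0).
      + intros t Ht. rewrite Rmax_left in Ht by lra. unfold ind.
        destruct (Rle_dec c t); [lra|]. symmetry. apply Rmult_0_l.
      + apply ex_RInt_const. }
  apply (ex_RInt_Chasles (V := R_NormedModule)) with c; [apply ex_RInt_swap|]; apply E.
Qed.

(** On [u <= T] the function is a finite combination of steps with jumps at [ln |g|]; local
    integrability and Abel summation thereby reduce to a single step. *)
Lemma psi_exp_ind T u : u <= T ->
  beurling_psi G (exp u) = rsum (fun g => L g * ind (lnn g) u) (ball (exp T)).
Proof.
  intros Hu. rewrite (psi_cutoff G (exp u) (exp T)) by (apply exp_le; auto).
  apply rsum_ext. intros g _. unfold ind. assert (N := norm_ge1 G g).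
  destruct (Rle_dec (as_norm g) (exp u)) as [H|H], (Rle_dec (lnn g) u) as [H'|H']; try ring; exfalso.
  - apply H'. rewrite <- (ln_exp u). apply ln_le; lra.
  - apply H. rewrite <- (exp_ln (as_norm g)) by lra. apply exp_le; auto.
Qed.

Lemma loc_int_psi : loc_int (fun u => beurling_psi G (exp u)).
Proof.
  intros phi Hphi p q Hp Hq. set (T := Rmax p q).
  apply ex_RInt_ext with (fun u => rsum (fun g => L g * ind (lnn g) u) (ball (exp T)) * phi u).
  - intros t Ht. rewrite <- (psi_exp_ind T t); auto. unfold T; lra.
  - generalize (ball (exp T)). intros l. induction l as [|g l IH].
    + apply ex_RInt_ext with (fun _ => 0); [|apply ex_RInt_const].
      intros t _. symmetry. apply Rmult_0_l.
    + apply ex_RInt_ext with (fun u => plus (scal (L g) (ind (lnn g) u * phi u))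
         (rsum (fun g => L g * ind (lnn g) u) l * phi u)).
      * intros t _. unfold rsum; simpl. unfold plus, scal; simpl. unfold mult; simpl. ring.
      * apply (ex_RInt_plus (V := R_NormedModule)); auto.
        apply (ex_RInt_scal (V := R_NormedModule)). apply ex_RInt_ind; auto.
Qed.

Lemma loc_int_Delta : loc_int (fun u => beurling_Delta G (exp u)).
Proof.
  intros phi Hphi p q Hp Hq.
  apply ex_RInt_ext with (fun u => minus (beurling_psi G (exp u) * phi u) (exp u * phi u)).
  - intros t _. unfold beurling_Delta, minus, plus, opp; simpl. ring.
  - apply (ex_RInt_minus (V := R_NormedModule)); [apply loc_int_psi; auto|].
    apply (ex_RInt_continuous (V := R_CompleteNormedModule)). intros t _.
    apply (continuous_mult (K := R_AbsRing)); auto.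
    apply (ex_derive_continuous (V := R_NormedModule)). auto_derive. auto.
Qed.

Lemma is_Cint_ind_exp c T s : 0 <= c <= T ->
  is_Cint (fun u => RtoC (ind c u) * (s * cexp (RtoC u * - s)))%C 0 T
    (cexp (RtoC c * - s) - cexp (RtoC T * - s))%C.
Proof.
  intros Hc.
  replace (cexp (RtoC c * - s) - cexp (RtoC T * - s))%C with
    (RtoC (c - 0) * RtoC 0 + (- (RtoC 1) * cexp (RtoC T * - s) - - (RtoC 1) * cexp (RtoC c * - s)))%C by ring.
  apply is_Cint_Chasles with c.
  - apply is_Cint_ext with (fun _ => RtoC 0); [|apply is_Cint_const].
    intros t Ht. rewrite Rmax_right in Ht by lra. unfold ind. destruct (Rle_dec c t); [lra|]. ring.
  - apply is_Cint_ext with (fun u => - (RtoC 1) * (- s * cexp (RtoC u * - s)))%C.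
    + intros t Ht. rewrite Rmin_left in Ht by lra. unfold ind. destruct (Rle_dec c t); [|lra]. ring.
    + replace (- (RtoC 1) * cexp (RtoC T * - s) - - (RtoC 1) * cexp (RtoC c * - s))%C with
        (- (RtoC 1) * (cexp (RtoC T * - s) - cexp (RtoC c * - s)))%C by ring.
      apply is_Cint_scal.
      apply (is_Cint_derive (fun u => cexp (RtoC u * - s))).
      * intros; apply cexp_ray_deriv.
      * intros; apply ccont_scal, ccont_cexp_ray.
Qed.

(** Abel summation one jump at a time: [s] times the integral of [e^(-su)] over [[ln |g|, T]] is
    [|g|^(-s) - e^(-sT)], and the second terms add up to the boundary term. *)
Lemma abel_psi s T : 0 <= T ->
  (s * lap (fun u => beurling_psi G (exp u)) s T)%C =
  (csum (fun g => RtoC (L g) * es s g)%C (ball (exp T))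
   - RtoC (beurling_psi G (exp T)) * cexp (RtoC T * - s))%C.
Proof.
  intros HT.
  assert (E1 : is_Cint (fun u => RtoC (beurling_psi G (exp u)) * (s * cexp (RtoC u * - s)))%C 0 T
    (s * lap (fun u => beurling_psi G (exp u)) s T)%C).
  { apply is_Cint_ext with (fun u => s * (RtoC (beurling_psi G (exp u)) * cexp (RtoC u * - s)))%C.
    - intros; ring.
    - apply is_Cint_scal, Cint_correct, lap_ex; [apply loc_int_psi | lra | lra]. }
  assert (E2 : is_Cint (fun u => RtoC (beurling_psi G (exp u)) * (s * cexp (RtoC u * - s)))%C 0 T
    (csum (fun g => RtoC (L g) * (es s g - cexp (RtoC T * - s)))%C (ball (exp T)))).
  { apply is_Cint_ext with (fun u => RtoC (rsum (fun g => L g * ind (lnn g) u)%R (ball (exp T))) * (s * cexp (RtoC u * - s)))%C.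
    - intros u Hu. rewrite Rmin_left, Rmax_right in Hu by lra. rewrite (psi_exp_ind T u) by lra. auto.
    - assert (Hall : forall g, In g (ball (exp T)) -> 0 <= lnn g <= T).
      { intros g Hg. apply In_ball in Hg. split; [apply ln_norm_ge0|].
        rewrite <- (ln_exp T). apply ln_le; auto. assert (N := norm_ge1 G g). lra. }
      revert Hall. generalize (ball (exp T)). intros l. induction l as [|g l IH]; intros Hall.
      + apply is_Cint_ext with (fun _ => RtoC 0).
        * intros u _. unfold rsum; simpl. ring.
        * assert (E0 := is_Cint_const (RtoC 0) 0 T). rewrite Cmult_0_r in E0. exact E0.
      + unfold csum; simpl.
        apply is_Cint_ext with (fun u => RtoC (L g) * (RtoC (ind (lnn g) u) * (s * cexp (RtoC u * - s)))
          + RtoC (rsum (fun g => L g * ind (lnn g) u)%R l) * (s * cexp (RtoC u * - s)))%C.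
        * intros u _. unfold rsum; simpl. rewrite RtoC_plus, RtoC_mult. ring.
        * apply is_Cint_plus; [|apply IH; intros; apply Hall; simpl; auto].
          apply is_Cint_scal. apply is_Cint_ind_exp. apply Hall; simpl; auto. }
  rewrite <- (is_Cint_unique _ _ _ _ E1), (is_Cint_unique _ _ _ _ E2).
  change (beurling_psi G (exp T)) with (rsum L (ball (exp T))).
  rewrite <- csum_RtoC, (Cmult_comm _ (cexp _)), <- csum_scal, <- csum_minus.
  apply csum_ext. intros; ring.
Qed.

Lemma lap_exp s T : ((s - 1) * lap exp s T)%C = (1 - cexp (RtoC T * (1 - s)))%C.
Proof.
  unfold lap.
  assert (E : is_Cint (fun u => (1 - s) * cexp (RtoC u * (1 - s)))%C 0 T
     (cexp (RtoC T * (1 - s)) - cexp (RtoC 0 * (1 - s)))%C).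
  { apply (is_Cint_derive (fun u => cexp (RtoC u * (1 - s)))).
    - intros; apply cexp_ray_deriv.
    - intros; apply ccont_scal, ccont_cexp_ray. }
  assert (X : ex_Cint (fun u => RtoC (exp u) * cexp (RtoC u * - s))%C 0 T).
  { apply ex_Cint_cont. intros t _.
    eapply curve_deriv_ccont.
    apply curve_deriv_ext with (fun u => cexp (RtoC u * (1 - s))); [|apply cexp_ray_deriv].
    intros u. replace (RtoC u * (1 - s))%C with (RtoC u + RtoC u * - s)%C by ring.
    rewrite cexp_plus. f_equal. unfold cexp, RtoC; simpl. rewrite cos_0, sin_0. f_equal; ring. }
  assert (E' : is_Cint (fun u => (1 - s) * cexp (RtoC u * (1 - s)))%C 0 T
     ((1 - s) * Cint (fun u => RtoC (exp u) * cexp (RtoC u * - s))%C 0 T)%C).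
  { apply is_Cint_ext with (fun u => (1 - s) * (RtoC (exp u) * cexp (RtoC u * - s)))%C.
    - intros u _. f_equal.
      replace (RtoC u * (1 - s))%C with (RtoC u + RtoC u * - s)%C by ring.
      rewrite cexp_plus. f_equal. unfold cexp, RtoC; simpl. rewrite cos_0, sin_0. f_equal; ring.
    - apply is_Cint_scal, Cint_correct; auto. }
  apply is_Cint_unique in E. apply is_Cint_unique in E'.
  rewrite E in E'. replace (RtoC 0 * (1 - s))%C with (RtoC 0) in E' by ring.
  rewrite cexp_0 in E'. apply Ceq_minus.
  match goal with |- ?X = _ => replace X with (- (RtoC 1) * ((1 - s) * Cint (fun u => RtoC (exp u) * cexp (RtoC u * - s))%C 0 T
     - (cexp (RtoC T * (1 - s)) - RtoC 1)))%C by ring end.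
  rewrite E'. ring.
Qed.

Lemma clim_exp_decay (v : R -> C) K c : 0 < c -> (forall T, 0 <= T -> Cmod (v T) <= K * exp (- c * T)) ->
  clim v (RtoC 0).
Proof.
  intros Hc H eps He. destruct (exp_decay_small K c eps Hc He) as [T [HT1 HT2]].
  assert (HK : 0 <= K).
  { specialize (H 0 (Rle_refl 0)). rewrite Rmult_0_r, exp_0 in H.
    assert (P := Cmod_ge_0 (v 0)). lra. }
  exists T. intros x Hx. replace (v x - RtoC 0)%C with (v x) by ring.
  eapply Rle_lt_trans; [apply H; lra|]. eapply Rle_lt_trans; [|exact HT2].
  apply Rmult_le_compat_l; auto. apply exp_le. nra.
Qed.

(** The limit [T -> oo] of Abel summation, [s D = V - s/(s-1)], multiplied by [s - 1]; the last term
    is the transform of the main term [e^u]. *)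
Lemma lap_Delta_series s V D : 1 < Re s ->
  clim (fun x => csum (fun g => RtoC (L g) * es s g)%C (ball x)) V ->
  clim (lap (fun u => beurling_Delta G (exp u)) s) D ->
  ((s - 1) * s * D)%C = ((s - 1) * V - s)%C.
Proof.
  intros Hs HV HD.
  set (c := (Re s - 1) / 2). assert (Hc : 0 < c) by (unfold c; lra).
  (* An exponent strictly between 1 and [Re s] makes the boundary term [psi(e^T) e^(-sT)] tend to
     0. *)
  destruct (psi_bound (Re s - c)) as [B HB]; [unfold c; lra|].
  assert (V' : clim (fun T => csum (fun g => RtoC (L g) * es s g)%C (ball (exp T))) V).
  { intros eps He. destruct (HV eps He) as [X HX]. exists (ln (Rmax 1 X)). intros T HT.
    apply HX. apply Rle_trans with (Rmax 1 X); [apply Rmax_r|].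
    rewrite <- (exp_ln (Rmax 1 X)).
    - apply exp_le; auto.
    - eapply Rlt_le_trans; [apply Rlt_0_1 | apply Rmax_l]. }
  assert (P0 : clim (fun T => RtoC (beurling_psi G (exp T)) * cexp (RtoC T * - s))%C (RtoC 0)).
  { apply clim_exp_decay with B c; auto. intros T HT.
    destruct (HB T HT) as [B1 B2].
    rewrite Cmod_mult, Cmod_R, Cmod_cexp, Re_scal_R, Rabs_right by lra.
    apply Rle_trans with (B * exp ((Re s - c) * T) * exp (T * Re (- s))).
    - apply Rmult_le_compat_r; [apply Rlt_le, exp_pos | auto].
    - right. rewrite Rmult_assoc, <- exp_plus. do 2 f_equal. destruct s; simpl; ring. }
  assert (P1 : clim (fun T => cexp (RtoC T * (1 - s))) (RtoC 0)).
  { apply clim_exp_decay with 1 (Re s - 1); [lra|]. intros T HT.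
    rewrite Cmod_cexp, Re_scal_R. right. rewrite Rmult_1_l. f_equal. destruct s; simpl; ring. }
  apply clim_unique with (fun T => (s - 1) * s * lap (fun u => beurling_Delta G (exp u)) s T)%C.
  { apply clim_scal; auto. }
  apply clim_ext with (fun T => (s - 1) * (csum (fun g => RtoC (L g) * es s g)%C (ball (exp T))
   - RtoC (beurling_psi G (exp T)) * cexp (RtoC T * - s)) - s * (1 - cexp (RtoC T * (1 - s))))%C 0.
  - intros T HT. rewrite <- abel_psi, <- lap_exp by auto.
    replace (lap (fun u => beurling_Delta G (exp u)) s T)
      with (lap (fun u => beurling_psi G (exp u)) s T - lap exp s T)%C; [ring|].
    symmetry. apply is_Cint_unique.
    apply is_Cint_ext with (fun u => RtoC (beurling_psi G (exp u)) * cexp (RtoC u * - s) - RtoC (exp u) * cexp (RtoC u * - s))%C.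
    + intros u _. unfold beurling_Delta. rewrite RtoC_minus. ring.
    + apply is_Cint_minus; apply Cint_correct, lap_ex; try lra; [apply loc_int_psi|].
      intros phi Hphi p q _ _. apply (ex_RInt_continuous (V := R_CompleteNormedModule)). intros t _.
      apply (continuous_mult (K := R_AbsRing)); auto.
      apply (ex_derive_continuous (V := R_NormedModule)). auto_derive. auto.
  - replace ((s - 1) * V - s)%C with ((s - 1) * (V - RtoC 0) - s * (1 - RtoC 0))%C by ring.
    apply clim_minus; apply clim_scal, clim_minus; auto. apply clim_const.
Qed.

End Dirichlet.

(** * Continuation of the logarithmic derivative *)

Lemma ex_derive_cderiv f s :
  ex_derive (K := C_AbsRing) (V := C_NormedModule) f s -> exists l, cderiv f s l.
Proof.
  intros [l [_ Hl]]. exists l. intros eps He.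
  destruct (Hl s (fun P H => H) (mkposreal eps He)) as [d Hd].
  exists d. split; [apply cond_pos|]. intros z Hz.
  assert (E := Hd z Hz). simpl in E.
  eapply Rle_trans; [|exact E]. right.
  change (Cmod (f z - f s - l * (z - s)) = Cmod ((f z - f s) - (z - s) * l)). f_equal. ring.
Qed.

Lemma holomorphic_holo theta f : holomorphic_right_of theta f -> holo theta f.
Proof. intros H s Hs. apply ex_derive_cderiv, H, Hs. Qed.

(** Neighbourhoods in the hypothesis are those of the larger coordinate, hence the halved radius. *)
Lemma filterlim_clim (v : R -> C) (l : C) :
  filterlim v (Rbar_locally p_infty) (locally l) -> clim v l.
Proof.
  intros H eps He. assert (He2 : 0 < eps / 2) by lra.
  destruct (proj1 (filterlim_locally _ _) H (mkposreal _ He2)) as [X HX].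
  exists (X + 1). intros x Hx. destruct (HX x ltac:(lra)) as [A B].
  change (Rabs (Re (v x) - Re l) < eps / 2) in A.
  change (Rabs (Im (v x) - Im l) < eps / 2) in B.
  eapply Rle_lt_trans; [apply Cmod_le_Re_Im|].
  replace (Re (v x - l)) with (Re (v x) - Re l) by (destruct (v x), l; reflexivity).
  replace (Im (v x - l)) with (Im (v x) - Im l) by (destruct (v x), l; reflexivity).
  lra.
Qed.

Lemma clim_Re_ge v l m X : clim v l -> (forall x, X <= x -> m <= Re (v x)) -> m <= Re l.
Proof.
  intros H Hm. apply Rnot_lt_le. intros Hlt.
  destruct (H (m - Re l)) as [Y HY]; [lra|].
  specialize (HY (Rmax X Y) (Rmax_r _ _)). specialize (Hm (Rmax X Y) (Rmax_l _ _)).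
  assert (A := Re_le_Cmod (v (Rmax X Y) - l)).
  replace (Re (v (Rmax X Y) - l)) with (Re (v (Rmax X Y)) - Re l) in A
    by (destruct (v (Rmax X Y)), l; reflexivity).
  assert (B := Rle_abs (Re (v (Rmax X Y)) - Re l)). lra.
Qed.

Section Continuation.
Context (G : arith_semigroup) (theta : R) (htheta : theta < 1) (zeta h : C -> C)
  (Hzeta : forall s, 1 < Re s -> clim (zeta_partial G s) (zeta s))
  (Hh : holo theta h) (Hh1 : h (RtoC 1) <> RtoC 0)
  (Hzh : forall s, theta < Re s -> s <> RtoC 1 -> zeta s = (h s / (s - RtoC 1))%C).

Notation a := (fun u : R => beurling_Delta G (exp u)).

Lemma neq_1 s : 1 < Re s -> (s - 1)%C <> RtoC 0.
Proof.
  intros Hs E. apply Ceq_minus in E. rewrite E in Hs. simpl in Hs. lra.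
Qed.

Lemma log_deriv s D : 1 < Re s -> clim (lap a s) D -> cderiv h s (- ((1 + s * D) * h s))%C.
Proof.
  intros Hs HD. destruct (mangoldt_series G zeta Hzeta s Hs) as [V [HV Hd]].
  assert (E := lap_Delta_series G zeta Hzeta s V D Hs HV HD).
  assert (N := neq_1 s Hs).
  assert (Hzs : forall z, 1 < Re z -> h z = (zeta z * (z - 1))%C).
  { intros z Hz. assert (Nz := neq_1 z Hz). rewrite Hzh.
    - field. auto.
    - lra.
    - intros E1. apply Nz. rewrite E1. ring. }
  apply cderiv_ext_loc with (fun z => zeta z * (z - 1))%C (Re s - 1); [lra| |].
  - intros z Hz. symmetry. apply Hzs. assert (A := Re_le_Cmod (z - s)).
    replace (Re (z - s)) with (Re z - Re s) in A by (destruct z, s; reflexivity).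
    apply Rcomplements.Rabs_le_between in A. lra.
  - replace (- ((1 + s * D) * h s))%C with (- (V * zeta s) * (s - 1) + zeta s * (RtoC 1 - RtoC 0))%C.
    + apply (cderiv_mult zeta (fun z => z - 1)%C); auto.
      apply (cderiv_minus (fun z => z) (fun _ => RtoC 1)); [apply cderiv_id | apply cderiv_const].
    + rewrite Hzs by auto.
      replace (- ((1 + s * D) * (zeta s * (s - 1))))%C
        with (- zeta s * ((s - 1) + (s - 1) * s * D))%C by ring.
      rewrite E. ring.
Qed.

(* The Laplace transform of [a] gives [(log h)' = -(1 + sD)] for [Re s > 1];
   exponentiating a primitive turns this into an identity between holomorphic
   functions, which then persists on the whole half-plane [Re s > b]. *)
Lemma continuation b M x0 c : theta <= b -> (forall u, 0 <= u -> Rabs (a u) <= M * exp (b * u)) ->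
  b < x0 -> 1 < x0 ->
  exists D F, (forall s, b < Re s -> clim (lap a s) (D s)) /\
    holo b D /\
    (forall x, F (x, c) = Cint (fun r => 1 + (r, c) * D (r, c))%C x0 x) /\
    (forall z, b < Re z -> (h z * cexp (F z))%C = h (x0, c)).
Proof.
  intros Hb HM H0 H1.
  assert (Ha := loc_int_Delta G).
  (* The limit is chosen point by point; 0 is a placeholder outside the half-plane of
     convergence. *)
  set (D := fun s => match excluded_middle_informative (b < Re s) with
    | left p => proj1_sig (constructive_indefinite_description _ (lap_limit a b M Ha HM s p))
    | right _ => RtoC 0 end).
  assert (HD : forall s, b < Re s -> clim (lap a s) (D s)).
  { intros s Hs. unfold D. destruct (excluded_middle_informative (b < Re s)) as [p|p]; [|contradiction].
    apply (proj2_sig (constructive_indefinite_description _ (lap_limit a b M Ha HM s p))). }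
  clearbody D.
  assert (HDh := lap_holo a b M D Ha HM HD).
  set (q := fun s => (1 + s * D s)%C).
  assert (Hq : holo b q).
  { apply holo_plus; [apply holo_const|]. apply holo_mult; [apply holo_id | auto]. }
  destruct (holo_primitive b q x0 c Hq H0) as [F [HF HFc]].
  exists D, F. split; auto. split; auto. split; auto.
  set (k := fun z => (h z * cexp (F z))%C).
  (* The maximum is needed because [b] may lie on either side of 1: below it for the oscillation
     result in the typical case, above it when [h] is shown not to vanish. *)
  assert (Hk : forall z, Rmax b 1 < Re z -> cderiv k z (RtoC 0)).
  { intros z Hz. assert (Hz1 := Rle_lt_trans _ _ _ (Rmax_l _ _) Hz).
    assert (Hz2 := Rle_lt_trans _ _ _ (Rmax_r _ _) Hz).
    replace (RtoC 0) with (- ((1 + z * D z) * h z) * cexp (F z) + h z * (cexp (F z) * q z))%C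
      by (unfold q; ring).
    apply (cderiv_mult h (fun z => cexp (F z))).
    - apply log_deriv; auto.
    - apply (cderiv_comp cexp F); [apply cderiv_cexp | auto]. }
  assert (E0 : k (x0, c) = h (x0, c)).
  { unfold k. rewrite HFc. unfold Cint. rewrite !(RInt_point (V := R_CompleteNormedModule)).
    change (h (x0, c) * cexp (RtoC 0) = h (x0, c))%C. rewrite cexp_0. ring. }
  intros z Hz. rewrite <- E0. apply Ceq_minus.
  apply (holo_vanish b (Rmax b 1) (fun z => k z - k (x0, c))%C); auto.
  - apply holo_minus; [|apply holo_const]. apply holo_mult.
    + intros s Hs. apply Hh. lra.
    + apply holo_cexp. intros s Hs. exists (q s). apply HF, Hs.
  - intros s Hs.
    assert (Hx : Rmax b 1 < Re (x0, c)) by (simpl; apply Rmax_lub_lt; auto).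
    rewrite (cderiv_0_const (Rmax b 1) k Hk (x0, c) s) by auto. ring.
Qed.

(** Provides the nonzero constant of the continuation identity: [h exp(F)] is constant on
    half-planes inside [Re s > 1], so one zero would propagate everywhere there and contradict
    [h 1 <> 0] by continuity. *)
Lemma h_nonzero z : 1 < Re z -> h z <> RtoC 0.
Proof.
  intros Hz E. apply Hh1.
  assert (H0 : forall w, 1 < Re w -> h w = RtoC 0).
  { intros w Hw. set (b := (1 + Rmin (Re z) (Re w)) / 2).
    assert (B : 1 < Rmin (Re z) (Re w)) by (apply Rmin_glb_lt; auto).
    assert (B1 := Rmin_l (Re z) (Re w)). assert (B2 := Rmin_r (Re z) (Re w)).
    destruct (psi_bound G zeta Hzeta b) as [M HM]; [unfold b; lra|].
    destruct (continuation b (M + 1) (b + 1) 0) as [D [F [_ [_ [_ K]]]]]; try (unfold b; lra).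
    { intros u Hu. unfold beurling_Delta. destruct (HM u Hu) as [M1 M2].
      assert (P : exp u <= exp (b * u)) by (apply exp_le; unfold b; nra).
      assert (Q := exp_pos u). apply Rabs_le. nra. }
    assert (Kz := K z ltac:(unfold b; lra)). assert (Kw := K w ltac:(unfold b; lra)).
    rewrite E in Kz. rewrite <- Kz in Kw.
    assert (N := cexp_neg_mult (F w)).
    replace (h w) with (h w * cexp (F w) * cexp (- F w))%C.
    - rewrite Kw. ring.
    - rewrite <- Cmult_assoc, (Cmult_comm (cexp (F w))), N. ring. }
  apply Cmod_small_eq0. intros eps He.
  destruct (Hh (RtoC 1)) as [l Hl]; [simpl; lra|].
  destruct (cderiv_continuous _ _ _ Hl eps He) as [d [Hd Hc]].
  specialize (Hc (RtoC (1 + d / 2))). rewrite H0 in Hc by (simpl; lra).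
  apply Rlt_le. rewrite <- Cmod_opp. replace (- h (RtoC 1))%C with (RtoC 0 - h (RtoC 1))%C by ring.
  apply Hc. rewrite <- RtoC_minus, Cmod_R, Rabs_right; lra.
Qed.

(** * Oscillation at a zero *)

(** Two constants are kept apart: [M] holds from [u = 0] on and gives convergence of the transform,
    whereas [K], valid only beyond [U], carries the constant of the theorem. *)
Lemma Delta_exp_bound beta K : 0 < beta -> (exists X, forall x, X <= x -> Rabs (beurling_Delta G x) <= K * Rpower x beta) ->
  exists U M, 0 <= U /\ (forall u, 0 <= u -> Rabs (a u) <= M * exp (beta * u)) /\
    (forall u, U <= u -> Rabs (a u) <= K * exp (beta * u)).
Proof.
  intros Hbeta [X HX]. set (U := ln (Rmax 1 X)).
  assert (HmX := Rmax_l 1 X).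
  assert (HU : 0 <= U) by (unfold U; rewrite <- ln_1; apply ln_le; lra).
  assert (HU2 : forall u, U <= u -> Rabs (a u) <= K * exp (beta * u)).
  { intros u Hu. replace (exp (beta * u)) with (Rpower (exp u) beta)
      by (unfold Rpower; rewrite ln_exp; auto).
    apply HX. apply Rle_trans with (Rmax 1 X); [apply Rmax_r|].
    rewrite <- (exp_ln (Rmax 1 X)) by lra. apply exp_le; auto. }
  exists U, (beurling_psi G (exp U) + exp U + Rabs K). split; auto. split; auto.
  intros u Hu.
  assert (P0 : forall x, 0 <= beurling_psi G x).
  { intros x. apply (rsum_ge0 (von_mangoldt (G := G))). intros; apply mangoldt_ge0. }
  assert (PU := P0 (exp U)). assert (EU := exp_pos U). assert (Eb := exp_pos (beta * u)).
  assert (PK := Rabs_pos K).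
  destruct (Rle_dec U u) as [H|H].
  - eapply Rle_trans; [apply HU2; auto|]. apply Rmult_le_compat_r; [lra|].
    assert (Q := Rle_abs K). lra.
  - assert (Hm : beurling_psi G (exp u) <= beurling_psi G (exp U)).
    { apply (rsum_ball_mono G (von_mangoldt (G := G))); [intros; apply mangoldt_ge0 | apply exp_le; lra]. }
    assert (Pu := P0 (exp u)). assert (Eu := exp_pos u).
    assert (Ee : exp u <= exp U) by (apply exp_le; lra).
    assert (E1 : 1 <= exp (beta * u)) by (rewrite <- exp_0; apply exp_le; nra).
    apply Rle_trans with ((beurling_psi G (exp U) + exp U + Rabs K) * 1).
    + rewrite Rmult_1_r. apply Rabs_le. unfold beurling_Delta. lra.
    + apply Rmult_le_compat_l; lra.
Qed.

Lemma is_RInt_Rabs_le (f g : R -> R) p q l m : p <= q -> (forall u, p <= u <= q -> Rabs (f u) <= g u) ->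
  is_RInt f p q l -> is_RInt g p q m -> Rabs l <= m.
Proof. intros H1 H2 H3 H4. eapply (norm_RInt_le (V := R_NormedModule)); eauto. Qed.

(** The Laplace bound for [|cos|] is a hypothesis, with [K2] independent of [r] and [T], so that
    both inequalities of the theorem are instances. *)
Lemma oscillation rho alpha c0 mu K2 :
  0 < Re rho -> theta < Re rho -> h rho = RtoC 0 ->
  Re rho = Cmod rho * cos alpha -> Im rho = Cmod rho * sin alpha ->
  0 <= c0 -> c0 * mu < 1 ->
  (forall r T, 0 < r -> 0 <= T ->
     RInt (fun u => exp (- r * u) * Rabs (cos (Im rho * u - alpha))) 0 T <= mu / r + K2) ->
  ~ exists X, forall x, X <= x ->
      Rabs (beurling_Delta G x) <= c0 / Cmod rho * Rpower x (Re rho).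
Proof.
  intros Hb0 Hb Hrho Hre Him Hc0 Hcmu Hcos HX.
  set (b := Re rho) in *. set (ga := Im rho) in *. set (m := Cmod rho) in *.
  assert (Hm : 0 < m).
  { unfold m. apply Cmod_gt_0. intros E. unfold b in Hb0. rewrite E in Hb0. simpl in Hb0. lra. }
  destruct (Delta_exp_bound b (c0 / m) Hb0 HX) as [U [M [HU [HM HMU]]]].
  (* Since [b > 0], this abscissa exceeds 1 and [h] is nonzero above it; the offset 2 is the range
     of [r] in the estimate of [s D(s)]. *)
  set (x0 := b + 2).
  destruct (continuation b M x0 ga) as [D [F [HD [HDh [HF HK]]]]]; auto; try (unfold x0; lra).
  assert (HM0 : 0 <= M).
  { assert (P := Rle_trans _ _ _ (Rabs_pos _) (HM 0 (Rle_refl 0))).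
    rewrite Rmult_0_r, exp_0, Rmult_1_r in P. exact P. }
  (* The three errors bounded independently of [r]: the range [[0, U]], where only [M] is available
     and [|s| <= b + 2 + |ga|]; the constant [K2]; and the effect of having [s = rho + r] in place
     of [rho] as a factor. *)
  set (K := U * (M * (b + 2 + Rabs ga)) + c0 * K2 + c0 / m).
  assert (Hcm : 0 <= c0 / m) by (apply Rmult_le_pos; auto; apply Rlt_le, Rinv_0_lt_compat; auto).
  assert (Hq : forall r, 0 < r <= 2 -> - (c0 * mu / r + K) <= Re (((b + r)%R, ga) * D ((b + r)%R, ga))%C).
  { intros r Hr. set (s := ((b + r)%R, ga) : C).
    apply clim_Re_ge with (fun T => s * lap a s T)%C U.
    { apply clim_scal, HD. simpl. lra. }
    intros T HT.
    assert (Xs : forall p q, 0 <= p -> 0 <= q -> ex_RInt (fun u => Re (s * (RtoC (a u) * cexp (RtoC u * - s)))%C) p q).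
    { intros p q Hp Hq. assert (Y := Cint_correct _ _ _ (lap_ex a s p q (loc_int_Delta G) Hp Hq)).
      apply (is_Cint_scal s) in Y. apply is_Cint_ex in Y. exact (proj1 Y). }
    assert (Er : Re (s * lap a s T) = RInt (fun u => Re (s * (RtoC (a u) * cexp (RtoC u * - s)))%C) 0 T).
    { assert (Y := Cint_correct _ _ _ (lap_ex a s 0 T (loc_int_Delta G) (Rle_refl 0) ltac:(lra))).
      apply (is_Cint_scal s) in Y. destruct Y as [Y _].
      symmetry. apply (is_RInt_unique (V := R_CompleteNormedModule)). exact Y. }
    rewrite Er.
    (* In [s = rho + r] the part [rho] yields [m cos (ga u - alpha)], whose [m] cancels the
       denominator of the assumed bound, and the part [r] yields [r cos (ga u)], harmless because
       [r] times the integral of [exp (- r u)] stays bounded. *)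
    assert (Ept : forall u, Re (s * (RtoC (a u) * cexp (RtoC u * - s)))%C
       = a u * exp (- (b + r) * u) * (m * cos (ga * u - alpha) + r * cos (ga * u))).
    { intros u. unfold s, cexp. rewrite Re_scal_R, Im_scal_R. simpl.
      replace (u * - (b + r)) with (- (b + r) * u) by ring.
      replace (u * - ga) with (- (ga * u)) by ring. rewrite cos_neg, sin_neg, cos_minus.
      transitivity (beurling_Delta G (exp u) * exp (- (b + r) * u)
        * ((m * cos alpha) * cos (ga * u) + (m * sin alpha) * sin (ga * u) + r * cos (ga * u))).
      - rewrite <- Hre, <- Him. ring.
      - ring. }
    assert (B1 : Rabs (RInt (fun u => Re (s * (RtoC (a u) * cexp (RtoC u * - s)))%C) 0 U) <= U * (M * (b + 2 + Rabs ga))).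
    { replace (U * (M * (b + 2 + Rabs ga))) with ((U - 0) * (M * (b + 2 + Rabs ga))) by ring.
      apply abs_RInt_le_const; auto; [apply Xs; lra|]. intros u Hu.
      eapply Rle_trans; [apply Re_le_Cmod|]. assert (Ei := Cmod_lap_integrand a s u). simpl in Ei.
      rewrite Cmod_mult, Ei, Rmult_comm.
      apply Rmult_le_compat.
      - apply Rmult_le_pos; [apply Rabs_pos | apply Rlt_le, exp_pos].
      - apply Cmod_ge_0.
      - apply Rle_trans with (M * exp (b * u) * exp (- Re s * u)).
        + apply Rmult_le_compat_r; [apply Rlt_le, exp_pos | apply HM; lra].
        + rewrite Rmult_assoc, <- exp_plus. replace M with (M * 1) at 2 by ring.
          apply Rmult_le_compat_l; auto. rewrite <- exp_0. apply exp_le. unfold s; simpl. nra.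
      - eapply Rle_trans; [apply Cmod_le_Re_Im|]. unfold s; simpl. rewrite Rabs_right by lra. lra. }
    assert (Xc : forall p q, ex_RInt (fun u => exp (- r * u) * Rabs (cos (ga * u - alpha))) p q).
    { intros p q. apply (ex_RInt_continuous (V := R_CompleteNormedModule)). intros t _.
      apply (continuous_mult (K := R_AbsRing)).
      - apply (ex_derive_continuous (V := R_NormedModule)). auto_derive. auto.
      - apply (continuous_comp (fun u => cos (ga * u - alpha)) Rabs).
        + apply (ex_derive_continuous (V := R_NormedModule)). auto_derive. auto.
        + apply continuous_Rabs. }
    set (g := fun u => c0 * (exp (- r * u) * Rabs (cos (ga * u - alpha))) + (c0 / m * r) * exp (- r * u)).
    assert (Ig : forall p q, is_RInt g p q (c0 * RInt (fun u => exp (- r * u) * Rabs (cos (ga * u - alpha))) p q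
       + (c0 / m * r) / r * (exp (- r * p) - exp (- r * q)))).
    { intros p q. apply (is_RInt_plus (V := R_NormedModule)).
      - apply (is_RInt_scal (V := R_NormedModule)). apply (RInt_correct (V := R_CompleteNormedModule)). apply Xc.
      - apply is_RInt_exp_decay. lra. }
    assert (Hg0 : forall u, 0 <= g u).
    { intros u. unfold g. assert (P := exp_pos (- r * u)). assert (Q := Rabs_pos (cos (ga * u - alpha))).
      assert (0 <= c0 / m * r) by (apply Rmult_le_pos; lra).
      assert (0 <= exp (- r * u) * Rabs (cos (ga * u - alpha))) by (apply Rmult_le_pos; lra).
      assert (0 <= c0 * (exp (- r * u) * Rabs (cos (ga * u - alpha)))) by (apply Rmult_le_pos; lra).
      assert (0 <= c0 / m * r * exp (- r * u)) by (apply Rmult_le_pos; lra). lra. }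
    assert (B2 : Rabs (RInt (fun u => Re (s * (RtoC (a u) * cexp (RtoC u * - s)))%C) U T) <= RInt g U T).
    { apply is_RInt_Rabs_le with (fun u => Re (s * (RtoC (a u) * cexp (RtoC u * - s)))%C) g U T; auto.
      - intros u Hu. rewrite Ept, !Rabs_mult. rewrite (Rabs_right (exp _)) by (apply Rle_ge, Rlt_le, exp_pos).
        apply Rle_trans with ((c0 / m * exp (b * u)) * exp (- (b + r) * u) * (m * Rabs (cos (ga * u - alpha)) + r)).
        + apply Rmult_le_compat.
          * apply Rmult_le_pos; [apply Rabs_pos | apply Rlt_le, exp_pos].
          * apply Rabs_pos.
          * apply Rmult_le_compat_r; [apply Rlt_le, exp_pos | apply HMU; lra].
          * eapply Rle_trans; [apply Rabs_triang|]. rewrite !Rabs_mult, (Rabs_right m), (Rabs_right r) by lra.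
            assert (Rabs (cos (ga * u)) <= 1) by (apply Rabs_le, COS_bound). nra.
        + right. rewrite (Rmult_assoc (c0 / m)), <- exp_plus. replace (b * u + - (b + r) * u) with (- r * u) by ring.
          unfold g. field. lra.
      - apply (RInt_correct (V := R_CompleteNormedModule)). apply Xs; lra.
      - apply (RInt_correct (V := R_CompleteNormedModule)). eexists; apply Ig. }
    (* Nonnegativity of [g] allows the integral to start at 0, where the hypothesis on [|cos|]
       starts. *)
    assert (B3 : RInt g U T <= RInt g 0 T).
    { rewrite <- (RInt_Chasles (V := R_CompleteNormedModule) g 0 U T) by (eexists; apply Ig).
      assert (0 <= RInt g 0 U) by (apply RInt_ge_0; auto; eexists; apply Ig).
      unfold plus; simpl. lra. }
    assert (B4 : RInt g 0 T <= c0 * mu / r + c0 * K2 + c0 / m).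
    { rewrite (is_RInt_unique (V := R_CompleteNormedModule) _ _ _ _ (Ig 0 T)).
      specialize (Hcos r T ltac:(lra) ltac:(lra)).
      apply Rmult_le_compat_l with (r := c0) in Hcos; auto.
      rewrite Rmult_plus_distr_l in Hcos. replace (c0 * (mu / r)) with (c0 * mu / r) in Hcos by (field; lra).
      rewrite Rmult_0_r, exp_0. assert (P := exp_pos (- r * T)).
      replace (c0 / m * r / r) with (c0 / m) by (field; lra).
      assert (c0 / m * (1 - exp (- r * T)) <= c0 / m * 1) by (apply Rmult_le_compat_l; lra).
      lra. }
    rewrite <- (RInt_Chasles (V := R_CompleteNormedModule) _ 0 U T) by (apply Xs; lra).
    match goal with |- _ <= plus ?A ?B => change (plus A B) with (A + B) end.
    apply Rcomplements.Rabs_le_between in B1. apply Rcomplements.Rabs_le_between in B2.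
    unfold K. lra. }
  set (H0 := h (x0, ga)).
  assert (HH0 : 0 < Cmod H0).
  { apply Cmod_gt_0. apply h_nonzero. simpl. unfold x0; lra. }
  assert (Erho : rho = (b, ga)) by (unfold b, ga; destruct rho; reflexivity).
  destruct (Hh rho Hb) as [l Hl]. destruct (Hl 1 Rlt_0_1) as [d [Hd Hld]].
  set (C1 := 1 + Cmod l). assert (HC1 : 1 <= C1) by (assert (P := Cmod_ge_0 l); unfold C1; lra).
  assert (Hsmall : forall r, 0 < r < d -> Cmod (h ((b + r)%R, ga)) <= C1 * r).
  { intros r Hr. assert (E : (((b + r)%R, ga) - rho)%C = RtoC r).
    { rewrite Erho. unfold Cminus, Cplus, Copp, RtoC; simpl. f_equal; ring. }
    assert (Y := Hld ((b + r)%R, ga)). rewrite E, Cmod_R, Rabs_right in Y by lra.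
    specialize (Y ltac:(lra)). rewrite Hrho in Y.
    replace (h ((b + r)%R, ga)) with ((h ((b + r)%R, ga) - RtoC 0 - l * RtoC r) + l * RtoC r)%C by ring.
    eapply Rle_trans; [apply Cmod_triangle|]. rewrite Cmod_mult, Cmod_R, Rabs_right by lra.
    unfold C1. lra. }
  set (nu := c0 * mu) in *.
  (* [F] at [b + r] is minus the integral from [b + r] to [b + 2], and integrating [nu / (t - b)]
     produces [nu (ln 2 - ln r)]. The form [K + Rabs K] covers both signs of [K]. *)
  assert (HReF : forall r, 0 < r < 1 -> Re (F ((b + r)%R, ga)) <= nu * (ln 2 - ln r) + (K + Rabs K) * 2).
  { intros r Hr. rewrite HF. unfold Cint; simpl.
    assert (Xq : ex_RInt (fun t => Re (1 + (t, ga) * D (t, ga))%C) (b + r) x0).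
    { apply (proj1 (holo_hint b (fun z => 1 + z * D z)%C (b + r) x0 ga
        ltac:(apply holo_plus; [apply holo_const|]; apply holo_mult; [apply holo_id|auto])
        ltac:(lra) ltac:(unfold x0; lra))). }
    assert (Es := opp_RInt_swap (V := R_CompleteNormedModule) (fun t => Re (1 + (t, ga) * D (t, ga))%C) (b + r) x0 Xq).
    change (RInt (fun t => Re (1 + (t, ga) * D (t, ga))%C) x0 (b + r) <= nu * (ln 2 - ln r) + (K + Rabs K) * 2).
    rewrite <- Es.
    assert (Ib : is_RInt (fun t => - (nu / (t - b) + K)) (b + r) x0 (- (nu * (ln 2 - ln r) + K * (2 - r)))).
    { replace (- (nu * (ln 2 - ln r) + K * (2 - r))) with
        (minus (- (nu * ln (x0 - b) + K * x0)) (- (nu * ln (b + r - b) + K * (b + r)))).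
      2: { unfold minus, plus, opp, x0; simpl. replace (b + 2 - b) with 2 by ring.
           replace (b + r - b) with r by ring. ring. }
      apply (is_RInt_derive (V := R_CompleteNormedModule) (fun t => - (nu * ln (t - b) + K * t))).
      - intros t Ht. rewrite Rmin_left in Ht by (unfold x0; lra). auto_derive; [lra|]. field. lra.
      - intros t Ht. rewrite Rmin_left in Ht by (unfold x0; lra).
        apply (ex_derive_continuous (V := R_NormedModule)). auto_derive. lra. }
    assert (Le : - (nu * (ln 2 - ln r) + K * (2 - r)) <= RInt (fun t => Re (1 + (t, ga) * D (t, ga))%C) (b + r) x0).
    { rewrite <- (is_RInt_unique (V := R_CompleteNormedModule) _ _ _ _ Ib).
      apply RInt_le; auto; [unfold x0; lra | eexists; exact Ib |].
      intros t Ht. unfold x0 in Ht. specialize (Hq (t - b) ltac:(lra)).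
      replace (b + (t - b)) with t in Hq by ring.
      replace (Re (1 + (t, ga) * D (t, ga))%C) with (1 + Re ((t, ga) * D (t, ga))%C).
      - lra.
      - destruct (D (t, ga)). unfold Cplus, Cmult, RtoC, Re; simpl. ring. }
    match goal with |- opp ?A <= _ => change (opp A) with (- A) end.
    assert (Q := Rle_abs K). assert (P := Rabs_pos K).
    assert (K * (2 - r) <= (K + Rabs K) * 2).
    { destruct (Rle_dec 0 K) as [Hk|Hk]; [rewrite Rabs_right by lra; nra|]. rewrite Rabs_left by lra. nra. }
    lra. }
  set (C2 := C1 * exp (nu * ln 2 + (K + Rabs K) * 2)).
  (* For [r = exp (- T')] the two estimates combine into [|H0| <= C2 r^(1 - nu)], an exponential
     decay in [T']. The maximum defining [T'] ensures [r < 1] and [r < d]. *)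
  destruct (exp_decay_small C2 (1 - nu) (Cmod H0)) as [T [HT1 HT2]]; [lra | auto |].
  set (T' := Rmax T (Rmax 1 (1 - ln d))).
  assert (T1 : T <= T') by apply Rmax_l.
  assert (T2 : 1 <= T') by (eapply Rle_trans; [apply (Rmax_l 1 (1 - ln d)) | apply Rmax_r]).
  assert (T3 : 1 - ln d <= T') by (eapply Rle_trans; [apply (Rmax_r 1 (1 - ln d)) | apply Rmax_r]).
  set (r := exp (- T')).
  assert (Hr0 : 0 < r) by apply exp_pos.
  assert (Hr1 : r < 1) by (rewrite <- exp_0; apply exp_increasing; lra).
  assert (Hr2 : r < d) by (rewrite <- (exp_ln d) by auto; apply exp_increasing; lra).
  specialize (HK ((b + r)%R, ga) ltac:(simpl; lra)). fold H0 in HK.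
  assert (EC : Cmod H0 <= C2 * exp (- (1 - nu) * T')).
  { rewrite <- HK, Cmod_mult, Cmod_cexp.
    apply Rle_trans with (C1 * r * exp (nu * (ln 2 - ln r) + (K + Rabs K) * 2)).
    - apply Rmult_le_compat; [apply Cmod_ge_0 | apply Rlt_le, exp_pos | apply Hsmall; lra |].
      apply exp_le. apply HReF. lra.
    - right. unfold C2, r. rewrite ln_exp, !Rmult_assoc, <- !exp_plus. do 2 f_equal. ring. }
  assert (C2 * exp (- (1 - nu) * T') <= C2 * exp (- (1 - nu) * T)).
  { apply Rmult_le_compat_l; [unfold C2; apply Rmult_le_pos; [lra | apply Rlt_le, exp_pos]|].
    apply exp_le. nra. }
  lra.
Qed.

End Continuation.

(** * The mean of |cos| *)

Lemma RInt_Chasles_R (f : R -> R) a b c : ex_RInt f a b -> ex_RInt f b c ->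
  RInt f a c = RInt f a b + RInt f b c.
Proof. intros H1 H2. rewrite <- (RInt_Chasles (V := R_CompleteNormedModule) f a b c); auto. Qed.

Lemma RInt_periodic_shift (w : R -> R) P a b : (forall u, w (u + P) = w u) ->
  (forall u, continuous w u) -> RInt w (a + P) (b + P) = RInt w a b.
Proof.
  intros Hp Hc.
  assert (E := RInt_comp_lin (V := R_CompleteNormedModule) w 1 P a b
    (ex_RInt_continuous (V := R_CompleteNormedModule) _ _ _ (fun z _ => Hc z))).
  rewrite !Rmult_1_l in E. rewrite <- E. apply RInt_ext.
  intros x _. change (1 * w (1 * x + P) = w x). rewrite !Rmult_1_l. apply Hp.
Qed.

(** Zero mean makes the primitive periodic, so only [[0, P]] matters, and there [|w| <= 1] bounds it
    by the length. The mean may be computed from any [u0], which leaves room for a convenient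
    period. *)
Lemma periodic_primitive_bounded (w : R -> R) P u0 : 0 < P -> (forall u, w (u + P) = w u) ->
  (forall u, continuous w u) -> (forall u, Rabs (w u) <= 1) -> RInt w u0 (u0 + P) = 0 ->
  forall u, 0 <= u -> Rabs (RInt w 0 u) <= P.
Proof.
  intros HP Hp Hc Hb H0.
  assert (X : forall a b, ex_RInt w a b).
  { intros. apply (ex_RInt_continuous (V := R_CompleteNormedModule)). auto. }
  assert (HP0 : RInt w 0 P = 0).
  { assert (E := RInt_periodic_shift w P 0 u0 Hp Hc). rewrite Rplus_0_l in E.
    assert (C1 := RInt_Chasles_R w 0 u0 (u0 + P) (X _ _) (X _ _)).
    assert (C2 := RInt_Chasles_R w 0 P (u0 + P) (X _ _) (X _ _)). lra. }
  assert (HS : forall u, RInt w 0 (u + P) = RInt w 0 u).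
  { intros u. assert (E := RInt_periodic_shift w P 0 u Hp Hc). rewrite Rplus_0_l in E.
    rewrite (RInt_Chasles_R w 0 P (u + P)) by auto. lra. }
  assert (Hk : forall n u, 0 <= u <= INR n * P -> Rabs (RInt w 0 u) <= P).
  { induction n; intros u Hu.
    - simpl in Hu. replace u with 0 by lra. rewrite (RInt_point (V := R_CompleteNormedModule)).
      change (Rabs 0 <= P). rewrite Rabs_R0. lra.
    - rewrite S_INR in Hu. destruct (Rle_dec u P) as [H|H].
      + eapply Rle_trans; [apply abs_RInt_le_const with (M := 1); auto; lra|]. lra.
      + replace u with ((u - P) + P) by ring. rewrite HS. apply IHn. lra. }
  intros u Hu. destruct (Rcomplements.nfloor_ex (u / P)) as [n Hn].
  { apply Rmult_le_pos; auto. apply Rlt_le, Rinv_0_lt_compat; auto. }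
  apply (Hk (S n)). split; auto. rewrite S_INR.
  apply Rmult_le_reg_r with (/ P); [apply Rinv_0_lt_compat; auto|].
  rewrite Rmult_assoc, Rinv_r by lra. unfold Rdiv in Hn. lra.
Qed.

Lemma continuous_abs_cos ga al u : continuous (fun u => Rabs (cos (ga * u - al))) u.
Proof.
  apply (continuous_comp (fun u => cos (ga * u - al)) Rabs).
  - apply (ex_derive_continuous (V := R_NormedModule)). auto_derive. auto.
  - apply continuous_Rabs.
Qed.

(* [|cos|] exceeds its mean [2/PI] by the derivative of a bounded function, so
   its Laplace transform exceeds [(2/PI)/r] by a bounded amount only. *)
Lemma abs_cos_laplace_pos ga al : 0 < ga -> exists K, forall r T, 0 < r -> 0 <= T ->
  RInt (fun u => exp (- r * u) * Rabs (cos (ga * u - al))) 0 T <= (2 / PI) / r + K.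
Proof.
  intros Hga. assert (HPI := PI_RGT_0).
  assert (HPI2 : 2 < PI) by (assert (Q := PI2_1); lra).
  set (P := PI / ga). assert (HP : 0 < P) by (apply Rdiv_lt_0_compat; lra).
  set (w := fun u => Rabs (cos (ga * u - al)) - 2 / PI).
  assert (Hc : forall u, continuous w u).
  { intros u. apply (continuous_minus (V := R_NormedModule)); [apply continuous_abs_cos | apply continuous_const]. }
  assert (Hper : forall u, w (u + P) = w u).
  { intros u. unfold w. replace (ga * (u + P) - al) with ((ga * u - al) + PI) by (unfold P; field; lra).
    rewrite neg_cos, Rabs_Ropp. auto. }
  assert (H2P : 0 < 2 / PI < 1).
  { split; [apply Rdiv_lt_0_compat; lra|]. apply Rmult_lt_reg_r with PI; auto.
    unfold Rdiv. rewrite Rmult_assoc, Rinv_l by lra. lra. }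
  assert (Hb : forall u, Rabs (w u) <= 1).
  { intros u. unfold w. assert (A := Rabs_pos (cos (ga * u - al))).
    assert (B : Rabs (cos (ga * u - al)) <= 1) by (apply Rabs_le, COS_bound).
    apply Rabs_le. lra. }
  (* From [u0] to [u0 + P] the phase runs from [- PI / 2] to [PI / 2], where [|cos| = cos]. *)
  set (u0 := (al - PI / 2) / ga).
  assert (H0 : RInt w u0 (u0 + P) = 0).
  { apply (is_RInt_unique (V := R_CompleteNormedModule)).
    apply is_RInt_ext with (fun u => cos (ga * u - al) - 2 / PI).
    - intros u Hu. rewrite Rmin_left, Rmax_right in Hu by lra. unfold w. f_equal.
      symmetry. apply Rabs_right, Rle_ge, cos_ge_0.
      + replace (- (PI / 2)) with (ga * u0 - al) by (unfold u0; field; lra). nra.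
      + replace (PI / 2) with (ga * (u0 + P) - al) by (unfold u0, P; field; lra). nra.
    - replace 0 with (minus (sin (ga * (u0 + P) - al) / ga - 2 / PI * (u0 + P))
         (sin (ga * u0 - al) / ga - 2 / PI * u0)).
      2: { replace (ga * u0 - al) with (- (PI / 2)) by (unfold u0; field; lra).
           replace (ga * (u0 + P) - al) with (PI / 2) by (unfold u0, P; field; lra).
           rewrite sin_neg, sin_PI2. unfold minus, plus, opp; simpl. unfold P. field. lra. }
      apply (is_RInt_derive (V := R_CompleteNormedModule) (fun u => sin (ga * u - al) / ga - 2 / PI * u)).
      + intros u _. auto_derive; auto. unfold Rminus. field. lra.
      + intros u _. apply (ex_derive_continuous (V := R_NormedModule)). auto_derive. auto. }
  set (W := (fun u => RInt w 0 u) : R -> R).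
  assert (HW : forall u, 0 <= u -> Rabs (W u) <= P).
  { exact (periodic_primitive_bounded w P u0 HP Hper Hc Hb H0). }
  assert (DW : forall u, is_derive W u (w u)).
  { intros u. apply (is_derive_RInt (V := R_NormedModule) w W 0 u); auto.
    exists (mkposreal 1 Rlt_0_1). intros y _. apply (RInt_correct (V := R_CompleteNormedModule)).
    apply (ex_RInt_continuous (V := R_CompleteNormedModule)). auto. }
  exists P. intros r T Hr HT.
  (* [dPhi] is the derivative of [exp (- r * u) * (W u - kap)]. It exceeds the integrand by
     [r exp (- r u) (P - W u) >= 0], and its integral is at most [kap] because [W 0 = 0] and
     [W T <= P <= kap]. *)
  set (kap := P + 2 / PI / r).
  set (dPhi := fun u => exp (- r * u) * w u + (- r * exp (- r * u)) * W u + kap * r * exp (- r * u)).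
  assert (IPhi : is_RInt dPhi 0 T (minus (exp (- r * T) * W T - kap * exp (- r * T)) (exp (- r * 0) * W 0 - kap * exp (- r * 0)))).
  { apply (is_RInt_derive (V := R_CompleteNormedModule) (fun u => exp (- r * u) * W u - kap * exp (- r * u))).
    - intros u _. unfold dPhi.
      assert (De : is_derive (fun u => exp (- r * u)) u (- r * exp (- r * u))) by (auto_derive; auto; ring).
      replace (exp (- r * u) * w u + - r * exp (- r * u) * W u + kap * r * exp (- r * u))
        with (minus (plus (mult (- r * exp (- r * u)) (W u)) (mult (exp (- r * u)) (w u))) (scal kap (- r * exp (- r * u)))).
      2: { unfold minus, plus, opp, mult, scal; simpl. unfold mult; simpl. ring. }
      apply (is_derive_minus (V := R_NormedModule) (fun u => exp (- r * u) * W u) (fun u => kap * exp (- r * u))).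
      + apply (is_derive_mult (K := R_AbsRing) (fun u => exp (- r * u)) W); [exact De | apply DW | exact Rmult_comm].
      + apply (is_derive_scal (fun u => exp (- r * u))). auto.
    - intros u _. unfold dPhi.
      assert (Ce : continuous (fun u => exp (- r * u)) u).
      { apply (ex_derive_continuous (V := R_NormedModule)). auto_derive. auto. }
      assert (Cw : continuous W u).
      { apply (ex_derive_continuous (V := R_NormedModule)). eexists; apply DW. }
      apply (continuous_plus (V := R_NormedModule)); [apply (continuous_plus (V := R_NormedModule))|].
      + apply (continuous_mult (K := R_AbsRing)); auto.
      + apply (continuous_mult (K := R_AbsRing)); auto.
        apply (continuous_scal_r (V := R_NormedModule)); auto.
      + apply (continuous_scal_r (V := R_NormedModule) (kap * r)); auto. }
  apply Rle_trans with (RInt dPhi 0 T).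
  - apply RInt_le; auto.
    + apply (ex_RInt_continuous (V := R_CompleteNormedModule)). intros u _.
      apply (continuous_mult (K := R_AbsRing)); [|apply continuous_abs_cos].
      apply (ex_derive_continuous (V := R_NormedModule)). auto_derive. auto.
    + eexists; exact IPhi.
    + intros u Hu. unfold dPhi.
      replace (Rabs (cos (ga * u - al))) with (w u + 2 / PI) by (unfold w; ring).
      replace (kap * r * exp (- r * u)) with (P * r * exp (- r * u) + 2 / PI * exp (- r * u)).
      2: { unfold kap. field. lra. }
      assert (HWu := HW u ltac:(lra)). apply Rcomplements.Rabs_le_between in HWu.
      assert (E := exp_pos (- r * u)). assert (0 < r * exp (- r * u)) by (apply Rmult_lt_0_compat; auto).
      nra.
  - rewrite (is_RInt_unique (V := R_CompleteNormedModule) _ _ _ _ IPhi).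
    assert (W0 : W 0 = 0) by (apply (RInt_point (V := R_CompleteNormedModule))).
    rewrite W0, !Rmult_0_r, exp_0.
    assert (HWT := HW T HT). apply Rcomplements.Rabs_le_between in HWT.
    assert (E := exp_pos (- r * T)). assert (Q : 0 < 2 / PI / r) by (apply Rdiv_lt_0_compat; lra).
    unfold minus, plus, opp; simpl. unfold kap. nra.
Qed.

Lemma abs_cos_laplace ga al : ga <> 0 -> exists K, forall r T, 0 < r -> 0 <= T ->
  RInt (fun u => exp (- r * u) * Rabs (cos (ga * u - al))) 0 T <= (2 / PI) / r + K.
Proof.
  intros Hga. destruct (Rlt_dec 0 ga) as [H|H]; [apply abs_cos_laplace_pos; auto|].
  destruct (abs_cos_laplace_pos (- ga) (- al)) as [K HK]; [lra|]. exists K.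
  intros r T Hr HT. specialize (HK r T Hr HT).
  rewrite (RInt_ext _ (fun u => exp (- r * u) * Rabs (cos (- ga * u - - al)))); auto.
  intros u _. f_equal. f_equal. rewrite <- cos_neg. f_equal. ring.
Qed.

Lemma abs_cos_laplace_trivial ga al r T : 0 < r -> 0 <= T ->
  RInt (fun u => exp (- r * u) * Rabs (cos (ga * u - al))) 0 T <= 1 / r + 0.
Proof.
  intros Hr HT.
  assert (I := is_RInt_exp_decay 1 r 0 T Hr).
  apply Rle_trans with (RInt (fun u => 1 * exp (- r * u)) 0 T).
  - apply RInt_le; auto.
    + apply (ex_RInt_continuous (V := R_CompleteNormedModule)). intros u _.
      apply (continuous_mult (K := R_AbsRing)); [|apply continuous_abs_cos].
      apply (ex_derive_continuous (V := R_NormedModule)). auto_derive. auto.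
    + eexists; exact I.
    + intros u _. rewrite Rmult_comm. apply Rmult_le_compat_r; [apply Rlt_le, exp_pos|].
      apply Rabs_le, COS_bound.
  - rewrite (is_RInt_unique (V := R_CompleteNormedModule) _ _ _ _ I).
    rewrite Rmult_0_r, exp_0. assert (E := exp_pos (- r * T)).
    assert (0 < 1 / r) by (apply Rdiv_lt_0_compat; lra). nra.
Qed.

(** On the right half-plane [atan (y / x)] is an argument, without distinction of cases. *)
Lemma polar_right z : 0 < Re z ->
  exists al, Re z = Cmod z * cos al /\ Im z = Cmod z * sin al.
Proof.
  destruct z as [x y]. simpl. intros Hx. exists (atan (y / x)).
  rewrite cos_atan, sin_atan.
  assert (E : Cmod (x, y) = x * sqrt (1 + (y / x)²)).
  { unfold Cmod; simpl. transitivity (sqrt (x²) * sqrt (1 + (y / x)²)); [|rewrite sqrt_Rsqr; lra].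
    rewrite <- sqrt_mult.
    - f_equal. unfold Rsqr. field. lra.
    - apply Rle_0_sqr.
    - assert (Q := Rle_0_sqr (y / x)). lra. }
  assert (S : 0 < sqrt (1 + (y / x)²)).
  { apply sqrt_lt_R0. assert (Q := Rle_0_sqr (y / x)). lra. }
  rewrite E. split; field; lra.
Qed.

Theorem theorem2 (G : arith_semigroup) (kappa A theta : R)
  (hkappa : 0 < kappa) (hA : 0 < A) (htheta : 0 < theta < 1)
  (hAxiomA : axiom_A G kappa A theta)
  (zeta : C -> C) (hzeta : is_beurling_zeta G theta zeta)
  (rho0 : C) (hpole : rho0 <> RtoC 1) (hzero : zeta rho0 = RtoC 0)
  (hbeta : theta < Re rho0) :
  (forall eps : R, 0 < eps ->
     forall X : R, exists x : R, X <= x /\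
       Rabs (beurling_Delta G x) >= (1 - eps) * (Rpower x (Re rho0) / Cmod rho0)) /\
  (Im rho0 <> 0 ->
   forall eps : R, 0 < eps ->
     forall X : R, exists x : R, X <= x /\
       Rabs (beurling_Delta G x) >= (PI / 2 - eps) * (Rpower x (Re rho0) / Cmod rho0)).
Proof.
  destruct hzeta as [Hz [h [Hh [Hh1 Hzh]]]].
  apply holomorphic_holo in Hh.
  assert (Hz' : forall s, 1 < Re s -> clim (zeta_partial G s) (zeta s)).
  { intros s Hs. apply filterlim_clim, Hz, Hs. }
  assert (Hb0 : 0 < Re rho0) by lra.
  assert (Hm : 0 < Cmod rho0).
  { apply Cmod_gt_0. intros E. rewrite E in Hb0. simpl in Hb0. lra. }
  assert (Hr : h rho0 = RtoC 0).
  { assert (N : (rho0 - 1)%C <> RtoC 0) by (intros E; apply hpole, Ceq_minus, E).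
    assert (E := Hzh rho0 hbeta hpole). rewrite hzero in E.
    replace (h rho0) with (h rho0 / (rho0 - 1) * (rho0 - 1))%C by (field; auto).
    rewrite <- E. ring. }
  destruct (polar_right rho0 Hb0) as [al [Hc Hs]].
  assert (Main : forall c mu K2, (0 <= c -> c * mu < 1) ->
    (forall r T, 0 < r -> 0 <= T ->
      RInt (fun u => exp (- r * u) * Rabs (cos (Im rho0 * u - al))) 0 T <= mu / r + K2) ->
    forall X, exists x, X <= x /\ Rabs (beurling_Delta G x) >= c * (Rpower x (Re rho0) / Cmod rho0)).
  { intros c mu K2 Hcm HK X. apply NNPP. intros Hn.
    assert (Hlt : forall x, X <= x -> Rabs (beurling_Delta G x) < c * (Rpower x (Re rho0) / Cmod rho0)).
    { intros x Hx. apply Rnot_ge_lt. intros Hge. apply Hn. exists x; auto. }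
    (* For large [eps] the constant is negative and any [x] satisfies the inequality; the assumed
       failure therefore excludes this case. *)
    assert (Hc0 : 0 <= c).
    { apply Rnot_lt_le. intros Hneg. assert (Q := Hlt X (Rle_refl X)).
      assert (P := Rabs_pos (beurling_Delta G X)).
      assert (P2 : 0 < Rpower X (Re rho0) / Cmod rho0) by (apply Rdiv_lt_0_compat; auto; apply exp_pos).
      nra. }
    apply (oscillation G theta (proj2 htheta) zeta h Hz' Hh Hh1 Hzh rho0 al c mu K2); auto.
    exists X. intros x Hx. apply Rlt_le. eapply Rlt_le_trans; [apply Hlt; auto|].
    right. field. lra. }
  split.
  - intros eps He. apply (Main (1 - eps) 1 0).
    + intros; lra.
    + intros; apply abs_cos_laplace_trivial; auto.
  - intros Hg eps He. destruct (abs_cos_laplace (Im rho0) al Hg) as [K HK].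
    apply (Main (PI / 2 - eps) (2 / PI) K); auto.
    intros _. assert (HPI := PI_RGT_0).
    replace ((PI / 2 - eps) * (2 / PI)) with (1 - eps * (2 / PI)) by (field; lra).
    assert (0 < 2 / PI) by (apply Rdiv_lt_0_compat; lra). nra.
Qed.
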